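(* Let $V:\mathbb{R}\to\mathbb{R}$ be a potential with logarithmic energy $E=E_V$ and equilibrium measure $\mu_V$. (1) If $V$ is $C^2$ and $V(x)-\rho x^2$ is convex for some $\rho>0$, then for any probability measure $\mu$ on $\mathbb{R}$, $$\rho\, W_2^2(\mu,\mu_V)\le E(\mu)-E(\mu_V).$$ If $V(x)=\rho x^2$, then equality is attained for the measures $\mu=\theta_\#\mu_V$ with $\theta(x)=x+m$ ($m\in\mathbb{R}$); therefore the constant $\rho$ in front of $W_2^2(\mu,\mu_V)$ is sharp. (2) Assume that $V$ is $C^2$, convex, and $V''(x)\ge\rho>0$ for all $|x|\ge r$. Then there is a constant $C=C(r,\rho,\mu_V,V)>0$ such that for any probability measure $\mu$ on $\mathbb{R}$, $$C\, W_2^2(\mu,\mu_V)\le E(\mu)-E(\mu_V).$$ (3) If $V$ is $C^2$ and $V(x)-\rho|x|^p$ is convex for some $\rho>0$ and some real number $p>1$, then for any probability measure $\mu$ on $\mathbb{R}$, $$c_p\,\rho\, W_p^p(\mu,\mu_V)\le E(\mu)-E(\mu_V),$$ where $c_p=\inf_{x\in\mathbb{R}}\left(|1+x|^p-|x|^p-p\,\mathrm{sign}(x)|x|^{p-1}\right)>0$.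
   Context: A potential is a lower semicontinuous function $V:\mathbb{R}\to\mathbb{R}$ with $\lim_{|x|\to\infty}(V(x)-2\log|x|)=\infty$. For a probability measure $\mu$ on $\mathbb{R}$, $$E(\mu)=E_V(\mu)=\int V(x)\,\mu(dx)-\iint\log|x-y|\,\mu(dx)\mu(dy)$$ whenever both integrals exist and are finite, and $E(\mu)=+\infty$ otherwise. It is known that $E_V$ has a unique minimizer $\mu_V$ among all probability measures on $\mathbb{R}$, called the equilibrium measure, and that it is compactly supported. For $p\ge1$, $W_p(\mu,\nu)=\inf_{\pi\in\Pi(\mu,\nu)}\left(\iint|x-y|^p\,\pi(dx,dy)\right)^{1/p}$, where $\Pi(\mu,\nu)$ is the set of probability measures on $\mathbb{R}^2$ with marginals $\mu$ and $\nu$. $\theta_\#\mu$ denotes the push-forward of $\mu$ by $\theta$. *)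

(* Defs.v *)
From HB Require Import structures.
From mathcomp Require Import all_boot all_order all_algebra.
From mathcomp Require Import all_classical all_reals all_analysis.
From mathcomp Require Import measurable_realfun.

Set Implicit Arguments.
Unset Strict Implicit.
Unset Printing Implicit Defensive.

Import Order.TTheory GRing.Theory Num.Theory.
Import numFieldNormedType.Exports.

Local Open Scope classical_set_scope.
Local Open Scope ring_scope.

Definition potential (R : realType) (V : R -> R) : Prop :=
  [/\ lower_semicontinuous (EFin \o V),
      (V x - 2 * ln `|x|) @[x --> +oo] --> +oo &
      (V x - 2 * ln `|x|) @[x --> -oo] --> +oo].

Definition C2 (R : realType) (V : R -> R) : Prop :=
  [/\ forall x, derivable V x 1,
      forall x, derivable (V^`())%classic x 1 &
      continuous (V^`(2))%classic].

Definition convex_on_line (R : realType) (f : R -> R) : Prop :=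
  @convex_function R R^o [set: R^o] f.

(* [lne] takes the value -oo at 0, unlike [ln], so that atoms have infinite
   logarithmic energy. *)
Definition log_kernel (R : realType) (z : R * R) : \bar R :=
  lne (`|z.1 - z.2|)%:E.

Definition log_energy (R : realType) (V : R -> R) (mu : probability R R) :
    \bar R :=
  if `[< mu.-integrable [set: R] (EFin \o V) /\
         (mu \x mu)%E.-integrable [set: R * R] (@log_kernel R) >]
  then (\int[mu]_x (V x)%:E - \int[(mu \x mu)%E]_z log_kernel z)%E
  else +oo%E.

(* Uniqueness of the minimizer is a theorem for potentials, so it is not part
   of the definition. *)
Definition equilibrium_measure (R : realType) (V : R -> R)
    (muV : probability R R) : Prop :=
  forall mu : probability R R, (log_energy V muV <= log_energy V mu)%E.

Definition coupling (R : realType) (mu nu : probability R R)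
    (pi : probability (R * R)%type R) : Prop :=
  forall A : set R, measurable A ->
    pushforward pi fst A = mu A /\ pushforward pi snd A = nu A.

Definition wasserstein (R : realType) (p : R) (mu nu : probability R R) :
    \bar R :=
  ereal_inf [set poweR (\int[pi]_z (`|z.1 - z.2| `^ p)%:E)%E p^-1 |
             pi in coupling mu nu].

Definition translation (R : realType) (m : R) : R -> R := fun x => x + m.

Lemma measurable_translation (R : realType) (m : R) :
  measurable_fun [set: R] (translation m).
Proof. by apply: measurable_funD. Qed.

HB.instance Definition _ (R : realType) (m : R) :=
  isMeasurableFun.Build _ _ R R (translation m) (measurable_translation m).

(* The push-forward of [mu] by [translation m], with the canonical probability
   structure of [distribution]. *)
Definition translate (R : realType) (m : R) (mu : probability R R) :
    probability R R :=
  distribution mu (translation m).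

Definition cp (R : realType) (p : R) : R :=
  inf (range (fun x : R =>
    `|1 + x| `^ p - `|x| `^ p - p * Num.sg x * `|x| `^ (p - 1))).

(* Main.v *)
Require Import Defs.
From HB Require Import structures.
From mathcomp Require Import all_boot all_order all_algebra.
From mathcomp Require Import all_classical all_reals all_analysis.
From mathcomp Require Import measurable_realfun ring lra.

(** Let [X] and [Y] be the quantile functions of [muV] and [mu] on the unit
    interval. They are comonotone, so along the displacement interpolation
    [Z = (1 - t) X + t Y] the distance between two independent copies of [Z] is
    the interpolation of the distances for [X] and [Y]. Comparing the energy of
    the law of [Z] with the minimal energy and using the concavity of the
    logarithm gives, for every [t] in the open unit interval
    ([displacement_gap], [quantile_displacement_gap]),

      (integral of the convexity gap of [V] between [X] and [Y] at time [t])
      + (double integral of the concavity gap of [ln] at time [t])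
      <= t * (E (mu) - E (muV)),

    while the integral of [|X - Y| `^ p] bounds [W_p ^ p] from above because
    [(X, Y)] gives a coupling.

    If [V - rho |x| ^ p] is convex, the logarithmic gap is dropped, the first gap
    is at least [cp p * rho * t * (1 - t) ^ p * |X - Y| ^ p], and [t] tends to [0]
    ([powR_uniformly_convex], [transport_inequality]). When [p = 2] the constant
    is [rho] by a direct computation. Positivity of [cp p] holds for [p >= 2] by
    Clarkson's inequality, and a function [V] of class C2 forces [p >= 2], since
    its second differences at [0] are of order [h ^ 2] at most.

    If [V] is only convex with [V'' >= rho] far out, both gaps are kept at
    [t = 1/2], where the logarithmic one is at least [((a - b) / (a + b)) ^ 2 / 2]
    with [a = |X - X'|] and [b = |Y - Y'|]. Far out, the gap of [V] controls
    [(X - Y) ^ 2]. For bounded values one compares [X - Y] with [X' - Y'], where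
    [X'] falls near a point of positive curvature: the gap of [V] controls
    [X' - Y'], and the logarithmic gap controls the difference
    ([displacement_le_gaps], [midpoint_transport]). This needs that [muV] charges
    the neighbourhoods of a point where [V'' > 0] ([curvature_on_support]).
    Otherwise [V'' <= 0] almost everywhere for [muV]; replacing [muV] by the
    mixture of its translates by [h] and [- h] then raises the potential term by
    at most [o (h ^ 2)], but lowers the logarithmic term by a multiple of [h ^ 2].
    The latter comes from the positive definiteness of [- ln |x - y|] on bounded
    sets: up to an affine function of [|x - y|] it is a mixture of tents, that
    is, of autocorrelations of intervals ([tent_kernelE], [tent_shift_double],
    [kernel_corr_geom]).

    For [V = rho x ^ 2] the energy of the translate of [muV] by [m] is
    [E (muV) + 2 rho m a + rho m ^ 2], where [a] is the mean of [muV];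
    minimality gives [a = 0], and [W_2 ^ 2 = m ^ 2] because couplings with a given
    difference [m] of means cost at least [m ^ 2]. *)

Set Implicit Arguments.
Unset Strict Implicit.
Unset Printing Implicit Defensive.

Import Order.TTheory GRing.Theory Num.Theory.
Import numFieldNormedType.Exports.

Local Open Scope classical_set_scope.
Local Open Scope ring_scope.

(** * Laws of random variables and their logarithmic energy *)

(** The law of the random element [X] under [P]. Unlike [distribution], it takes
    a bare function and a proof of its measurability. *)
Definition law d (T : measurableType d) (R : realType) (P : probability T R)
    d' (T' : measurableType d') (X : T -> T') (mX : measurable_fun setT X) :
    probability T' R :=
  distribution P (mfun_Sub (mem_set mX)).

Section law.
Local Open Scope ereal_scope.
Context d (T : measurableType d) (R : realType) (P : probability T R).
Context d' (T' : measurableType d') (X : T -> T').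
Hypothesis mX : measurable_fun setT X.

Lemma ge0_integral_law (f : T' -> \bar R) : measurable_fun setT f ->
  (forall y, 0 <= f y) -> \int[law P mX]_y f y = \int[P]_x f (X x).
Proof. by move=> mf f0; rewrite ge0_integral_distribution. Qed.

Lemma integrable_law (f : T' -> \bar R) : measurable_fun setT f ->
  (law P mX).-integrable setT f <-> P.-integrable setT (f \o X).
Proof.
move=> mf; split => /integrableP[_ H]; apply/integrableP; split => //.
- exact: measurableT_comp.
- rewrite ge0_integral_law in H => //; exact: measurableT_comp.
- rewrite ge0_integral_law => //; exact: measurableT_comp.
Qed.

Lemma integral_law (f : T' -> \bar R) : measurable_fun setT f ->
  P.-integrable setT (f \o X) -> \int[law P mX]_y f y = \int[P]_x f (X x).
Proof. by move=> mf iX; rewrite integral_distribution. Qed.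

Lemma measurable_pair_map :
  measurable_fun setT (fun w : T * T => (X w.1, X w.2)).
Proof.
by apply: measurable_fun_pair;
  [exact: (measurableT_comp mX measurable_fst)|exact: (measurableT_comp mX measurable_snd)].
Qed.

Lemma law_product A : measurable A ->
  (law P mX \x law P mX) A = law (P \x P) measurable_pair_map A.
Proof.
move=> mA; apply: product_measure_unique => // B C mB mC.
rewrite /law /= /distribution /pushforward /=.
have -> : (fun w : T * T => (X w.1, X w.2)) @^-1` (B `*` C) =
  (X @^-1` B) `*` (X @^-1` C) by [].
by rewrite product_measure1E// -[X in measurable X]setTI; exact: mX.
Qed.

End law.

Lemma ae_eq_integrable d (T : measurableType d) (R : realType)
    (mu : {measure set T -> \bar R}) (f g : T -> \bar R) :
  measurable_fun setT g -> {ae mu, forall x, f x = g x} ->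
  mu.-integrable setT f -> mu.-integrable setT g.
Proof.
move=> mg fg /integrableP[mf iF]; apply/integrableP; split => //.
rewrite (ge0_ae_eq_integral (g := abse \o f)) => //.
- exact: measurableT_comp.
- exact: measurableT_comp.
- by move=> x _; exact: abse_ge0.
- by apply: filterS fg => x /= -> _.
Qed.

Section law_square.
Local Open Scope ereal_scope.
Context d (T : measurableType d) (R : realType) (P : probability T R).
Context d' (T' : measurableType d') (X : T -> T').
Hypothesis mX : measurable_fun setT X.

Lemma ge0_integral_law2 (f : T' * T' -> \bar R) : measurable_fun setT f ->
  (forall y, 0 <= f y) ->
  \int[law P mX \x law P mX]_y f y = \int[P \x P]_w f (X w.1, X w.2).
Proof.
move=> mf f0.
rewrite (@eq_measure_integral _ _ _ _ (law (P \x P) (measurable_pair_map mX))).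
  by rewrite ge0_integral_law.
by move=> A mA _; exact: law_product.
Qed.

Lemma integrable_law2 (f : T' * T' -> \bar R) : measurable_fun setT f ->
  (law P mX \x law P mX).-integrable setT f <->
  (P \x P).-integrable setT (fun w => f (X w.1, X w.2)).
Proof.
move=> mf; have mf' : measurable_fun setT (fun w : T * T => f (X w.1, X w.2)).
  exact: (measurableT_comp mf (measurable_pair_map mX)).
split => /integrableP[_ H]; apply/integrableP; split => //.
- by rewrite ge0_integral_law2 in H => //; exact: measurableT_comp.
- by rewrite ge0_integral_law2 => //; exact: measurableT_comp.
Qed.

Lemma integral_law2 (f : T' * T' -> \bar R) : measurable_fun setT f ->
  (P \x P).-integrable setT (fun w => f (X w.1, X w.2)) ->
  \int[law P mX \x law P mX]_y f y = \int[P \x P]_w f (X w.1, X w.2).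
Proof.
move=> mf iX.
rewrite (@eq_measure_integral _ _ _ _ (law (P \x P) (measurable_pair_map mX))).
  by rewrite integral_law.
by move=> A mA _; exact: law_product.
Qed.

End law_square.

Section energy.
Local Open Scope ereal_scope.
Context (R : realType).
Implicit Types (V : R -> R).

Lemma measurable_normrB d (T : measurableType d) (X : T -> R) :
  measurable_fun setT X ->
  measurable_fun setT (fun w : T * T => `|X w.1 - X w.2|%R).
Proof.
move=> mX; apply: measurableT_comp => //; apply: measurable_funB.
  exact: (measurableT_comp mX measurable_fst).
exact: (measurableT_comp mX measurable_snd).
Qed.

Lemma measurable_ln_dist d (T : measurableType d) (X : T -> R) :
  measurable_fun setT X ->
  measurable_fun setT (fun w : T * T => (ln `|X w.1 - X w.2|)%R).
Proof.
by move=> mX; apply: measurableT_comp => //; exact: measurable_normrB.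
Qed.

Lemma log_kernelE (z : R * R) : z.1 != z.2 ->
  log_kernel z = (ln `|z.1 - z.2|)%:E.
Proof. by move=> z12; rewrite /log_kernel lne_EFin// normr_gt0 subr_eq0. Qed.

Lemma measurable_neq_diag : measurable [set z : R * R | z.1 != z.2].
Proof.
have -> : [set z : R * R | z.1 != z.2] =
    (fun z : R * R => (z.1 - z.2)%R) @^-1` ~` [set 0%R].
  apply/seteqP; split=> z /=; first by move=> /negP z12 /subr0_eq z0; apply: z12; apply/eqP.
  by move=> z12; apply/negP => /eqP z0; apply: z12; rewrite z0 subrr.
rewrite -[X in measurable X]setTI; apply: measurable_funB => //.
exact: measurableC.
Qed.

Lemma measurable_log_kernel : measurable_fun setT (@log_kernel R).
Proof.
have -> : @log_kernel R = fun z =>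
    if z.1 != z.2 then (ln `|z.1 - z.2|)%:E else -oo.
  apply/funext => z; case: ifPn => [/log_kernelE//|].
  by rewrite negbK /log_kernel => /eqP ->; rewrite subrr normr0 le0_lneNy.
apply: measurable_fun_ifT => //.
  apply: (measurable_fun_bool true).
  by rewrite setTI; exact: measurable_neq_diag.
by apply/measurable_EFinP; exact: (measurable_ln_dist (@measurable_id _ R setT)).
Qed.

(** The law of [X] has finite energy, expressed on the space where [X] lives:
    [V (X)] is integrable and, for an independent copy [X'] of [X], almost
    surely [X != X'] with [ln |X - X'|] integrable. The middle clause is needed
    because [ln] takes the value [0] at [0], so that integrability of
    [ln |X - X'|] does not exclude atoms. *)
Definition finite_energy d (T : measurableType d) (P : probability T R)
    V (X : T -> R) :=
  [/\ P.-integrable setT (fun w => (V (X w))%:E),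
      {ae P \x P, forall w, X w.1 != X w.2} &
      (P \x P).-integrable setT (fun w => (ln `|X w.1 - X w.2|)%:E)].

Context d (T : measurableType d) (P : probability T R).

Lemma log_energy_law V (X : T -> R) (mV : measurable_fun setT V)
    (mX : measurable_fun setT X) : finite_energy P V X ->
  log_energy V (law P mX) = \int[P]_w (V (X w))%:E
    - \int[P \x P]_w (ln `|X w.1 - X w.2|)%:E.
Proof.
move=> [iV dX iX].
have mlV : measurable_fun setT (EFin \o V) by exact/measurable_EFinP.
have mlX : measurable_fun setT (fun w : T * T => log_kernel (X w.1, X w.2)).
  exact: (measurableT_comp measurable_log_kernel (measurable_pair_map mX)).
have aeE : ae_eq (P \x P) setT (fun w : T * T => (ln `|X w.1 - X w.2|)%:E)
    (fun w : T * T => log_kernel (X w.1, X w.2)).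
  by apply: filterS dX => w wX _; rewrite log_kernelE.
have iK : (P \x P).-integrable setT (fun w => log_kernel (X w.1, X w.2)).
  by apply: ae_eq_integrable iX => //; apply: filterS aeE => w /(_ I).
rewrite /log_energy; case: asboolP => [_|[]]; last first.
  split; first exact/integrable_law.
  by apply/integrable_law2 => //; exact: measurable_log_kernel.
rewrite integral_law// integral_law2//; last exact: measurable_log_kernel.
congr (_ - _); apply: ae_eq_integral => //.
- by apply/measurable_EFinP; exact: measurable_ln_dist.
- by apply: filterS aeE => w /[apply].
Qed.

Lemma finite_energy_law V (X : T -> R) (mV : measurable_fun setT V)
    (mX : measurable_fun setT X) :
  log_energy V (law P mX) != +oo -> finite_energy P V X.
Proof.
rewrite /log_energy; case: asboolP => [[iV iK] _|]; last by rewrite eqxx.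
have mlV : measurable_fun setT (EFin \o V) by exact/measurable_EFinP.
move/integrable_law : iV => /(_ mlV) iV.
move/integrable_law2 : iK => /(_ measurable_log_kernel) iK.
have dX : {ae P \x P, forall w : T * T, X w.1 != X w.2}.
  apply: filterS (integrable_ae measurableT iK) => w /= /(_ I).
  by apply: contraTneq => ->; rewrite /log_kernel subrr normr0 le0_lneNy.
split => //.
apply: ae_eq_integrable iK => //.
  by apply/measurable_EFinP; exact: measurable_ln_dist.
by apply: filterS dX => w wX; rewrite log_kernelE.
Qed.

(** Two probabilities that agree on measurable sets need not be equal as
    structures, but have the same energy. *)
Lemma eq_log_energy V (mu nu : probability R R) :
  (forall A, measurable A -> mu A = nu A) -> log_energy V mu = log_energy V nu.
Proof.
move=> munu.
have munu2 A : measurable A -> (mu \x mu) A = (nu \x nu) A.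
  apply: product_measure_unique => B C mB mC.
  by have /= -> := product_measure1E nu nu mB mC; rewrite !munu.
have E1 (f : R -> \bar R) : \int[mu]_x f x = \int[nu]_x f x.
  by apply: eq_measure_integral => A mA _; exact: munu.
have E2 (f : R * R -> \bar R) : \int[mu \x mu]_x f x = \int[nu \x nu]_x f x.
  by apply: eq_measure_integral => A mA _; exact: munu2.
have I1 (f : R -> \bar R) : mu.-integrable setT f <-> nu.-integrable setT f.
  split=> /integrableP[mf intf]; apply/integrableP; split => //.
    by rewrite -E1.
  by rewrite E1.
have I2 (f : R * R -> \bar R) :
    (mu \x mu).-integrable setT f <-> (nu \x nu).-integrable setT f.
  split=> /integrableP[mf intf]; apply/integrableP; split => //.
    by rewrite -E2.
  by rewrite E2.
rewrite /log_energy E1 E2; congr (if _ then _ else _).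
by apply/asbool_equiv_eq; split=> -[/I1 ? /I2 ?].
Qed.

End energy.

(** * Quantile functions *)

(** The uniform law on the unit interval. *)
Definition unif (R : realType) : probability (measurableTypeR R) R :=
  uniform_prob (@ltr01 R).

Section quantile.
Context (R : realType).

Lemma unifE (A : set (measurableTypeR R)) : measurable A ->
  unif R A = lebesgue_measure (A `&` `]0, 1[).
Proof.
move=> mA.
have -> : unif R A = (\int[unif R]_x (\1_A x)%:E)%E.
  by rewrite integral_indic// setIT.
rewrite integral_uniform//; last first.
  exact/measurable_EFinP/measurable_indic.
rewrite subr0 invr1 mul1e integral_itv_bndoo; last first.
  exact/measurable_funTS/measurable_EFinP/measurable_indic.
by rewrite integral_indic.
Qed.

Lemma ae_unif : {ae unif R, forall s, s \in `]0, 1[}.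
Proof.
exists (~` `]0, 1[); split => //; first exact: measurableC.
rewrite unifE; last exact: measurableC.
by rewrite setICl measure0.
Qed.

Variable mu : probability R R.

Let F (x : R) : R := fine (mu `]-oo, x]%classic).

Let FE x : (F x)%:E = mu `]-oo, x]%classic.
Proof. by rewrite fineK// fin_num_measure. Qed.

Let F_nd : {homo F : x y / x <= y}.
Proof.
move=> x y xy; rewrite -lee_fin !FE; apply: le_measure; rewrite ?inE//.
exact: subset_itvl.
Qed.

Let F_ge0 x : 0 <= F x. Proof. by rewrite fine_ge0. Qed.
Let F_le1 x : F x <= 1.
Proof. by rewrite -lee_fin FE; exact: probability_le1. Qed.

Let idX : {mfun R >-> R} := mfun_Sub (mem_set (@measurable_id _ R setT)).

Let cdfE : fine \o cdf (P := mu) idX = F.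
Proof. by []. Qed.

Let F_rc (x : R) : F y @[y --> x^'+] --> F x.
Proof.
rewrite -cdfE; apply: fine_cvg; rewrite /= FE.
exact: (@cdf_right_continuous _ _ _ mu idX x).
Qed.

Let F_y : F y @[y --> +oo] --> (1 : R).
Proof. by rewrite -cdfE; apply: fine_cvg; exact: cvg_cdfy1. Qed.

Let F_Ny : F y @[y --> -oo] --> (0 : R).
Proof. by rewrite -cdfE; apply: fine_cvg; exact: cvg_cdfNy0. Qed.

(** The generalized inverse of the distribution function [F] of [mu]. Outside
    the open unit interval, where the infimum may not exist, the value is [0];
    this set is negligible for [unif]. *)
Definition quantile (s : R) : R :=
  if s \in `]0, 1[ then inf [set x | s <= F x] else 0.

Let lb s : 0 < s -> has_lbound [set x | s <= F x].
Proof.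
move=> s0.
have : \forall x \near -oo, F x < s by apply: cvgr_lt F_Ny _ s0.
case=> M [_ HM]; exists (M - 1) => y /= sy.
rewrite leNgt; apply/negP => yM.
have := HM (M - 1); rewrite ltrBlDr ltrDl ltr01 => /(_ isT).
by apply/negP; rewrite -leNgt (le_trans sy)// F_nd// ltW.
Qed.

Let ne s : s < 1 -> [set x | s <= F x] !=set0.
Proof.
move=> s1.
have : \forall x \near +oo, s < F x by apply: cvgr_gt F_y _ s1.
case=> M [_ HM]; exists (M + 1) => /=.
by apply/ltW/HM; rewrite ltrDl.
Qed.

Let quantile_le s x : s \in `]0, 1[ -> (quantile s <= x) = (s <= F x).
Proof.
move=> s01; have := s01; rewrite in_itv/= => /andP[s0 s1].
rewrite /quantile s01; apply/idP/idP => [qx|sx]; last first.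
  by apply: ge_inf => //; exact: lb.
rewrite leNgt; apply/negP => Fxs.
have : \forall y \near x^'+, F y < s by apply: cvgr_lt (@F_rc x) _ Fxs.
move=> H; near x^'+ => y.
have xy : x < y by near: y; exact: nbhs_right_gt.
have [z /= sz zy] : exists2 z, s <= F z & z < y.
  have := @inf_adherent _ [set x | s <= F x] (y - inf [set x | s <= F x]).
  rewrite subr_gt0 (le_lt_trans qx xy) => /(_ isT) [|z sz zy].
    by split; [exact: ne|exact: lb].
  by exists z => //; rewrite (lt_le_trans zy)// addrC subrK.
have : F y < s by near: y.
by rewrite ltNge (le_trans sz)// F_nd// ltW.
Unshelve. all: by end_near. Qed.

Lemma quantile_nondecreasing :
  {in `]0, 1[ &, {homo quantile : s t / s <= t}}.
Proof.
by move=> s t s01 t01 st; rewrite quantile_le// (le_trans st)// -quantile_le.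
Qed.

Let preE (x : R) : (quantile @^-1` `]x, +oo[) `&` `]0, 1[ = `]F x, 1[%classic.
Proof.
apply/seteqP; split => s /=; rewrite !in_itv/= andbT.
  move=> [xs /[dup] s01 /andP[_ ->]]; rewrite andbT ltNge -quantile_le ?in_itv//.
  by rewrite -ltNge.
move=> /andP[Fs s1]; have s01 : s \in `]0, 1[.
  by rewrite in_itv/= s1 andbT (le_lt_trans _ Fs).
by rewrite s1 andbT (le_lt_trans _ Fs)// ltNge quantile_le// -ltNge.
Qed.

Lemma measurable_quantile :
  measurable_fun [set: measurableTypeR R] quantile.
Proof.
apply: (measurability _ (RGenOInfty.measurableE R)) => //.
move=> _ [_ [x ->] <-]; rewrite setTI.
rewrite -[X in measurable X](setIT _) -(setUv `]0, 1[%classic) setIUr preE.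
apply: measurableU => //.
have [x0|x0] := ltP x 0.
  rewrite (_ : _ `&` _ = ~` `]0, 1[%classic); first exact: measurableC.
  apply/seteqP; split => [s []//|s /= s01]; split => //.
  by rewrite /= /quantile ifN ?in_itv ?andbT//; apply/negP.
rewrite (_ : _ `&` _ = set0)//; apply/seteqP; split => s //= -[+ s01].
by rewrite /quantile (negbTE (introN idP s01)) in_itv/= andbT ltNge x0.
Qed.

(** [quantile mu] pushes the uniform law forward to [mu]. *)
Lemma law_quantile A : measurable A -> mu A = law (unif R) measurable_quantile A.
Proof.
move=> mA.
apply: (measure_unique (@RGenOInfty.G R) (fun n => `]- n%:R, +oo[%classic)) mA.
- exact: (RGenOInfty.measurableE R).
- move=> _ _ [x ->] [y ->]; exists (Num.max x y).
  apply/seteqP; split => z /=; rewrite !in_itv/= !andbT gt_max.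
    by move=> [-> ->].
  by move=> /andP[].
- by move=> n; exists (- n%:R).
- apply/seteqP; split => // x _; exists (Num.truncn `|x|).+1 => //=.
  rewrite in_itv/= andbT ltrNl; apply: le_lt_trans (truncnS_gt _).
  by rewrite lerNl; exact: lerNnormlW.
- move=> _ [x ->].
  transitivity (1 - (F x)%:E)%E.
    have := @probability_setC _ _ _ mu `]-oo, x]%classic (measurable_itv _).
    by rewrite -FE /= setCitvl => ->.
  rewrite /law /= /distribution /pushforward /=.
  rewrite unifE; last first.
    by rewrite -[X in measurable X]setTI; exact: measurable_quantile.
  rewrite preE lebesgue_measure_itv/= lte_fin.
  case: ltP => // h; have := F_le1 x; rewrite le_eqVlt ltNge h orbF => /eqP ->.
  by rewrite subee.
- by move=> n; rewrite (le_lt_trans (probability_le1 _ _))// ltry.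
Qed.

End quantile.

(** * Concavity of the logarithm and displacement interpolation *)

Lemma half01 (R : realType) : 0 <= (2^-1 : R) <= 1.
Proof. by apply/andP; split; lra. Qed.

Section ln_ineq.
Context (R : realType).
Implicit Types a b t x y : R.

Lemma ln_le_tangent x y : 0 < x -> 0 < y -> ln x <= ln y + (x / y - 1).
Proof.
move=> x0 y0; rewrite -lerBlDl -ln_div ?posrE//.
have : -1 < x / y - 1 by rewrite ltrBrDr addrC subrr divr_gt0.
by move=> /le_ln1Dx; rewrite addrC subrK.
Qed.

Lemma ln_conv_ge a b t : 0 < a -> 0 < b -> 0 < t < 1 ->
  (1 - t) * ln a + t * ln b <= ln ((1 - t) * a + t * b).
Proof.
move=> a0 b0 /andP[t0 t1].
have t1' : 0 < 1 - t by rewrite subr_gt0.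
set z := (1 - t) * a + t * b.
have z0 : 0 < z by rewrite addr_gt0// mulr_gt0.
have ha := ler_wpM2l (ltW t1') (ln_le_tangent a0 z0).
have hb := ler_wpM2l (ltW t0) (ln_le_tangent b0 z0).
apply: (le_trans (lerD ha hb)).
have -> : (1 - t) * (ln z + (a / z - 1)) + t * (ln z + (b / z - 1)) =
  ln z + (((1 - t) * a + t * b) / z - 1) by field; rewrite gt_eqF.
by rewrite divff ?gt_eqF// subrr addr0.
Qed.

(** Together with concavity this bounds [|ln c|], for [c] between [a] and [b],
    by [|ln a| + |ln b|], hence the integrability of interpolated logarithms. *)
Lemma ln_conv_le a b t : 0 < a -> 0 < b -> 0 < t < 1 ->
  ln ((1 - t) * a + t * b) <= `|ln a| + `|ln b|.
Proof.
move=> a0 b0 /andP[t0 t1]; have t1' : 0 < 1 - t by rewrite subr_gt0.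
have z0 : 0 < (1 - t) * a + t * b by rewrite addr_gt0// mulr_gt0.
have [ab|/ltW ba] := leP a b.
  apply: (@le_trans _ _ (ln b)); last by rewrite (le_trans (ler_norm _))// lerDr.
  by rewrite ler_ln ?posrE//; nra.
apply: (@le_trans _ _ (ln a)); last by rewrite (le_trans (ler_norm _))// lerDl.
by rewrite ler_ln ?posrE//; nra.
Qed.

(** Concavity of the logarithm at the midpoint, with a remainder. *)
Lemma ln_midpoint_gap a b : 0 < a -> 0 < b ->
  2^-1 * ln a + 2^-1 * ln b + 2^-1 * ((a - b) / (a + b)) ^+ 2 <=
  ln (2^-1 * a + 2^-1 * b).
Proof.
(* the tangent bound at the point [z ^ 2], evaluated at [a * b] *)
move=> a0 b0; set z := 2^-1 * a + 2^-1 * b.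
have z0 : 0 < z by rewrite addr_gt0// mulr_gt0// invr_gt0.
have ab : 0 < a * b by rewrite mulr_gt0.
have zz : 0 < z * z by rewrite mulr_gt0.
have := ln_le_tangent ab zz; rewrite !lnM ?posrE//.
have -> : a * b / (z * z) - 1 = - ((a - b) / (a + b)) ^+ 2.
  by rewrite /z; field; rewrite gt_eqF ?addr_gt0.
lra.
Qed.

End ln_ineq.

Section integrals.
Local Open Scope ereal_scope.
Context d (T : measurableType d) (R : realType).
Variable (P : {measure set T -> \bar R}).

Lemma EFin_Rintegral (f : T -> R) : P.-integrable setT (EFin \o f) ->
  (\int[P]_x f x)%R%:E = \int[P]_x (f x)%:E.
Proof. by move=> i; rewrite /Rintegral fineK// integrable_fin_num. Qed.

Lemma ge0_ae_le_integral_Rintegral (f g : T -> R) :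
  measurable_fun setT f -> (forall x, 0 <= f x)%R ->
  P.-integrable setT (EFin \o g) -> {ae P, forall x, (f x <= g x)%R} ->
  \int[P]_x (f x)%:E <= (\int[P]_x g x)%R%:E.
Proof.
move=> mf f0 ig fg; rewrite EFin_Rintegral//.
have mg : measurable_fun setT (EFin \o g) by case/integrableP : ig.
rewrite [leRHS](@ae_eq_integral _ _ _ _ _ (fun x => (Num.max 0 (g x))%:E))//.
- apply: ae_ge0_le_integral => //.
  + by move=> x _; rewrite lee_fin.
  + exact/measurable_EFinP.
  + by move=> x _; rewrite lee_fin le_max lexx.
  + apply/measurable_EFinP/measurable_maxr => //; exact/measurable_EFinP.
  + by apply: filterS fg => x fgx _; rewrite lee_fin le_max fgx orbT.
- apply/measurable_EFinP/measurable_maxr => //; exact/measurable_EFinP.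
- apply: filterS fg => x fgx _; congr EFin; apply/esym/max_idPr.
  exact: le_trans fgx.
Qed.

Lemma ae_le_integrable (f g : T -> R) :
  measurable_fun setT f ->
  P.-integrable setT (EFin \o g) -> {ae P, forall x, (`|f x| <= g x)%R} ->
  P.-integrable setT (EFin \o f).
Proof.
move=> mf ig fg; apply/integrableP; split; first exact/measurable_EFinP.
apply: le_lt_trans (ltry (\int[P]_x g x)%R).
apply: ge0_ae_le_integral_Rintegral => //.
exact: measurableT_comp.
Qed.

End integrals.

Section displacement.
Local Open Scope ereal_scope.
Context d (T : measurableType d) (R : realType) (P : probability T R).
Variables (V : R -> R) (X Y : T -> R) (t c : R).
Hypothesis mV : measurable_fun setT V.
Hypothesis V_ge : forall x, (c <= V x)%R.
Hypothesis mX : measurable_fun setT X.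
Hypothesis mY : measurable_fun setT Y.
Hypothesis XY : {ae P \x P, forall w,
  (0 <= (X w.1 - X w.2) * (Y w.1 - Y w.2))%R}.
Hypothesis t01 : (0 < t < 1)%R.
Hypothesis eX : finite_energy P V X.
Hypothesis eY : finite_energy P V Y.

(* displacement interpolation between [X] and [Y] *)
Let Z w := ((1 - t) * X w + t * Y w)%R.

Let mZ : measurable_fun setT Z.
Proof. by apply: measurable_funD; apply: measurable_funM. Qed.

Variables (H : T -> R) (K : T * T -> R).
Hypothesis mH : measurable_fun setT H.
Hypothesis mK : measurable_fun setT K.
Hypothesis H_ge0 : forall w, (0 <= H w)%R.
Hypothesis K_ge0 : forall w, (0 <= K w)%R.
Hypothesis HZ : forall w,
  (V (Z w) + H w <= (1 - t) * V (X w) + t * V (Y w))%R.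

Let a w : R := `|X w.1 - X w.2|%R.
Let b w : R := `|Y w.1 - Y w.2|%R.

Hypothesis KZ : forall w, (0 < a w)%R -> (0 < b w)%R ->
  ((1 - t) * ln (a w) + t * ln (b w) + K w <=
   ln ((1 - t) * a w + t * b w))%R.

(* comonotonicity makes the distance between two independent copies of [Z]
   the interpolation of the distances for [X] and for [Y] *)
Let good : {ae P \x P, forall w, [/\ (0 < a w)%R, (0 < b w)%R &
  `|Z w.1 - Z w.2|%R = ((1 - t) * a w + t * b w)%R]}.
Proof.
have [_ dX _] := eX; have [_ dY _] := eY.
apply: filterS3 XY dX dY => w xy dXw dYw; rewrite !normr_gt0 !subr_eq0; split => //.
have -> : (Z w.1 - Z w.2 = (1 - t) * (X w.1 - X w.2) + t * (Y w.1 - Y w.2))%R.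
  by rewrite /Z; ring.
rewrite /a /b.
move: xy; set x := (_ - _)%R; set y := (Y _ - _)%R => xy.
have /andP[t0 /ltW t1] := t01; rewrite -subr_ge0 in t1.
have [x0|x0] := leP 0%R x.
  have [y0|y0] := leP 0%R y; first by
    rewrite (ger0_norm x0) (ger0_norm y0) ger0_norm// addr_ge0// mulr_ge0// ltW.
  have x00 : x = 0%R.
    by apply/eqP; rewrite eq_le x0 andbT -(ler_nM2r y0) mul0r.
  by rewrite x00 normr0 mulr0 !add0r normrM gtr0_norm.
have y0 : (y <= 0)%R by rewrite -(ler_nM2l x0) mulr0.
rewrite (ltr0_norm x0) (ler0_norm y0) ler0_norm; first by rewrite opprD !mulrN.
by rewrite -oppr_ge0 opprD -!mulrN addr_ge0// mulr_ge0 ?oppr_ge0// ltW.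
Qed.

Let iVX : P.-integrable setT (EFin \o (fun w => V (X w))).
Proof. by case: eX. Qed.
Let iVY : P.-integrable setT (EFin \o (fun w => V (Y w))).
Proof. by case: eY. Qed.
Let ila : (P \x P).-integrable setT (EFin \o (fun w => ln (a w))).
Proof. by case: eX. Qed.
Let ilb : (P \x P).-integrable setT (EFin \o (fun w => ln (b w))).
Proof. by case: eY. Qed.

Let integrable_conv d' (T' : measurableType d')
    (Q : {measure set T' -> \bar R}) (f g : T' -> R) :
  Q.-integrable setT (EFin \o f) -> Q.-integrable setT (EFin \o g) ->
  Q.-integrable setT (EFin \o (fun w => (1 - t) * f w + t * g w)%R).
Proof.
move=> iF iG; have := integrableD measurableT
  (integrableZl measurableT (1 - t)%R iF) (integrableZl measurableT t iG).
by apply: eq_integrable.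
Qed.

Let Rintegral_conv d' (T' : measurableType d')
    (Q : {measure set T' -> \bar R}) (f g : T' -> R) :
  Q.-integrable setT (EFin \o f) -> Q.-integrable setT (EFin \o g) ->
  (\int[Q]_w ((1 - t) * f w + t * g w) =
   (1 - t) * \int[Q]_w f w + t * \int[Q]_w g w)%R.
Proof.
move=> iF iG; rewrite RintegralD ?RintegralZl//.
- exact: (integrableZl measurableT (1 - t)%R iF).
- exact: (integrableZl measurableT t iG).
Qed.

Let iVZ : P.-integrable setT (EFin \o (fun w => V (Z w))).
Proof.
apply: (@ae_le_integrable _ _ _ _ _
  (fun w => `|c| + `|(1 - t) * V (X w) + t * V (Y w)|)%R).
- exact: measurableT_comp mV mZ.
- have := integrableD measurableT
    (finite_measure_integrable_cst P `|c|%R measurableT)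
    (integrable_norm (integrable_conv iVX iVY)).
  by apply: eq_integrable.
- apply: aeW => w; rewrite ler_norml; apply/andP; split.
    rewrite opprD (le_trans _ (V_ge _))//.
    by rewrite (@le_trans _ _ (- `|c|)%R) ?gerDl ?oppr_le0// lerNnormlW.
  have := HZ w; have := H_ge0 w.
  have := ler_norm ((1 - t) * V (X w) + t * V (Y w))%R.
  have := normr_ge0 c; lra.
Qed.

Let ilZ : (P \x P).-integrable setT
  (EFin \o (fun w => ln `|Z w.1 - Z w.2|)%R).
Proof.
apply: (@ae_le_integrable _ _ _ _ _ (fun w => `|ln (a w)| + `|ln (b w)|)%R).
- exact: measurable_ln_dist.
- have := integrableD measurableT (integrable_norm ila) (integrable_norm ilb).
  by apply: eq_integrable.
- apply: filterS good => w [a0 b0 ->]; rewrite ler_norml ln_conv_le// andbT.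
  apply: le_trans (ln_conv_ge a0 b0 t01).
  have /andP[t0 t1] := t01.
  have ha : (- `|ln (a w)| <= (1 - t) * ln (a w))%R.
    have := ler_norm (- ln (a w)); rewrite normrN.
    have := ler_norm (ln (a w)); nra.
  have hb : (- `|ln (b w)| <= t * ln (b w))%R.
    have := ler_norm (- ln (b w)); rewrite normrN.
    have := ler_norm (ln (b w)); nra.
  by rewrite opprD lerD.
Qed.

Let eZ : finite_energy P V Z.
Proof.
split => //; apply: filterS good => w [a0 b0 zE].
have /andP[t0 t1] := t01.
by rewrite -subr_eq0 -normr_gt0 zE addr_gt0// mulr_gt0// subr_gt0.
Qed.

Hypothesis minX : forall nu : probability R R,
  log_energy V (law P mX) <= log_energy V nu.

(** If the law of [X] minimizes the energy, then the convexity gap [H] of [V] and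
    the concavity gap [K] of the logarithm along the interpolation are paid for
    by the energy difference: compare the minimal energy with that of [Z]. *)
Theorem displacement_gap :
  \int[P]_w (H w)%:E + \int[P \x P]_w (K w)%:E <=
  t%:E * (log_energy V (law P mY) - log_energy V (law P mX)).
Proof.
have minZ := minX (law P mZ); move: minZ.
rewrite !log_energy_law//.
have EV (W : T -> R) : P.-integrable setT (EFin \o (fun w => V (W w))) ->
  \int[P]_w (V (W w))%:E = (\int[P]_w V (W w))%R%:E.
  by move=> i; rewrite EFin_Rintegral.
have EL (W : T -> R) :
    (P \x P).-integrable setT (EFin \o (fun w => ln `|W w.1 - W w.2|)%R) ->
  \int[P \x P]_w (ln `|W w.1 - W w.2|)%:E =
  (\int[P \x P]_w ln `|W w.1 - W w.2|)%R%:E.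
  by move=> i; rewrite EFin_Rintegral.
rewrite !EV// !EL// -!EFinB -EFinM lee_fin.
set VX := (\int[P]_w V (X w))%R; set VY := (\int[P]_w V (Y w))%R.
set VZ := (\int[P]_w V (Z w))%R.
set LX := (\int[_]_w ln `|X _ - _|)%R; set LY := (\int[_]_w ln `|Y _ - _|)%R.
set LZ := (\int[_]_w ln `|Z _ - _|)%R => minZ.
have hH : \int[P]_w (H w)%:E <= ((1 - t) * VX + t * VY - VZ)%:E.
  rewrite -Rintegral_conv// -RintegralB//; last exact: integrable_conv.
  apply: ge0_ae_le_integral_Rintegral => //.
    have := integrableB measurableT (integrable_conv iVX iVY) iVZ.
    by apply: eq_integrable.
  by apply: aeW => w; have := HZ w; lra.
have hK : \int[P \x P]_w (K w)%:E <= (LZ - ((1 - t) * LX + t * LY))%:E.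
  rewrite -Rintegral_conv// -RintegralB//; last exact: integrable_conv.
  apply: ge0_ae_le_integral_Rintegral => //.
    have := integrableB measurableT ilZ (integrable_conv ila ilb).
    by apply: eq_integrable.
  by apply: filterS good => w [a0 b0 zE]; have := KZ a0 b0; rewrite zE /a /b; lra.
(* [minZ : VX - LX <= VZ - LZ], so the two gaps add up to at most
   [t * ((VY - LY) - (VX - LX))] *)
apply: (le_trans (leeD hH hK)); rewrite -EFinD lee_fin.
nra.
Qed.

End displacement.

(** * Wasserstein distances and the quantile coupling *)

Section wasserstein.
Local Open Scope ereal_scope.
Context (R : realType).
Implicit Types (mu nu : probability R R) (p : R).

Lemma wasserstein_ge0 p mu nu : 0 <= wasserstein p mu nu.
Proof. by apply: le_ereal_inf_tmp => _ [pi _ <-]; exact: poweR_ge0. Qed.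

Lemma sqre_poweR (x : \bar R) : 0 <= x -> x ^+ 2 = poweR x 2.
Proof.
case: x => [x| |]//; last by rewrite poweRyr ?pnatr_eq0// /= mulyy.
by rewrite lee_fin => x0; rewrite poweR_EFin powR_mulrn// expr2 EFinM.
Qed.

Lemma measurable_cost d (T : measurableType d) p (X Y : T -> R) :
  measurable_fun setT X -> measurable_fun setT Y ->
  measurable_fun setT (fun w => `|X w - Y w| `^ p)%R.
Proof.
move=> mX mY.
have mXY : measurable_fun setT (fun w => `|X w - Y w|%R).
  by apply: measurableT_comp => //; exact: measurable_funB.
exact: (measurableT_comp (@measurable_powR R p) mXY).
Qed.

(** Random variables on a common space give a coupling of their laws. *)
Lemma wasserstein_law_le p mu nu d (T : measurableType d)
    (P : probability T R) (X Y : T -> R)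
    (mX : measurable_fun setT X) (mY : measurable_fun setT Y) : (0 < p)%R ->
  (forall A, measurable A -> mu A = law P mX A) ->
  (forall A, measurable A -> nu A = law P mY A) ->
  poweR (wasserstein p mu nu) p <= \int[P]_w (`|X w - Y w| `^ p)%:E.
Proof.
move=> p0 hmu hnu.
have mXY := measurable_fun_pair mX mY.
have mp : measurable_fun setT (fun z : R * R => (`|z.1 - z.2| `^ p)%:E).
  apply/measurable_EFinP.
  exact: (measurable_cost p measurable_fst measurable_snd).
have cpl : coupling mu nu (law P mXY).
  by move=> A mA; rewrite hmu// hnu//.
have I0 : 0 <= \int[P]_w (`|X w - Y w| `^ p)%:E.
  by apply: integral_ge0 => w _; rewrite lee_fin powR_ge0.
have -> : \int[P]_w (`|X w - Y w| `^ p)%:E =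
    poweR (poweR (\int[P]_w (`|X w - Y w| `^ p)%:E) p^-1) p.
  by rewrite -poweRrM mulVf ?gt_eqF// poweRe1.
apply: gt0_ler_poweR; [exact: ltW| | |].
- by rewrite in_itv/= wasserstein_ge0 leey.
- by rewrite in_itv/= poweR_ge0 leey.
apply: ereal_inf_lbound; exists (law P mXY) => //.
by congr poweR; rewrite ge0_integral_law// => y; rewrite lee_fin powR_ge0.
Qed.

End wasserstein.

Section quantile_displacement.
Local Open Scope ereal_scope.
Context (R : realType) (V : R -> R) (muV mu : probability R R) (c : R).
Hypothesis mV : measurable_fun setT V.
Hypothesis V_ge : forall x, (c <= V x)%R.
Hypothesis muV_min : equilibrium_measure V muV.
Hypothesis muV_fin : log_energy V muV != +oo.
Hypothesis mu_fin : log_energy V mu != +oo.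

Let X := quantile muV.
Let Y := quantile mu.
Let mX := measurable_quantile muV.
Let mY := measurable_quantile mu.

Lemma log_energy_quantile (nu : probability R R) :
  log_energy V nu = log_energy V (law (unif R) (measurable_quantile nu)).
Proof. by apply: eq_log_energy => A mA; exact: law_quantile. Qed.

Lemma ae_unif_pair : {ae unif R \x unif R, forall w,
  (w.1 \in `]0, 1[)%R /\ (w.2 \in `]0, 1[)%R}.
Proof.
set D := ([set` `]0, 1[%R] : set (measurableTypeR R)).
have mI : measurable D by exact: measurable_itv.
have mD : measurable (D `*` D) by exact: measurableX.
exists (~` (D `*` D)); split.
- exact: measurableC.
- have /= -> := @probability_setC _ _ _ (unif R \x unif R) _ mD.
  have /= -> := product_measure1E (unif R) (unif R) mI mI.
  rewrite unifE//.
  by rewrite setIid lebesgue_measure_itv/= lte_fin ltr01 oppr0 adde0 mule1 subee.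
- by move=> w /= h [h1 h2]; apply: h.
Qed.

(** Quantile functions are nondecreasing, hence comonotone. *)
Lemma quantile_comonotone : {ae unif R \x unif R, forall w,
  (0 <= (X w.1 - X w.2) * (Y w.1 - Y w.2))%R}.
Proof.
have F := ae_filter_ringOfSetsType (unif R \x unif R).
apply: (@filterS _ _ F) ae_unif_pair => w [w1 w2].
have [h|/ltW h] := leP w.1 w.2.
  by rewrite -mulrNN mulr_ge0// opprB subr_ge0; exact: quantile_nondecreasing.
by rewrite mulr_ge0// subr_ge0; exact: quantile_nondecreasing.
Qed.

(** The displacement inequality for the quantile coupling of [muV] and [mu]. *)
Lemma quantile_displacement_gap (t : R) (h k : R * R -> R) : (0 < t < 1)%R ->
  measurable_fun setT h -> measurable_fun setT k ->
  (forall z, 0 <= h z)%R -> (forall z, 0 <= k z)%R ->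
  (forall x y, V ((1 - t) * x + t * y) + h (x, y) <= (1 - t) * V x + t * V y)%R ->
  (forall a b, 0 < a -> 0 < b ->
    (1 - t) * ln a + t * ln b + k (a, b) <= ln ((1 - t) * a + t * b))%R ->
  \int[unif R]_w (h (X w, Y w))%:E +
  \int[unif R \x unif R]_w (k (`|X w.1 - X w.2|, `|Y w.1 - Y w.2|)%R)%:E <=
  t%:E * (log_energy V mu - log_energy V muV).
Proof.
move=> t01 mh mk h0 k0 hV kV; rewrite (log_energy_quantile mu) (log_energy_quantile muV).
apply: (displacement_gap (c := c)) => //.
- exact: quantile_comonotone.
- by apply: (finite_energy_law mV (mX := mX)); rewrite -log_energy_quantile.
- by apply: (finite_energy_law mV (mX := mY)); rewrite -log_energy_quantile.
- exact: (measurableT_comp mh (measurable_fun_pair mX mY)).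
- apply: (measurableT_comp mk); apply: measurable_fun_pair;
    exact: measurable_normrB.
- by move=> w a0 b0; exact: kV.
- by move=> nu; have := muV_min nu; rewrite {1}log_energy_quantile.
Qed.

Lemma wasserstein_quantile_le p : (0 < p)%R ->
  poweR (wasserstein p mu muV) p <= \int[unif R]_w (`|X w - Y w| `^ p)%:E.
Proof.
move=> p0; under eq_integral do rewrite distrC.
apply: (wasserstein_law_le (mX := mY) (mY := mX)) => // A mA; exact: law_quantile.
Qed.

End quantile_displacement.

Section uniformly_convex.
Local Open Scope ereal_scope.
Context (R : realType) (V : R -> R) (muV : probability R R) (c : R).
Hypothesis mV : measurable_fun setT V.
Hypothesis V_ge : forall x, (c <= V x)%R.
Hypothesis muV_min : equilibrium_measure V muV.
Hypothesis muV_fin : log_energy V muV != +oo.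

Lemma log_energyB_fin mu : log_energy V mu != +oo ->
  log_energy V mu - log_energy V muV \is a fin_num.
Proof.
suff fin (nu : probability R R) : log_energy V nu != +oo -> log_energy V nu \is a fin_num.
  by move=> /fin fmu; rewrite fin_numB fmu fin.
rewrite log_energy_quantile => nufin.
have [iV _ il] := finite_energy_law mV nufin.
rewrite log_energy_law//; last exact: finite_energy_law nufin.
by rewrite fin_numB !integrable_fin_num.
Qed.

(** The interpolation at time [t] costs a factor [(1 - t) `^ p], which tends to
    [1] as [t] tends to [0]. *)
Lemma transport_inequality (p kappa : R) mu : (0 < p)%R -> (0 <= kappa)%R ->
  (forall t x y, 0 < t < 1 ->
    V ((1 - t) * x + t * y) + kappa * t * (1 - t) `^ p * `|x - y| `^ p <=
    (1 - t) * V x + t * V y)%R ->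
  kappa%:E * poweR (wasserstein p mu muV) p <=
    log_energy V mu - log_energy V muV.
Proof.
move=> p0 kappa0 hV.
have [mu_infty|mu_fin] := eqVneq (log_energy V mu) +oo.
  rewrite mu_infty; have := log_energyB_fin muV_fin.
  by rewrite fin_numB => /andP[/fineK <- _]; rewrite leey.
have := log_energyB_fin mu_fin; set D := _ - _ => Dfin.
set I := \int[unif R]_w (`|quantile muV w - quantile mu w| `^ p)%:E.
have I0 : 0 <= I by apply: integral_ge0 => w _; rewrite lee_fin powR_ge0.
have mI : measurable_fun [set: measurableTypeR R]
    (fun w => (`|quantile muV w - quantile mu w| `^ p)%:E).
  by apply/measurable_EFinP; apply: measurable_cost;
    exact: measurable_quantile.
apply: (@le_trans _ _ (kappa%:E * I)).
  by apply: lee_wpmul2l; [rewrite lee_fin|exact: wasserstein_quantile_le].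
have H t : (0 < t < 1)%R -> ((1 - t) `^ p)%:E * (kappa%:E * I) <= D.
  move=> t01; have /andP[t0 t1] := t01.
  pose h (z : R * R) : R := (kappa * t * (1 - t) `^ p * `|z.1 - z.2| `^ p)%R.
  have mc : measurable_fun [set: R * R] (fun z : R * R => `|z.1 - z.2| `^ p)%R.
    exact: (measurable_cost p measurable_fst measurable_snd).
  have mh : measurable_fun setT h by exact: measurable_funM.
  have h0 z : (0 <= h z)%R by rewrite !mulr_ge0 ?powR_ge0// ltW.
  have hV' x y : (V ((1 - t) * x + t * y) + h (x, y) <= (1 - t) * V x + t * V y)%R.
    exact: hV.
  have k0 a b : (0 < a)%R -> (0 < b)%R ->
      ((1 - t) * ln a + t * ln b + 0 <= ln ((1 - t) * a + t * b))%R.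
    by move=> a0 b0; rewrite addr0; exact: ln_conv_ge.
  have := quantile_displacement_gap mV V_ge muV_min muV_fin mu_fin t01 mh
    (measurable_cst (0%R : R)) h0 (fun=> lexx 0%R) hV' k0.
  rewrite integral0 adde0 -/D => gap.
  rewrite -(@lee_pmul2l _ t%:E) ?lte_fin// (le_trans _ gap)//.
  rewrite (eq_integral (fun w : measurableTypeR R => (kappa * t * (1 - t) `^ p)%R%:E *
    (`|quantile muV w - quantile mu w| `^ p)%:E)); last first.
    by move=> w _; rewrite -EFinM.
  rewrite ge0_integralZl//.
  - by rewrite -/I !muleA -!EFinM (mulrC kappa) mulrAC (mulrC t).
  - by rewrite lee_fin !mulr_ge0// ?powR_ge0// ltW.
have : 0 <= kappa%:E * I by rewrite mule_ge0// lee_fin.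
move: H; set J := kappa%:E * I; rewrite -(fineK Dfin).
case: J => [J| |//] H J0; last first.
  have := H 2^-1%R; rewrite invr_gt0 ltr0n/= invf_lt1 ?ltr0n// ltr1n => /(_ isT).
  rewrite gt0_muley ?leye_eq// lte_fin powR_gt0// subr_gt0 invf_lt1// ltr1n.
  done.
(* [(1 - t) `^ p] takes every value [s] strictly between [0] and [1] *)
have {}H s : (0 < s < 1)%R -> (s * J <= fine D)%R.
  move=> /andP[s0 s1].
  have s01 : (0 < s `^ p^-1 < 1)%R.
    have h : (s `^ p^-1 < 1 `^ p^-1)%R.
      by rewrite gt0_ltr_powR ?invr_gt0// ?nnegrE// ltW.
    by rewrite powR_gt0//=; move: h; rewrite powR1.
  have := H (1 - s `^ p^-1)%R; rewrite subKr subr_gt0 ltrBlDr ltrDl.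
  case/andP: s01 => -> -> /(_ isT).
  by rewrite -powRrM mulVf ?gt_eqF// powRr1 ?lee_fin// ltW.
rewrite lee_fin leNgt; apply/negP => DJ.
have D0 : (0 <= fine D)%R.
  have h2 : (0 < (2^-1 : R) < 1)%R by apply/andP; split; lra.
  by rewrite (le_trans _ (H _ h2))// mulr_ge0.
have Jgt0 := le_lt_trans D0 DJ.
have J2 : (0 < 2 * J)%R by lra.
(* [s * J] is then the midpoint of [D] and [J] *)
have s01 : (0 < (fine D + J) / (2 * J) < 1)%R.
  apply/andP; split; first by rewrite divr_gt0//; lra.
  by rewrite ltr_pdivrMr//; lra.
have := H _ s01.
have -> : ((fine D + J) / (2 * J) * J = (fine D + J) / 2)%R.
  by field; rewrite gt_eqF.
by apply/negP; rewrite -ltNge; lra.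
Qed.
End uniformly_convex.

(** * Uniform convexity of powers *)

Section powers.
Context (R : realType).
Implicit Types p q u v x y h : R.

(** The derivative of [|x| `^ p], for [1 < p]. *)
Definition dpow p x : R := p * Num.sg x * `|x| `^ (p - 1).

(** Convexity of [|x| `^ p], by Young's inequality. *)
Lemma powR_tangent p x y : 1 < p ->
  `|x| `^ p + dpow p x * (y - x) <= `|y| `^ p.
Proof.
move=> p1; have p0 : 0 < p by lra.
have E : Num.sg x * `|x| `^ (p - 1) * x = `|x| `^ p.
  by rewrite mulrAC -normrEsg mulr_powRB1.
have Yg : Num.sg x * `|x| `^ (p - 1) * y <= `|y| `^ p / p + `|x| `^ p * (1 - p^-1).
  have q0 : 0 < (1 - p^-1)^-1 by rewrite invr_gt0 subr_gt0 invf_lt1.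
  have := @conjugate_powR _ `|y| (`|x| `^ (p - 1)) p (1 - p^-1)^-1
    (normr_ge0 _) (powR_ge0 _ _) p0 q0.
  rewrite invrK addrC subrK => /(_ erefl).
  rewrite -powRrM (_ : (p - 1) * (1 - p^-1)^-1 = p); last first.
    by field; rewrite (gt_eqF p0) gt_eqF// subr_gt0.
  apply: le_trans.
  rewrite (le_trans (ler_norm _))// !normrM (ger0_norm (powR_ge0 _ _)).
  rewrite mulrAC ler_wpM2r// ?powR_ge0//.
  by rewrite ler_piMl// normr_sg; case: (x != 0).
rewrite /dpow mulrBr -mulrA -mulrA -mulrA !mulrA.
have -> : p * Num.sg x * `|x| `^ (p - 1) * x = p * `|x| `^ p.
  by rewrite -E; ring.
have -> : p * Num.sg x * `|x| `^ (p - 1) * y =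
    p * (Num.sg x * `|x| `^ (p - 1) * y) by ring.
have := ler_wpM2l (ltW p0) Yg.
have -> : p * (`|y| `^ p / p + `|x| `^ p * (1 - p^-1)) =
  `|y| `^ p + `|x| `^ p * (p - 1) by field; rewrite gt_eqF.
lra.
Qed.

Lemma cp_le p x : 1 < p ->
  cp p <= `|1 + x| `^ p - `|x| `^ p - p * Num.sg x * `|x| `^ (p - 1).
Proof.
move=> p1; apply: ge_inf; last by exists x.
exists 0 => _ [y _ <-].
have := powR_tangent y (1 + y) p1; rewrite addrK mulr1 /dpow.
lra.
Qed.

Lemma cp_ge0 p : 1 < p -> 0 <= cp p.
Proof.
move=> p1; apply: lb_le_inf; first by eexists; exists 0.
move=> _ [y _ <-]; have := powR_tangent y (1 + y) p1; rewrite addrK mulr1 /dpow.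
lra.
Qed.

(** The defining property of [cp], made homogeneous: the case [h = 1] rescaled. *)
Lemma powR_bregman p x h : 1 < p ->
  cp p * `|h| `^ p <= `|x + h| `^ p - `|x| `^ p - dpow p x * h.
Proof.
move=> p1; have p0 : 0 < p by lra.
have [->|h0] := eqVneq h 0.
  by rewrite normr0 powR0 ?gt_eqF// !mulr0 addr0 subrr subr0.
have hp : 0 < `|h| `^ p by rewrite powR_gt0// normr_gt0.
have := ler_wpM2r (ltW hp) (cp_le (x / h) p1); move/le_trans; apply.
rewrite !mulrBl -powRM// -normrM mulrDl mul1r divfK// [h + x]addrC.
rewrite -powRM// -normrM divfK// lerD2l lerN2 /dpow.
rewrite -(mulr_powRB1 (normr_ge0 h) p0).
rewrite sgrM normrM powRM// sgrV normfV.
have -> : p * (Num.sg x * Num.sg h) * (`|x| `^ (p - 1) * `|h|^-1 `^ (p - 1)) *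
  (`|h| * `|h| `^ (p - 1)) = p * Num.sg x * `|x| `^ (p - 1) *
  (Num.sg h * `|h|) * (`|h|^-1 `^ (p - 1) * `|h| `^ (p - 1)) by ring.
by rewrite -powRM ?invr_ge0// mulVf ?normr_eq0// powR1 mulr1 -numEsg.
Qed.

(** Apply [powR_bregman] at the interpolated point [z] and keep the remainder
    only for [y], where it carries the factor [t * (1 - t) `^ p]. *)
Lemma powR_uniformly_convex p t x y : 1 < p -> 0 < t < 1 ->
  `|(1 - t) * x + t * y| `^ p + cp p * t * (1 - t) `^ p * `|x - y| `^ p <=
  (1 - t) * `|x| `^ p + t * `|y| `^ p.
Proof.
move=> p1 /andP[t0 t1]; set z := (1 - t) * x + t * y.
have t1' : 0 < 1 - t by lra.
have hx := powR_bregman z (t * (x - y)) p1.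
have hy := powR_bregman z ((1 - t) * (y - x)) p1.
rewrite (_ : z + t * (x - y) = x) in hx; last by rewrite /z; ring.
rewrite (_ : z + (1 - t) * (y - x) = y) in hy; last by rewrite /z; ring.
have c0 := cp_ge0 p1.
have hx0 : 0 <= `|x| `^ p - `|z| `^ p - dpow p z * (t * (x - y)).
  by rewrite (le_trans _ hx)// mulr_ge0// powR_ge0.
have hx1 := mulr_ge0 (ltW t1') hx0.
have := ler_wpM2l (ltW t0) hy.
rewrite normrM (gtr0_norm t1') powRM ?(ltW t1')// distrC.
set D := dpow p z in hx1 *; set A := (1 - t) `^ p; set B := `|x - y| `^ p.
set Z := `|z| `^ p in hx1 *; set X := `|x| `^ p in hx1 *; set Y := `|y| `^ p.
move=> h1.
have -> : cp p * t * A * B = t * (cp p * (A * B)) by ring.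
have := lerD hx1 h1.
rewrite (_ : (1 - t) * (X - Z - D * (t * (x - y))) +
  t * (Y - Z - D * ((1 - t) * (y - x))) = (1 - t) * X + t * Y - Z); last by ring.
lra.
Qed.

Lemma powR_superadditive q u v : 1 <= q -> 0 <= u -> 0 <= v ->
  u `^ q + v `^ q <= (u + v) `^ q.
Proof.
move=> q1 u0 v0; have q0 : 0 < q by lra.
have [uv0|uv0] := eqVneq (u + v) 0.
  have -> : u = 0 by lra.
  have -> : v = 0 by lra.
  by rewrite powR0 ?gt_eqF// addr0 powR0 ?gt_eqF.
have s0 : 0 < u + v by rewrite lt_neqAle eq_sym uv0 addr_ge0.
have H w : 0 <= w -> w <= u + v -> w `^ q <= (w / (u + v)) * (u + v) `^ q.
  move=> w0 ws; rewrite -{1}(divfK uv0 w) powRM ?divr_ge0 ?(ltW s0)//.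
  rewrite ler_wpM2r ?powR_ge0//.
  have [->|wn0] := eqVneq w 0; first by rewrite mul0r powR0 ?gt_eqF.
  have w0' : 0 < w by rewrite lt_neqAle eq_sym wn0.
  by rewrite ge1r_powR// divr_gt0//= ler_pdivrMr// mul1r.
have hu : u <= u + v by lra.
have hv : v <= u + v by lra.
apply: le_trans (lerD (H _ u0 hu) (H _ v0 hv)) _.
by rewrite -mulrDl -mulrDl divff// mul1r.
Qed.

Lemma powR_midpoint q u v : 1 <= q -> 0 <= u -> 0 <= v ->
  ((u + v) / 2) `^ q <= (u `^ q + v `^ q) / 2.
Proof.
move=> q1 u0 v0.
have h0 : 0 <= 2^-1 :> R by lra.
have h1 : 2^-1 <= 1 :> R by lra.
have := @convex_powR R q q1 (Itv01 h0 h1) u v.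
rewrite !inE/= !in_itv/= !andbT => /(_ u0 v0).
rewrite convRE [X in X `^ _ <= _ -> _]convRE/= /unstable.onem.
have -> : 1 - 2^-1 = 2^-1 :> R by lra.
by rewrite -!mulrDr ![2^-1 * _]mulrC.
Qed.

(** Clarkson's inequality on the line: superadditivity and convexity of
    [u `^ (p / 2)] applied to the parallelogram identity. *)
Lemma clarkson p x y : 2 <= p ->
  2 * `|x| `^ p + 2 * `|y| `^ p <= `|x + y| `^ p + `|x - y| `^ p.
Proof.
move=> p2; have q1 : 1 <= p / 2 by lra.
have sq z : `|z| `^ p = (z ^+ 2) `^ (p / 2).
  by rewrite -(real_normK (num_real z)) -powR_mulrn// -powRrM; congr powR; field.
rewrite !sq.
have := powR_midpoint q1 (sqr_ge0 (x + y)) (sqr_ge0 (x - y)).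
have -> : ((x + y) ^+ 2 + (x - y) ^+ 2) / 2 = x ^+ 2 + y ^+ 2 by field.
have := powR_superadditive q1 (sqr_ge0 x) (sqr_ge0 y).
lra.
Qed.

Lemma cp_gt0 p : 2 <= p -> 0 < cp p.
Proof.
move=> p2; have p1 : 1 < p by lra.
apply: (@lt_le_trans _ _ (2 * 2^-1 `^ p)).
  by rewrite mulr_gt0// powR_gt0// invr_gt0.
apply: lb_le_inf; first by eexists; exists 0.
move=> _ [x _ <-].
(* [1 + x] and [x] are [x + 1/2] plus and minus [1/2]; the value at [x + 1/2]
   is then bounded below by the tangent at [x] *)
have := clarkson (x + 2^-1) 2^-1 p2.
have -> : x + 2^-1 + 2^-1 = 1 + x by field.
rewrite addrK (ger0_norm (x := 2^-1)) ?invr_ge0//.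
have := powR_tangent x (x + 2^-1) p1.
rewrite addrAC subrr add0r /dpow.
lra.
Qed.

End powers.

(** * Convexity and second differences on the line *)

Section second_difference.
Context (R : realType).
Implicit Types (V : R -> R) (x y z s : R).

Lemma convex_on_lineE V t x y : convex_on_line V -> 0 <= t <= 1 ->
  V ((1 - t) * x + t * y) <= (1 - t) * V x + t * V y.
Proof.
move=> cV /andP[t0 t1].
have s0 : 0 <= 1 - t by lra.
have s1 : 1 - t <= 1 by lra.
have := @cV (Itv01 s0 s1) x y; rewrite !inE => /(_ Logic.I Logic.I).
rewrite convRE [X in V X <= _ -> _]convRE/= /unstable.onem.
by rewrite (_ : 1 - (1 - t) = t)//; ring.
Qed.

Lemma derivable_quotient V x : derivable V x 1 ->
  h^-1 * (V (h + x) - V x) @[h --> 0^'] --> (V^`())%classic x.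
Proof.
move=> dV; rewrite derive1E.
have : h^-1 *: (V (h *: 1 + x) - V x) @[h --> 0^'] --> 'D_1 V x by exact: dV.
by under eq_fun do rewrite scaler1.
Qed.

Lemma near_dnbhs_right (Q : R -> Prop) : (\forall h \near 0^', Q h) ->
  \forall h \near 0^'+, Q h.
Proof.
move=> H; near=> h; have h0 : 0 < h by near: h; exact: nbhs_right_gt.
move: (h0); rewrite lt0r => /andP[+ _]; near: h.
by apply: cvg_within; move: H; rewrite near_withinE.
Unshelve. all: by end_near. Qed.

Lemma near_dnbhs_left (Q : R -> Prop) : (\forall h \near 0^', Q h) ->
  \forall h \near 0^'-, Q h.
Proof.
move=> H; near=> h; have h0 : h < 0 by near: h; exact: nbhs_left_lt.
move: (h0); rewrite lt_neqAle => /andP[+ _]; near: h.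
by apply: cvg_within; move: H; rewrite near_withinE.
Unshelve. all: by end_near. Qed.

(** Both derivatives are compared with the slope of the chord. *)
Lemma convex_derive1_nd V : convex_on_line V ->
  (forall x, derivable V x 1) -> {homo (V^`())%classic : x y / x <= y}.
Proof.
move=> cV dV x y; rewrite le_eqVlt => /predU1P[->//|xy].
have yx : 0 < y - x by rewrite subr_gt0.
apply: (@le_trans _ _ ((V y - V x) / (y - x))).
  rewrite leNgt; apply/negP => H.
  have K := near_dnbhs_right (cvgr_gt _ (derivable_quotient (dV x)) _ H).
  near (0:R)^'+ => h.
  have h0 : 0 < h by near: h; exact: nbhs_right_gt.
  have hyx : h < y - x by near: h; exact: nbhs_right_lt.
  have : (V y - V x) / (y - x) < h^-1 * (V (h + x) - V x) by near: h; exact: K.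
  apply/negP; rewrite -leNgt.
  have t01 : 0 <= h / (y - x) <= 1.
    apply/andP; split; first by rewrite divr_ge0// ltW.
    by rewrite ler_pdivrMr// mul1r ltW.
  have := convex_on_lineE x y cV t01.
  have -> : (1 - h / (y - x)) * x + h / (y - x) * y = h + x.
    by field; rewrite gt_eqF.
  move=> cVh; rewrite ler_pdivrMl// lerBlDr (le_trans cVh)//.
  by rewrite le_eqVlt; apply/orP; left; apply/eqP; field; rewrite gt_eqF.
rewrite leNgt; apply/negP => H.
have K := near_dnbhs_left (cvgr_lt _ (derivable_quotient (dV y)) _ H).
 near (0:R)^'- => h.
have h0 : h < 0 by near: h; exact: nbhs_left_lt.
have hyx : - (y - x) < h by near: h; apply: nbhs_left_gt; rewrite oppr_lt0.
have : h^-1 * (V (h + y) - V y) < (V y - V x) / (y - x) by near: h; exact: K.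
apply/negP; rewrite -leNgt.
have t01 : 0 <= 1 + h / (y - x) <= 1.
  have h1 : h / (y - x) <= 0 by rewrite mulr_le0_ge0 ?invr_ge0// ltW.
  have h2 : - h / (y - x) <= 1 by rewrite ler_pdivrMr// mul1r lerNl ltW.
  by apply/andP; split; lra.
have := convex_on_lineE x y cV t01.
have -> : (1 - (1 + h / (y - x))) * x + (1 + h / (y - x)) * y = h + y.
  by field; rewrite gt_eqF.
move=> cVh.
have -> : h^-1 * (V (h + y) - V y) = (- h)^-1 * (V y - V (h + y)).
  by field; rewrite lt_eqF.
rewrite ler_pdivlMl ?oppr_gt0// lerBrDr -lerBrDl (le_trans cVh)//.
by rewrite le_eqVlt; apply/orP; left; apply/eqP; field; rewrite gt_eqF.
Unshelve. all: by end_near. Qed.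

Lemma derive1_le_increment (f : R -> R) (K a b : R) :
  (forall x, derivable f x 1) -> a <= b ->
  (forall x, a <= x -> x <= b -> (f^`())%classic x <= K) ->
  f b - f a <= K * (b - a).
Proof.
move=> df ab fK.
have [||c cab ->] := @MVT_segment _ f (f^`())%classic a b ab.
- by move=> x _; rewrite derive1E; exact: derivableP.
- by apply: derivable_within_continuous => x _.
- move: cab; rewrite in_itv/= => /andP[ac cb].
  by rewrite ler_wpM2r ?subr_ge0// fK.
Qed.

Lemma derive1_ge_increment (f : R -> R) (K a b : R) :
  (forall x, derivable f x 1) -> a <= b ->
  (forall x, a <= x -> x <= b -> K <= (f^`())%classic x) ->
  K * (b - a) <= f b - f a.
Proof.
move=> df ab fK.
have [||c cab ->] := @MVT_segment _ f (f^`())%classic a b ab.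
- by move=> x _; rewrite derive1E; exact: derivableP.
- by apply: derivable_within_continuous => x _.
- move: cab; rewrite in_itv/= => /andP[ac cb].
  by rewrite ler_wpM2r ?subr_ge0// fK.
Qed.

Section symmetric.
Variables (V : R -> R) (z : R).
Hypothesis dV : forall x, derivable V x 1.
Let dV' := (V^`())%classic.

Let is_derive_sym (k alpha u : R) :
  is_derive u 1 (fun u => V (z + u) + V (z - u) - k * (u - alpha) ^+ 2)
    (dV' (z + u) - dV' (z - u) - 2 * k * (u - alpha)).
Proof.
have dVx x : is_derive x 1 V (dV' x) by rewrite /dV' derive1E; exact: derivableP.
have d1 : is_derive u 1 (fun u => z + u) (0 + 1).
  exact: (is_deriveD (is_derive_cst z u 1) (is_derive_id u 1)).
have d2 : is_derive u 1 (fun u => z - u) (0 - 1).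
  exact: (is_deriveB (is_derive_cst z u 1) (is_derive_id u 1)).
have d3 : is_derive u 1 (fun u => u - alpha) (1 - 0).
  exact: (is_deriveB (is_derive_id u 1) (is_derive_cst alpha u 1)).
have h1 := @is_derive1_comp _ V (fun u => z + u) u _ _ (dVx _) d1.
have h2 := @is_derive1_comp _ V (fun u => z - u) u _ _ (dVx _) d2.
have := is_deriveB (is_deriveD h1 h2) (is_deriveZ k (is_deriveX 2 d3)).
rewrite add0r mulr1 sub0r mulrN1 subr0.
rewrite (_ : k *: _ = 2 * k * (u - alpha)); last first.
  by rewrite -[X in X = _]/(k * (2 * (u - alpha) ^+ 1 * 1)); ring.
by [].
Qed.

(** Integration of a lower bound on [V' (z + u) - V' (z - u)]. The starting point
    [alpha] allows the bound to hold only away from [u = 0]. *)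
Lemma symmetric_difference_ge (k alpha s : R) : alpha <= s ->
  (forall u, alpha <= u -> u <= s -> 2 * k * (u - alpha) <= dV' (z + u) - dV' (z - u)) ->
  k * (s - alpha) ^+ 2 <=
  V (z + s) + V (z - s) - (V (z + alpha) + V (z - alpha)).
Proof.
move=> als H.
set g := fun u => V (z + u) + V (z - u) - k * (u - alpha) ^+ 2.
have := @derive1_ge_increment g 0 alpha s.
rewrite mul0r /g subrr expr0n/= mulr0 subr0 => K.
suff : 0 <= g s - (V (z + alpha) + V (z - alpha)) by rewrite /g; lra.
apply: (K _ als) => u.
- by case: (is_derive_sym k alpha u).
- move=> au us; have := H u au us; rewrite derive1E; have := is_derive_sym k alpha u => {}K.
  by rewrite derive_val subr_ge0.
Qed.

Lemma symmetric_difference_le (k s : R) : 0 <= s ->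
  (forall u, 0 <= u -> u <= s -> dV' (z + u) - dV' (z - u) <= 2 * k * u) ->
  V (z + s) + V (z - s) - 2 * V z <= k * s ^+ 2.
Proof.
move=> s0 H.
set g := fun u => V (z + u) + V (z - u) - k * (u - 0) ^+ 2.
have := @derive1_le_increment g 0 0 s.
rewrite mul0r /g subrr expr0n/= mulr0 !subr0 addr0 => K.
suff : V (z + s) + V (z - s) - k * s ^+ 2 - (V z + V z) <= 0 by lra.
apply: (K _ s0) => u.
- by case: (is_derive_sym k 0 u).
- move=> au us; have := H u au us; rewrite derive1E; have := is_derive_sym k 0 u => {}K.
  by rewrite derive_val subr0 subr_le0.
Qed.

End symmetric.

End second_difference.

(** * The logarithmic kernel as a mixture of tents *)

Section tent_kernel.
Context (R : realType).
Implicit Types (L r z a b u : R).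

(** The tent of half-width [r]: the autocorrelation of an interval of length
    [r]. *)
Definition tent r z : R := Num.max 0 (r - `|z|).

(** The tent with weight [r ^ -2], restricted to [0 < r <= L]. *)
Definition tent_weight L r z : R :=
  if (0 < r) && (r <= L) then tent r z * r `^ (- 2) else 0.

(** The mixture of tents. For [0 < |z| <= L] it equals [- ln |z|] up to an affine
    function of [|z|], see [tent_kernelE]; being a mixture of autocorrelations,
    it is positive definite. *)
Definition tent_kernel L z : \bar R :=
  (\int[lebesgue_measure]_r (tent_weight L r z)%:E)%E.

Lemma tent_ge0 r z : 0 <= tent r z.
Proof. by rewrite le_max lexx. Qed.

Lemma tent_weight_ge0 L r z : 0 <= tent_weight L r z.
Proof.
rewrite /tent_weight; case: ifPn => // _.
by rewrite mulr_ge0 ?tent_ge0// powR_ge0.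
Qed.

Lemma tent_kernel_ge0 L z : (0 <= tent_kernel L z)%E.
Proof. by apply: integral_ge0 => r _; rewrite lee_fin tent_weight_ge0. Qed.

Lemma tent_kernel0 L z : L <= `|z| -> tent_kernel L z = 0%E.
Proof.
move=> Lz; apply: integral0_eq => r _; rewrite /tent_weight.
case: ifPn => // /andP[r0 rL].
by rewrite /tent max_l ?mul0r// subr_le0 (le_trans rL).
Qed.

Lemma measurable_tent_weight L d (T : measurableType d)
    (f : T -> R) (g : T -> R) : measurable_fun setT f -> measurable_fun setT g ->
  measurable_fun setT (fun w => (tent_weight L (f w) (g w))%:E).
Proof.
move=> mf mg; apply/measurable_EFinP; apply: measurable_fun_ifT => //.
- by apply: measurable_and; [apply: measurable_fun_ltr|apply: measurable_fun_ler].
- apply: measurable_funM.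
    apply: measurable_maxr => //; apply: measurable_funB => //.
    exact: measurableT_comp.
  exact: (measurableT_comp (@measurable_powR R (- 2)) mf).
Qed.

Lemma measurable_tent_weight2 L d (T : measurableType d) (g : T -> R) :
  measurable_fun setT g ->
  measurable_fun setT (fun p : T * measurableTypeR R =>
    (tent_weight L p.2 (g p.1))%:E).
Proof.
move=> mg; apply: measurable_tent_weight.
- exact: measurable_snd.
- exact: (measurableT_comp mg measurable_fst).
Qed.

Lemma measurable_tent_kernel L : measurable_fun setT (tent_kernel L).
Proof.
apply: (@measurable_fun_fubini_tonelli_F _ _ R (measurableTypeR R) R
  lebesgue_measure (fun p => (tent_weight L p.2 p.1)%:E)).
  exact: (measurable_tent_weight2 L (@measurable_id _ R setT)).
by move=> p; rewrite lee_fin tent_weight_ge0.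
Qed.

Let is_derive_prim (a r : R) : 0 < r ->
  is_derive r 1 (fun r => ln r + a * r^-1) (r^-1 - a * r^-1 ^+ 2).
Proof.
move=> r0; have rn0 : r != 0 by rewrite gt_eqF.
have := is_deriveD (is_derive1_ln r0)
  (is_deriveZ a (is_deriveV rn0 (is_derive_id r 1))).
rewrite (_ : _ + _ = r^-1 - a * r^-1 ^+ 2) //.
by rewrite -[X in _ + X]/(a * (- r ^- 2 * 1)) mulr1 mulrN exprVn.
Qed.

Let derivable_integrand (a r : R) : 0 < r ->
  derivable (fun r => r^-1 - a * r^-1 ^+ 2) r 1.
Proof.
move=> r0; have rn0 : r != 0 by rewrite gt_eqF.
have i1 := is_deriveV rn0 (is_derive_id r 1).
have := is_deriveB i1 (is_deriveZ a (is_deriveX 2 i1)).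
by case.
Qed.

Lemma tent_kernelE L z : 0 < `|z| -> `|z| <= L ->
  tent_kernel L z = (ln L - ln `|z| - 1 + `|z| / L)%:E.
Proof.
move=> z0; rewrite le_eqVlt => /predU1P[zL|zL].
  by rewrite tent_kernel0 ?zL// -zL divff ?gt_eqF//; congr EFin; lra.
set a := `|z| in z0 zL *.
transitivity (\int[lebesgue_measure]_(r in `[a, L]) (r^-1 - a * r^-1 ^+ 2)%:E)%E.
  rewrite integral_mkcond; apply: eq_integral => r _; rewrite patchE.
  rewrite mem_setE in_itv/= /tent_weight.
  case: ifPn => [/andP[r0 rL]|r0L]; last first.
    case: ifPn => // /andP[ar rL]; move: r0L; rewrite rL andbT.
    by rewrite (lt_le_trans z0 ar).
  rewrite rL andbT; case: ifPn => [ar|].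
    rewrite /tent max_r ?subr_ge0// (powR_invn 2 (ltW r0)) -/a; congr EFin.
    by field; rewrite gt_eqF.
  by rewrite -ltNge => ra; rewrite /tent max_l ?mul0r// subr_le0 ltW.
(* [ln r + a / r] is a primitive of [(r - a) / r ^ 2] *)
rewrite (@continuous_FTC2 _ _ (fun r => ln r + a * r^-1))//.
- have L0 := lt_trans z0 zL; rewrite -EFinB (divff (lt0r_neq0 z0)); congr EFin.
  by lra.
- apply: derivable_within_continuous => r; rewrite in_itv/= => /andP[ar _].
  by apply: derivable_integrand; rewrite (lt_le_trans z0).
- have cont r : 0 < r -> {for r, continuous (fun r => ln r + a * r^-1)}.
    move=> r0; apply: differentiable_continuous; apply/derivable1_diffP.
    by case: (is_derive_prim a r0).
  split.
  + move=> r; rewrite in_itv/= => /andP[ar _].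
    by case: (is_derive_prim a (lt_trans z0 ar)).
  + exact: cvg_at_right_filter (cont _ z0).
  + exact: cvg_at_left_filter (cont _ (lt_trans z0 zL)).
- move=> r; rewrite in_itv/= => /andP[ar _].
  rewrite derive1E; have := is_derive_prim a (lt_trans z0 ar) => ?.
  by rewrite derive_val.
Qed.

(** Half-open intervals are used because their intersection is again half-open;
    the Lebesgue measure does not see the difference. *)
Lemma tent_overlap r x y : 0 < r ->
  (tent r (x - y))%:E = lebesgue_measure
    (`]x - r / 2, x + r / 2] `&` `]y - r / 2, y + r / 2])%classic.
Proof.
move=> r0.
have -> : (`]x - r / 2, x + r / 2] `&` `]y - r / 2, y + r / 2])%classic =
  `]Num.max x y - r / 2, Num.min x y + r / 2]%classic.
  apply/seteqP; split => u /=; rewrite !in_itv/= !ltrBlDr gt_max -!lerBlDr le_min.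
    by move=> [/andP[-> ->] /andP[-> ->]].
  by move=> /andP[/andP[-> ->] /andP[-> ->]].
rewrite lebesgue_measure_itv/= lte_fin -EFinD /tent.
have -> : Num.min x y + r / 2 - (Num.max x y - r / 2) = r - `|x - y|.
  have [xy|xy] := leP x y.
    by rewrite ler0_norm ?subr_le0//; lra.
  by rewrite gtr0_norm ?subr_gt0//; lra.
have -> : (Num.max x y - r / 2 < Num.min x y + r / 2) = (0 < r - `|x - y|).
  have [xy|xy] := leP x y.
    by rewrite ler0_norm ?subr_le0//; apply/idP/idP; lra.
  by rewrite gtr0_norm ?subr_gt0//; apply/idP/idP; lra.
by case: ltP.
Qed.

End tent_kernel.

(** * Correlations of tents *)

Section tent_correlation.
Local Open Scope ereal_scope.
Context d (T : measurableType d) (R : realType) (P : probability T R).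
Variable X : T -> R.
Hypothesis mX : measurable_fun setT X.

Section fixed_width.
Variable r : R.
Hypothesis r0 : (0 < r)%R.

(* [u] lies in the window of length [r] centred at [X t + a] *)
Let c (a : R) (t : T) (u : R) : bool :=
  ((X t + a - r / 2 < u) && (u <= X t + a + r / 2))%R.

Let I (a : R) (t : T) : set R := `](X t + a - r / 2)%R, (X t + a + r / 2)%R]%classic.

Let cE a t u : c a t u = (u \in I a t).
Proof. by rewrite mem_setE in_itv. Qed.

Let mc d' (T' : measurableType d') (f : T' -> T) (g : T' -> R) a :
  measurable_fun setT f -> measurable_fun setT g ->
  measurable_fun setT (fun w => c a (f w) (g w)).
Proof.
move=> mr mg; have mXf := measurableT_comp mX mr.
apply: measurable_and.
- by apply: measurable_fun_ltr => //; do ! apply: measurable_funD.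
- by apply: measurable_fun_ler => //; do ! apply: measurable_funD.
Qed.

(* the mass seen by the window, as a function of [u] *)
Let m (a u : R) : \bar R := P [set t | c a t u].

Let measurable_c a u : measurable [set t | c a t u].
Proof.
have h := @mc _ T id (cst u) a (@measurable_id _ _ _) (measurable_cst _).
have -> : [set t | c a t u] = [set: T] `&` (fun w => c a w u) @^-1` [set true].
  by rewrite setTI.
exact: h.
Qed.

Let bool_int (b : bool) : \bar R := b%:R%:E.

Let measurable_bool d' (T' : measurableType d') (f : T' -> bool) :
  measurable_fun setT f -> measurable_fun setT (fun w => bool_int (f w)).
Proof.
move=> mr; have -> : (fun w => bool_int (f w)) = fun w => if f w then 1 else 0.
  by apply/funext => w; rewrite /bool_int; case: (f w).
by apply: measurable_fun_ifT.
Qed.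

Let tent_overlapE a b (w : T * T) :
  (tent r ((X w.1 + a) - (X w.2 + b)))%:E =
  \int[lebesgue_measure]_u bool_int (c a w.1 u && c b w.2 u).
Proof.
rewrite tent_overlap//; have mI t e : measurable (I e t : set (measurableTypeR R)).
  exact: measurable_itv.
transitivity (\int[lebesgue_measure]_u (\1_(I a w.1 `&` I b w.2) u)%:E).
  by rewrite integral_indic ?setIT//; exact: measurableI.
by apply: eq_integral => u _; rewrite indicE in_setI -!cE.
Qed.

(** The expected tent at the difference of two independent translates of [X] is
    a scalar product of window masses. *)
Lemma tent_correlation a b :
  \int[P \x P]_w (tent r ((X w.1 + a) - (X w.2 + b)))%:E =
  \int[lebesgue_measure]_u (m a u * m b u).
Proof.
under eq_integral do rewrite tent_overlapE.
pose f (p : (T * T) * measurableTypeR R) := bool_int (c a p.1.1 p.2 && c b p.1.2 p.2).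
have mr : measurable_fun setT f.
  apply: measurable_bool; apply: measurable_and; apply: mc => //.
  - exact: (measurableT_comp measurable_fst measurable_fst).
  - exact: (measurableT_comp measurable_snd measurable_fst).
have f0 p : 0 <= f p by rewrite lee_fin ler0n.
have := @fubini_tonelli _ _ _ _ _ ((P \x P)%E : probability (T * T)%type R)
  (lebesgue_measure : {sigma_finite_measure set (measurableTypeR R) -> \bar R})
  f mr f0.
move=> /= ->; apply: eq_integral => u _.
have mAB := measurableX (measurable_c a u) (measurable_c b u).
have /= <- := product_measure1E P P (measurable_c a u) (measurable_c b u).
have := @integral_indic _ _ _ ((P \x P)%E : probability (T * T)%type R) setT
  measurableT _ mAB.
rewrite setIT /= => <-.
apply: eq_integral => w _; rewrite /f /bool_int indicE.
congr (_%:R%:E); congr nat_of_bool; apply/idP/idP.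
  by move=> /andP[h1 h2]; rewrite inE.
by rewrite inE => -[/= -> ->].
Qed.

Let mr a u : R := fine (m a u).

Let mE a u : m a u = (mr a u)%:E.
Proof. by rewrite /mr fineK// fin_num_measure. Qed.

Let measurable_m a : measurable_fun [set: measurableTypeR R] (m a).
Proof.
have -> : m a = fun u : measurableTypeR R => \int[P]_t bool_int (c a t u).
  apply/funext => u; rewrite /m -[in LHS](setIT [set t | _]) -integral_indic//.
  apply: eq_integral => t _; rewrite indicE /bool_int; congr (_%:R%:E).
  by congr nat_of_bool; apply/idP/idP; rewrite inE.
apply: (@measurable_fun_fubini_tonelli_G _ _ T (measurableTypeR R) R P
  (fun p => bool_int (c a p.1 p.2))).
  by apply: measurable_bool; exact: mc.
by move=> p; rewrite lee_fin ler0n.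
Qed.

Let measurable_mm a b (k : R) :
  measurable_fun [set: measurableTypeR R] (fun u => k%:E * (m a u * m b u)).
Proof. by apply: emeasurable_funM => //; exact: emeasurable_funM. Qed.

Let mm_ge0 a b (k : R) u : (0 <= k)%R -> 0 <= k%:E * (m a u * m b u).
Proof. by move=> k0; rewrite !mule_ge0. Qed.

Lemma tent_corr_shift a b e : (a - b = e)%R ->
  \int[P \x P]_w (tent r (X w.1 - X w.2 + e))%:E =
  \int[lebesgue_measure]_u (m a u * m b u).
Proof.
move=> <-; rewrite -tent_correlation; apply: eq_integral => w _.
by congr (tent _ _)%:E; ring.
Qed.

Let tentX e := \int[P \x P]_w (tent r (X w.1 - X w.2 + e))%:E.

Let ge0_le_mm (f g : R -> \bar R) :
  measurable_fun [set: measurableTypeR R] f ->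
  measurable_fun [set: measurableTypeR R] g ->
  (forall u, 0 <= f u) -> (forall u, 0 <= g u) ->
  (forall u, f u <= g u) ->
  \int[lebesgue_measure]_u f u <= \int[lebesgue_measure]_u g u.
Proof. by move=> mf mg f0 g0 fg; apply: ge0_le_integral. Qed.

Let int_mm a b (k : R) : (0 <= k)%R ->
  \int[lebesgue_measure]_u (k%:E * (m a u * m b u)) = k%:E * tentX (a - b)%R.
Proof.
move=> k0; rewrite ge0_integralZl_EFin//.
- by congr (_ * _); apply/esym/tent_corr_shift.
- by move=> u _; rewrite mule_ge0.
- exact: emeasurable_funM.
Qed.

Let tentX_ge0 e : 0 <= tentX e.
Proof. by apply: integral_ge0 => w _; rewrite lee_fin tent_ge0. Qed.

Let mm1_ge0 a b (k : R) : (0 <= k)%R -> forall u, 0 <= k%:E * (m a u * m b u).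
Proof. by move=> k0 u; exact: mm_ge0. Qed.

Let int_mmD a b k a' b' k' : (0 <= k)%R -> (0 <= k')%R ->
  \int[lebesgue_measure]_u
    (k%:E * (m a u * m b u) + k'%:E * (m a' u * m b' u)) =
  k%:E * tentX (a - b)%R + k'%:E * tentX (a' - b')%R.
Proof.
move=> k0 k0'; rewrite ge0_integralD//; first by rewrite !int_mm.
- by move=> u _; exact: mm1_ge0.
- by move=> u _; exact: mm1_ge0.
Qed.

(** Cauchy-Schwarz for the scalar product of [tent_correlation]. *)
Lemma tent_shift_le e : tentX e <= tentX 0.
Proof.
rewrite -(@lee_pmul2l _ 2%:E)//.
apply: (@le_trans _ _ (\int[lebesgue_measure]_u
    (1%:E * (m e u * m e u) + 1%:E * (m 0 u * m 0 u)))).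
  rewrite -[in leLHS](subr0 e) -int_mm//; apply: ge0_le_mm.
  - exact: measurable_mm.
  - by apply: emeasurable_funD; exact: measurable_mm.
  - exact: mm1_ge0.
  - by move=> u; rewrite adde_ge0// mm_ge0.
  - move=> u; rewrite !mE -!EFinM -EFinD lee_fin.
    by have := sqr_ge0 (mr e u - mr 0 u); lra.
by rewrite int_mmD// !subrr -ge0_muleDl// -EFinD.
Qed.

(** Nonnegativity of the squared norm of [m 0 - 2 * m e + m (e + e)]: the deficit
    of the correlation at [0] is at most multiplied by [4] when the shift is
    doubled. *)
Lemma tent_shift_double e :
  4%:E * tentX e <= 3%:E * tentX 0 + tentX (e + e).
Proof.
rewrite -(@lee_pmul2l _ 2%:E)//.
apply: (@le_trans _ _ (\int[lebesgue_measure]_u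
    (4%:E * (m e u * m 0 u) + 4%:E * (m (e + e) u * m e u)))).
  rewrite int_mmD// subr0 addrK -ge0_muleDl// -EFinD muleA -EFinM.
  by rewrite (_ : 2 * 4 = 4 + 4)%R//; ring.
apply: (@le_trans _ _ (\int[lebesgue_measure]_u
    ((1%:E * (m 0 u * m 0 u) + 4%:E * (m e u * m e u)) +
    (1%:E * (m (e + e) u * m (e + e) u) + 2%:E * (m (e + e) u * m 0 u))))).
  apply: ge0_le_mm.
  - by apply: emeasurable_funD; exact: measurable_mm.
  - by apply: emeasurable_funD; apply: emeasurable_funD; exact: measurable_mm.
  - by move=> u; rewrite adde_ge0// mm_ge0.
  - by move=> u; rewrite !adde_ge0// mm_ge0.
  - move=> u; rewrite !mE -!EFinM -!EFinD lee_fin.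
    by have := sqr_ge0 (mr 0 u - 2 * mr e u + mr (e + e) u); lra.
rewrite ge0_integralD//;
  do ?[by move=> u _; rewrite adde_ge0// mm_ge0];
  do ?[by apply: emeasurable_funD; exact: measurable_mm].
rewrite !int_mmD// !subrr subr0.
move: (tentX_ge0 0) (tentX_ge0 (e + e)).
case: (tentX 0) (tentX (e + e)) => [a| |] [b| |]// _ _.
- by rewrite -!EFinM -!EFinD lee_fin; lra.
- by rewrite (_ : 3%:E * a%:E + +oo = +oo)// gt0_muley// leey.
- by rewrite (_ : 3%:E * +oo + b%:E = +oo) ?gt0_muley// leey.
- by rewrite (_ : 3%:E * +oo + +oo = +oo) ?gt0_muley// leey.
Qed.

End fixed_width.
End tent_correlation.

(** * Correlations of the logarithmic kernel *)

Section kernel_correlation.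
Local Open Scope ereal_scope.
Context d (T : measurableType d) (R : realType) (P : probability T R).
Variables (X : T -> R) (L : R).
Hypothesis mX : measurable_fun setT X.

(** The expectation of the truncated logarithmic kernel at [X - X' + e], for an
    independent copy [X'] of [X]. *)
Definition kernel_corr (e : R) : \bar R :=
  \int[P \x P]_w tent_kernel L (X w.1 - X w.2 + e).

Let mXX e : measurable_fun setT (fun w : T * T => X w.1 - X w.2 + e)%R.
Proof.
apply: measurable_funD => //; apply: measurable_funB.
  exact: (measurableT_comp mX measurable_fst).
exact: (measurableT_comp mX measurable_snd).
Qed.

Let A (e r : R) := \int[P \x P]_w (tent_weight L r (X w.1 - X w.2 + e))%:E.

Let A_ge0 e r : 0 <= A e r.
Proof. by apply: integral_ge0 => w _; rewrite lee_fin tent_weight_ge0. Qed.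

Let measurable_A e : measurable_fun [set: measurableTypeR R] (A e).
Proof.
apply: (@measurable_fun_fubini_tonelli_G _ _ (T * T)%type (measurableTypeR R) R
  ((P \x P) : probability (T * T)%type R)
  (fun p => (tent_weight L p.2 (X p.1.1 - X p.1.2 + e))%:E)).
  exact: (measurable_tent_weight2 L (mXX e)).
by move=> p; rewrite lee_fin tent_weight_ge0.
Qed.

Let kernel_corrE e : kernel_corr e = \int[lebesgue_measure]_r A e r.
Proof.
have := @fubini_tonelli _ _ _ _ _ ((P \x P)%E : probability (T * T)%type R)
  (lebesgue_measure : {sigma_finite_measure set (measurableTypeR R) -> \bar R})
  (fun p => (tent_weight L p.2 (X p.1.1 - X p.1.2 + e))%:E)
  (measurable_tent_weight2 L (mXX e)).
by apply=> p; rewrite lee_fin tent_weight_ge0.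
Qed.

Let AE e r : A e r = if (0 < r)%R && (r <= L)%R then
  (r `^ (- 2))%:E * \int[P \x P]_w (tent r (X w.1 - X w.2 + e))%:E else 0.
Proof.
rewrite /A /tent_weight; case: ifPn => // rL; last first.
  by apply: integral0_eq.
rewrite -ge0_integralZl_EFin ?powR_ge0//.
- by apply: eq_integral => w _; rewrite mulrC EFinM.
- by move=> w _; rewrite lee_fin tent_ge0.
- apply/measurable_EFinP; apply: measurable_maxr => //; apply: measurable_funB => //.
  exact: measurableT_comp.
Qed.

Lemma kernel_corr_le e : kernel_corr e <= kernel_corr 0.
Proof.
rewrite !kernel_corrE; apply: ge0_le_integral => // r _.
rewrite !AE; case: ifPn => // /andP[r0 _].
by rewrite lee_wpmul2l ?lee_fin ?powR_ge0//; exact: tent_shift_le.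
Qed.

Lemma kernel_corr_ge0 e : 0 <= kernel_corr e.
Proof. by apply: integral_ge0 => w _; exact: tent_kernel_ge0. Qed.

Lemma kernel_corr_double e :
  4%:E * kernel_corr e <= 3%:E * kernel_corr 0 + kernel_corr (e + e).
Proof.
rewrite !kernel_corrE -!ge0_integralZl_EFin// -ge0_integralD//.
- apply: ge0_le_integral => //.
  + by move=> r _; rewrite mule_ge0.
  + exact: measurable_funeM.
  + by apply: emeasurable_funD => //; exact: measurable_funeM.
  + move=> r _; rewrite !AE; case: ifPn => [/andP[r0 _]|_]; last first.
      by rewrite !mule0 adde0.
    rewrite !(muleCA _ (r `^ (- 2))%:E) -ge0_muleDr//; last 2 first.
      by rewrite mule_ge0//; apply: integral_ge0 => w _; rewrite lee_fin tent_ge0.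
      by apply: integral_ge0 => w _; rewrite lee_fin tent_ge0.
    by rewrite lee_wpmul2l ?lee_fin ?powR_ge0//; exact: tent_shift_double.
- by move=> r _; rewrite mule_ge0.
- exact: measurable_funeM.
Qed.

(** The tents have weight [r ^ -2], so a quadratic bound in [r] is enough. *)
Lemma kernel_corr_lty (C : R) : (0 <= C)%R -> (forall r : R, (0 < r)%R ->
    \int[P \x P]_w (tent r (X w.1 - X w.2))%:E <= (C * r ^+ 2)%R%:E) ->
  kernel_corr 0 < +oo.
Proof.
move=> C0 HC; rewrite kernel_corrE.
have mI : measurable (`]0%R, L]%classic : set (measurableTypeR R)).
  exact: measurable_itv.
apply: (@le_lt_trans _ _ (\int[lebesgue_measure]_(r in `]0%R, L]) C%:E)).
  rewrite [leRHS]integral_mkcond; apply: ge0_le_integral => //.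
  - by apply/(measurable_restrictT _ mI).
  - move=> r _; rewrite patchE mem_setE in_itv/= AE; case: ifPn => // /andP[r0 rL].
    under eq_integral do rewrite addr0.
    apply: (le_trans (lee_wpmul2l _ (HC r r0))); first by rewrite lee_fin powR_ge0.
    rewrite -EFinM lee_fin (powR_invn 2 (ltW r0)) mulrCA mulVf ?mulr1//.
    by rewrite expf_eq0/= gt_eqF.
rewrite integral_cst//= lebesgue_measure_itv/=; case: ifPn => _; last by rewrite mule0.
by rewrite -EFinB -EFinM ltry.
Qed.

Let geom_arith (a b c e : R) : (e <= b - c -> 4 * a <= 3 * b + c ->
  4^-1 * e <= b - a)%R.
Proof. by move=> ? ?; lra. Qed.

(** If the correlation vanishes at [t], its deficit at [t / 2 ^ n] is at least
    quadratic in the shift. *)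
Lemma kernel_corr_geom (t : R) (n : nat) : kernel_corr 0 \is a fin_num ->
  kernel_corr t = 0 ->
  (fine (kernel_corr 0) / 4 ^+ n <=
   fine (kernel_corr 0) - fine (kernel_corr (t / 2 ^+ n)))%R.
Proof.
move=> f0 kt.
have fin e : kernel_corr e \is a fin_num.
  rewrite ge0_fin_numE ?kernel_corr_ge0// (le_lt_trans (kernel_corr_le e))//.
  by rewrite -ge0_fin_numE// kernel_corr_ge0.
elim: n => [|n ih]; first by rewrite !expr0 !divr1 kt/= subr0.
have := kernel_corr_double (t / 2 ^+ n.+1)%R.
rewrite (_ : t / 2 ^+ n.+1 + t / 2 ^+ n.+1 = t / 2 ^+ n)%R; last first.
  by rewrite exprS; field; rewrite expf_eq0 pnatr_eq0 andbF.
rewrite -(fineK (fin 0%R)) -(fineK (fin (t / 2 ^+ n)%R)).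
rewrite -(fineK (fin (t / 2 ^+ n.+1)%R)) -!EFinM -EFinD lee_fin.
rewrite [(4 ^+ n.+1)%R]exprS invfM mulrCA.
exact: geom_arith ih.
Qed.

Hypothesis dX : {ae P \x P, forall w, X w.1 != X w.2}.
Hypothesis XL : {ae P \x P, forall w, (`|X w.1 - X w.2| <= L)%R}.

Let kf (w : T * T) := fine (tent_kernel L (X w.1 - X w.2)).

Let measurable_kernelX : measurable_fun setT
  (fun w : T * T => tent_kernel L (X w.1 - X w.2)).
Proof.
apply: (measurableT_comp (@measurable_tent_kernel R L)).
by have := mXX 0; under eq_fun do rewrite addr0.
Qed.

Let measurable_kf : measurable_fun setT kf.
Proof. exact: measurableT_comp. Qed.

Let ae_kf : {ae P \x P, forall w, tent_kernel L (X w.1 - X w.2) = (kf w)%:E /\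
  ln `|X w.1 - X w.2|%R = (ln L - 1 + `|X w.1 - X w.2| / L - kf w)%R}.
Proof.
apply: filterS2 dX XL => w w12 wL.
rewrite /kf tent_kernelE ?normr_gt0 ?subr_eq0//=; split => //.
by ring.
Qed.

Let integrable_cst (k : R) : (P \x P).-integrable setT
  (EFin \o (fun _ : T * T => k)).
Proof.
exact: (@finite_measure_integrable_cst _ _ _
  ((P \x P)%E : probability (T * T)%type R) setT k measurableT).
Qed.

Let integrable_dist : (P \x P).-integrable setT
  (EFin \o (fun w : T * T => `|X w.1 - X w.2|)%R).
Proof.
apply: (ae_le_integrable (g := cst L)).
- exact: measurable_normrB.
- exact: integrable_cst.
- by apply: filterS XL => w; rewrite normr_id.
Qed.

Let integrable_affine : (P \x P).-integrable setT
  (EFin \o (fun w : T * T => ln L - 1 + `|X w.1 - X w.2| / L)%R).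
Proof.
have := integrableD measurableT (integrable_cst (ln L - 1)%R)
  (integrableZl measurableT L^-1 integrable_dist).
apply: eq_integrable => // w _.
by rewrite /= -EFinM -EFinD mulrC.
Qed.

Lemma kernel_corr_fin_num : kernel_corr 0 \is a fin_num <->
  (P \x P).-integrable setT (fun w => (ln `|X w.1 - X w.2|)%:E).
Proof.
have k0 : kernel_corr 0 = \int[P \x P]_w `|(EFin \o kf) w|.
  apply: ae_eq_integral => //.
  - by under eq_fun do rewrite addr0.
  - by apply: measurableT_comp => //; exact/measurable_EFinP.
  - apply: filterS ae_kf => w [+ _] _.
    rewrite addr0 => ->; rewrite /= ger0_norm// /kf fine_ge0//.
    exact: tent_kernel_ge0.
split => [kfin|il].
  have ikf : (P \x P).-integrable setT (EFin \o kf).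
    apply/integrableP; split; first exact/measurable_EFinP.
    by rewrite -k0 ltey_eq kfin.
  apply: ae_eq_integrable (integrableB measurableT integrable_affine ikf).
    by apply/measurable_EFinP; exact: measurable_ln_dist.
  by apply: filterS ae_kf => w [_ /= ->]; rewrite EFinB.
have ikf : (P \x P).-integrable setT (EFin \o kf).
  apply: ae_eq_integrable (integrableB measurableT integrable_affine il).
    exact/measurable_EFinP.
  apply: filterS ae_kf => w [_ /= ->]; rewrite -EFinB; congr EFin.
  by ring.
rewrite k0 ge0_fin_numE; last by apply: integral_ge0.
by move/integrableP : ikf => [].
Qed.

Lemma integral_ln_dist : kernel_corr 0 \is a fin_num ->
  (\int[P \x P]_w ln `|X w.1 - X w.2| =
   ln L - 1 + (\int[P \x P]_w `|X w.1 - X w.2|) / L - fine (kernel_corr 0))%R.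
Proof.
move=> kfin.
have il := kernel_corr_fin_num.1 kfin.
have k0 : fine (kernel_corr 0) = (\int[P \x P]_w kf w)%R.
  congr fine; apply: ae_eq_integral => //.
  - by under eq_fun do rewrite addr0.
  - exact/measurable_EFinP.
  - by apply: filterS ae_kf => w [+ _] _; rewrite addr0.
have ikf : (P \x P).-integrable setT (EFin \o kf).
  apply: ae_eq_integrable (integrableB measurableT integrable_affine il).
    exact/measurable_EFinP.
  apply: filterS ae_kf => w [_ /= ->]; rewrite -EFinB; congr EFin.
  by ring.
transitivity (\int[P \x P]_w (ln L - 1 + `|X w.1 - X w.2| / L - kf w))%R.
  congr fine; apply: ae_eq_integral => //.
  - by apply/measurable_EFinP; exact: measurable_ln_dist.
  - apply/measurable_EFinP; apply: measurable_funB => //.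
    by have /integrableP[/measurable_EFinP] := integrable_affine.
  - by apply: filterS ae_kf => w [_ ->] _.
rewrite RintegralB// k0; congr (_ - _)%R.
have id' : (P \x P).-integrable setT
    (EFin \o (fun w : T * T => `|X w.1 - X w.2| / L)%R).
  have := integrableZl measurableT L^-1 integrable_dist.
  by apply: eq_integrable => // w _; rewrite /= -EFinM mulrC.
have ic := integrable_cst (ln L - 1)%R.
rewrite (RintegralD measurableT ic id'); congr (_ + _)%R.
  have /= -> := @Rintegral_cst _ _ _ ((P \x P)%E : probability (T * T)%type R)
    setT measurableT (ln L - 1)%R.
  have /= -> := @probability_setT _ _ _ ((P \x P)%E : probability (T * T)%type R).
  by rewrite mulr1.
by rewrite RintegralZr.
Qed.

End kernel_correlation.

(** * Finiteness of the equilibrium energy *)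

Section no_atom.
Local Open Scope ereal_scope.
Context d (T : measurableType d) (R : realType) (P : probability T R).
Variables (X : T -> R).
Hypothesis mX : measurable_fun setT X.

Let mdiag : measurable [set w : T * T | X w.1 != X w.2].
Proof.
have := @measurable_neq_diag R => /(measurable_pair_map mX measurableT).
by rewrite setTI.
Qed.

(** Two independent copies of [X] are almost surely distinct exactly when the law
    of [X] has no atom. *)
Lemma ae_neq_no_atom : (forall x, P (X @^-1` [set x]) = 0) <->
  {ae P \x P, forall w, X w.1 != X w.2}.
Proof.
set D := ~` [set w : T * T | X w.1 != X w.2].
have mD : measurable D by exact: measurableC.
split => [P0|dX x].
  exists D; split => //.
  rewrite /= /product_measure1; apply: integral0_eq => t _ /=.
  rewrite -(P0 (X t)); congr (P _); apply/seteqP; split => s.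
    by rewrite /xsection/= inE /D/= => /negP; rewrite negbK => /eqP /= E; exact/esym.
  by move=> /= Xs; rewrite /xsection/= inE /D/= Xs eqxx.
have /(negligibleP _ mD) PD : (P \x P).-negligible D by exact: dX.
have mx : measurable (X @^-1` [set x]).
  by rewrite -[X in measurable X]setTI; exact: mX.
have : P (X @^-1` [set x]) * P (X @^-1` [set x]) <= 0.
  have /= <- := product_measure1E P P mx mx.
  rewrite -[leRHS]PD; apply: le_measure; rewrite ?inE//; first exact: measurableX.
  by move=> w [/= w1 w2]; rewrite /D /= w1 w2 eqxx.
have := fin_num_measure P _ mx; case: (P _) => // p _.
rewrite -EFinM lee_fin => pp; congr EFin; apply/eqP.
by rewrite -sqrf_eq0 expr2 eq_le pp -expr2 sqr_ge0.
Qed.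

Lemma ae_pair (Q : T -> Prop) : {ae P, forall t, Q t} ->
  {ae P \x P, forall w, Q w.1 /\ Q w.2}.
Proof.
move=> [N [mN PN QN]].
have mU : measurable (N `*` setT `|` setT `*` N : set (T * T)).
  by apply: measurableU; exact: measurableX.
exists (N `*` setT `|` setT `*` N); split => //.
  have m1 : measurable (N `*` setT : set (T * T)) by exact: measurableX.
  have m2 : measurable (setT `*` N : set (T * T)) by exact: measurableX.
  apply/eqP; rewrite eq_le measure_ge0 andbT.
  have := @measureU2 _ _ _ ((P \x P)%E : probability (T * T)%type R) _ _ m1 m2.
  move/le_trans; apply.
  have /= -> := product_measure1E P P mN measurableT.
  have /= -> := product_measure1E P P measurableT mN.
  by rewrite PN mul0e mule0 adde0.
move=> w /= /not_andP[h|h]; [left|right]; split => //=; exact: QN.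
Qed.

End no_atom.

Section uniform_energy.
Local Open Scope ereal_scope.
Context (R : realType).

Lemma unif_le (A : set (measurableTypeR R)) : measurable A ->
  unif R A <= lebesgue_measure A.
Proof.
move=> mA; rewrite unifE//; apply: le_measure; rewrite ?inE//.
by apply: measurableI => //; exact: measurable_itv.
Qed.

Let X : measurableTypeR R -> R := id.

(** The two copies of the line differ only by the name of their measurable
    structure. *)
Lemma measurable_Borel_id : measurable_fun setT (id : measurableTypeR R -> R).
Proof. exact: measurable_id. Qed.

Let mX : measurable_fun setT X := measurable_Borel_id.

Lemma unif_tent_le r : (0 < r)%R ->
  \int[unif R \x unif R]_w (tent r (X w.1 - X w.2))%:E <= (2 * r ^+ 2)%R%:E.
Proof.
move=> r0.
have mt : measurable_fun setT
    (fun w : measurableTypeR R * measurableTypeR R => (tent r (X w.1 - X w.2))%:E).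
  apply/measurable_EFinP; apply: measurable_maxr => //; apply: measurable_funB => //.
  exact: (measurable_normrB mX).
have t0 (w : measurableTypeR R * measurableTypeR R) : 0 <= (tent r (X w.1 - X w.2))%:E.
  by rewrite lee_fin tent_ge0.
have := @fubini_tonelli1 _ _ _ _ _ (unif R) (unif R) _ mt t0.
rewrite /= => ->.
apply: (@le_trans _ _ (\int[unif R]_x (cst (2 * r ^+ 2)%R%:E x))); last first.
  rewrite integral_cst//; have /= -> := @probability_setT _ _ _ (unif R).
  by rewrite mule1.
apply: ge0_le_integral => //.
- by move=> x _; apply: integral_ge0.
- exact: measurable_fun_fubini_tonelli_F.
- move=> x _; rewrite /fubini_F/=.
  have mI : measurable (`[(x - r)%R, (x + r)%R]%classic : set (measurableTypeR R)).
    exact: measurable_itv.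
  apply: (@le_trans _ _ (\int[unif R]_y
      (r%:E * (\1_(`[(x - r)%R, (x + r)%R]%classic : set (measurableTypeR R)) y)%:E))).
    apply: ge0_le_integral => //.
    + by move=> y _; rewrite lee_fin tent_ge0.
    + exact: (measurableT_comp mt (pair1_measurable x)).
    + apply: measurable_funeM; apply/measurable_EFinP.
      exact: (@measurable_indic _ (measurableTypeR R) R setT _ mI).
    + move=> y _; rewrite -EFinM lee_fin indicE mem_setE in_itv/= /tent ge_max.
      rewrite -ler_distlC /X; have [xy|xy] := leP `|x - y|%R r.
        by rewrite mulr1 (ltW r0) gerBl normr_ge0.
      by rewrite mulr0 lexx subr_le0 ltW.
  rewrite ge0_integralZl_EFin ?(ltW r0)//; last first.
    apply/measurable_EFinP.
    exact: (@measurable_indic _ (measurableTypeR R) R setT _ mI).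
  rewrite integral_indic// setIT expr2 mulrA EFinM muleC.
  rewrite lee_wpmul2r ?lee_fin ?(ltW r0)// (le_trans (unif_le mI))//.
  rewrite lebesgue_measure_itv/= lte_fin; case: ifPn => _; last first.
    by rewrite lee_fin mulr_ge0// ltW.
  by rewrite -EFinB lee_fin; lra.
Qed.

Lemma finite_energy_unif (V : R -> R) : continuous V -> finite_energy (unif R) V X.
Proof.
move=> cV.
have ae01 := @ae_pair _ _ _ (unif R) _ (ae_unif R).
have dX : {ae unif R \x unif R, forall w, X w.1 != X w.2}.
  apply: (@ae_neq_no_atom _ _ R (unif R) X mX).1 => x; apply/eqP; rewrite eq_le measure_ge0 andbT.
  rewrite -(lebesgue_measure_set1 x); exact: (unif_le (measurable_set1 x)).
have XL : {ae unif R \x unif R, forall w, (`|X w.1 - X w.2| <= 1)%R}.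
  have F := ae_filter_ringOfSetsType (unif R \x unif R).
  apply: (@filterS _ _ F) ae01 => w [].
  rewrite !in_itv/= => /andP[a0 a1] /andP[b0 b1]; rewrite /X ler_norml.
  by apply/andP; split; lra.
split => //.
- have [|c c01 Vc] := @EVT_max _ (fun x => `|V x|)%R 0%R 1%R ler01.
    apply: continuous_subspaceT => x; apply: cvg_norm; exact: cV.
  apply: (ae_le_integrable (g := cst `|V c|%R)).
  + exact: (measurableT_comp (continuous_measurable_fun cV) mX).
  + exact: finite_measure_integrable_cst.
  + have F := ae_filter_ringOfSetsType (unif R).
    apply: (@filterS _ _ F) (ae_unif R) => x x01; apply: Vc.
    exact: subset_itv_oo_cc.
- apply: (kernel_corr_fin_num mX dX XL).1.
  rewrite ge0_fin_numE ?kernel_corr_ge0//.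
  by apply: (@kernel_corr_lty _ _ _ _ _ _ mX 2) => // r r0; exact: unif_tent_le.
Qed.

End uniform_energy.

Section equilibrium.
Local Open Scope ereal_scope.
Context (R : realType) (V : R -> R) (muV : probability R R).

(** The uniform law on the unit interval has finite energy. *)
Lemma equilibrium_log_energy_fin : continuous V -> equilibrium_measure V muV ->
  log_energy V muV != +oo.
Proof.
move=> cV /(_ (law (unif R) (@measurable_Borel_id R))).
have mV := continuous_measurable_fun cV.
rewrite (log_energy_law mV _ (finite_energy_unif cV)).
have [iV _ il] := finite_energy_unif cV.
have f1 := integrable_fin_num measurableT iV.
have f2 := integrable_fin_num measurableT il.
apply: contraTneq => ->; rewrite leye_eq.
have : \int[unif R]_w (V w)%:E - \int[unif R \x unif R]_w (ln `|w.1 - w.2|)%:E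
  \is a fin_num by rewrite fin_numB f1.
by case: (_ - _).
Qed.

End equilibrium.

(** Outside a compact interval [V] is at least [2 * ln |x| >= 0]. *)
Lemma potential_lower_bound (R : realType) (V : R -> R) :
  potential V -> continuous V -> exists c, forall x, c <= V x.
Proof.
move=> [_ /cvgryPge/(_ 0) Vy /cvgryPge/(_ 0) VNy] cV.
move: Vy => [M [_ HM]]; move: VNy => [N [_ HN]].
set K := Num.max 1 (Num.max M (- N)) + 1.
have K1 : 1 <= K by rewrite ler_wpDr// le_max lexx.
have KM : M < K by rewrite ltr_pwDr// !le_max lexx !orbT.
have KN : - N < K by rewrite ltr_pwDr// !le_max lexx !orbT.
have far x : 1 <= `|x| -> 0 <= V x - 2 * ln `|x| -> 0 <= V x.
  by move=> x1; rewrite subr_ge0; apply: le_trans; rewrite mulr_ge0// ln_ge0.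
have [||c cK Vc] := @EVT_min _ V (- K) K.
- lra.
- exact: continuous_subspaceT.
exists (Num.min 0 (V c)) => x; rewrite ge_min; apply/orP.
have [xK|Kx] := leP `|x| K.
  by right; apply: Vc; rewrite in_itv/= -ler_norml.
left; apply: far; first by rewrite (le_trans K1)// ltW.
have [x0|x0] := leP 0 x.
  by apply: HM; rewrite (lt_trans KM)// -(ger0_norm x0).
by apply: HN; rewrite -ltrN2 (lt_trans KN)// -(ltr0_norm x0).
Qed.

(** * Locally null sets and uniform continuity *)

(** The line is second countable, so a set of points with null neighbourhoods is
    null. *)
Lemma ae_of_locally_null (R : realType) (mu : probability R R) (Q : R -> Prop) :
  (forall x, Q x -> exists2 e, 0 < e & mu `]x - e, x + e[%classic = 0%E) ->
  {ae mu, forall x, ~ Q x}.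
Proof.
move=> HQ.
(* countably many intervals, enumerated by [F], each kept only if it is null *)
pose B (p : rat * nat) : set R :=
  `]ratr p.1 - p.2.+1%:R^-1, ratr p.1 + p.2.+1%:R^-1[%classic.
pose F (k : nat) : set R :=
  if unpickle k is Some p then if mu (B p) == 0%E then B p else set0 else set0.
have : mu.-negligible (\bigcup_k F k).
  apply: negligible_bigcup => k; rewrite /F.
  case: unpickle => [p|]; last exact: negligible_set0.
  case: ifPn => [/eqP Bp|_]; last exact: negligible_set0.
  by exists (B p); split => //; exact: measurable_itv.
apply: negligibleS => x /= /contrapT /HQ[e e0 me].
have [k ke] : exists k : nat, k.+1%:R^-1 < e / 2.
  have e2 : 0 < e / 2 by rewrite divr_gt0.
  have [k] := ltr_add_invr e2; rewrite add0r => ke; exists k => //.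
have k0 : 0 < k.+1%:R^-1 :> R by rewrite invr_gt0.
have [q] : exists q, ratr q \in `]x - k.+1%:R^-1, x + k.+1%:R^-1[.
  by apply: rat_in_itvoo; rewrite ltrBlDr -addrA ltrDl addr_gt0.
rewrite in_itv/= => /andP[q1 q2].
exists (pickle (q, k)); [exact: Logic.I|rewrite /F pickleK].
have -> : mu (B (q, k)) == 0%E.
  rewrite -measure_le0 -me; apply: le_measure; rewrite ?inE; try exact: measurable_itv.
  move=> y; rewrite /B/= !in_itv/= => /andP[y1 y2].
  move: ke q1 q2 y1 y2; set a := k.+1%:R^-1 => *; by apply/andP; split; lra.
rewrite /B /= in_itv/=; move: q1 q2; set a := k.+1%:R^-1 => *; by apply/andP; split; lra.
Qed.

Lemma uniform_upper_modulus (R : realType) (f : R -> R) (M eta : R) :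
  continuous f -> 0 < eta ->
  exists2 e, 0 < e & forall x y, `|x| <= M -> `|y - x| <= e -> f y <= f x + eta.
Proof.
move=> cf eta0.
pose P (e x : R) := forall y, `|y - x| <= e -> f y <= f x + eta.
have /compact_near_coveringP/(_ R (0^'+) P) := @segment_compact R (- M) M.
have H : forall x, `[(- M), M]%classic x -> \forall x' \near x & d \near 0^'+, P d x'.
  move=> x _.
  have eta2 : 0 < eta / 2 by rewrite divr_gt0.
  have /cvgrPdist_lt/(_ _ eta2) := cf x.
  move=> /nbhs_ballP[e /= e0 He].
  have e2 : 0 < e / 2 by rewrite divr_gt0.
  exists (ball x (e / 2), [set d | d < e / 2]) => /=.
    by split; [exact: nbhsx_ballx|exact: nbhs_right_lt].
  move=> [x' d] /= [xx' de] y yx'.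
  have h1 := He x'; have h2 := He y.
  rewrite /ball/= in xx'.
  have : `|f x - f x'| < eta / 2.
    by apply: h1; rewrite /ball/= (lt_trans xx')//; lra.
  have : `|f x - f y| < eta / 2.
    apply: h2; rewrite /ball/=.
    have := ler_distD x' x y; rewrite (distrC x' y); lra.
  by rewrite !ltr_norml => /andP[? ?] /andP[? ?]; lra.
move=> /(_ _ H) K; near (0:R)^'+ => e.
exists e; first by near: e; exact: nbhs_right_gt.
move=> x y xM; have : `[(- M), M] `<=` P e by near: e; exact: K.
by move/(_ x); rewrite /= in_itv/= -ler_norml => /(_ xM); apply.
Unshelve. all: by end_near. Qed.

(** * Mixtures of two translates *)

Section mixture.
Local Open Scope ereal_scope.
Context (R : realType) (mu : probability R R) (h : R).

(* the bias of the coin is a probability *)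
Let half_itv := half01 R.

(** A fair coin together with an independent point drawn from [mu]. *)
Definition coin_prob : probability (bool * R)%type R :=
  ((bernoulli_prob (2^-1 : R) : probability bool R) \x mu)%E.

(** The point moved by [h] or [- h] according to the coin; its law is the mixture
    with equal weights of two translates of [mu]. *)
Definition coin_shift (w : bool * R) : R := if w.1 then (w.2 + h)%R else (w.2 - h)%R.

Lemma measurable_coin_shift : measurable_fun setT coin_shift.
Proof.
apply: measurable_fun_ifT.
- exact: measurable_fst.
- by apply: measurable_funD => //; exact: measurable_snd.
- by apply: measurable_funB => //; exact: measurable_snd.
Qed.

Let measurable_shift (f : R -> \bar R) e : measurable_fun setT f ->
  measurable_fun setT (fun x : R => f (x + e)%R).
Proof. by move=> mf; apply: (measurableT_comp mf); exact: measurable_funD. Qed.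

Lemma ge0_integral_coin (f : R -> \bar R) : measurable_fun setT f ->
  (forall x, 0 <= f x) ->
  \int[coin_prob]_w f (coin_shift w) =
  2^-1%:E * \int[mu]_x f (x + h)%R + 2^-1%:E * \int[mu]_x f (x - h)%R.
Proof.
move=> mf f0.
have mfs := measurableT_comp mf measurable_coin_shift.
have f0s w : 0 <= (f \o coin_shift) w by exact: f0.
have := @fubini_tonelli1 _ _ _ _ _ (bernoulli_prob (2^-1 : R) : probability bool R) mu
  _ mfs f0s.
rewrite /= => ->; rewrite /fubini_F/=.
rewrite integral_bernoulli_prob//; last by move=> b; apply: integral_ge0.
by have -> : (unstable.onem 2^-1 = 2^-1 :> R)%R by rewrite /unstable.onem; lra.
Qed.

Lemma ae_coin (Q : R -> Prop) : measurable [set x | Q x] ->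
  {ae mu, forall x, Q (x + h)%R} -> {ae mu, forall x, Q (x - h)%R} ->
  {ae coin_prob, forall w, Q (coin_shift w)}.
Proof.
move=> mQ Qp Qm.
have mC : measurable (~` [set x | Q x]) by exact: measurableC.
have mi : measurable_fun setT (fun x : R => (\1_(~` [set x | Q x]) x : R)%:E).
  by apply/measurable_EFinP; exact: measurable_indic.
have mpre : measurable (coin_shift @^-1` (~` [set x | Q x])).
  by rewrite -[X in measurable X]setTI; exact: measurable_coin_shift.
exists (coin_shift @^-1` (~` [set x | Q x])); split => //.
have := @integral_indic _ _ _ coin_prob setT measurableT _ mpre.
rewrite setIT => <-.
have i0 x : 0 <= (\1_(~` [set x | Q x]) x : R)%:E by rewrite lee_fin.
have -> : \int[coin_prob]_x (\1_(coin_shift @^-1` (~` [set x | Q x])) x)%:E =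
  \int[coin_prob]_w (fun x => (\1_(~` [set x | Q x]) x : R)%:E) (coin_shift w) by [].
rewrite (ge0_integral_coin mi i0).
suff K e : {ae mu, forall x, Q (x + e)%R} ->
    \int[mu]_x (\1_(~` [set x | Q x]) (x + e)%R : R)%:E = 0.
  by rewrite !K// !mule0 adde0.
move=> Qe; rewrite -[RHS](integral0 mu setT); apply: ae_eq_integral => //.
  exact: (measurable_shift e mi).
apply: filterS Qe => x Qx _; rewrite indicE memNset//=.
Qed.

Let mixE (a b c : \bar R) : 0 <= a -> 0 <= b -> 0 <= c ->
  2^-1%:E * (2^-1%:E * a + 2^-1%:E * b) + 2^-1%:E * (2^-1%:E * c + 2^-1%:E * a) =
  2^-1%:E * a + 4^-1%:E * (b + c).
Proof.
move=> a0 b0 c0.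
have q0 (x : \bar R) : 0 <= x -> 0 <= 2^-1%:E * x.
  by move=> x0; rewrite mule_ge0// lee_fin.
rewrite (ge0_muleDr _ (q0 _ a0) (q0 _ b0)) (ge0_muleDr _ (q0 _ c0) (q0 _ a0)).
rewrite (ge0_muleDr _ b0 c0) !muleA -!EFinM.
have -> : (2^-1 * 2^-1 = 4^-1 :> R)%R by field.
rewrite [X in _ + X]addeC addeACA -ge0_muleDl ?lee_fin// -EFinD.
by have -> : (4^-1 + 4^-1 = 2^-1 :> R)%R by field.
Qed.

(** Two independent draws receive the same shift with probability [1/2], and
    opposite shifts with probability [1/4] for each order. *)
Lemma ge0_integral_coin2 (g : R -> \bar R) : measurable_fun setT g ->
  (forall x, 0 <= g x) ->
  \int[coin_prob \x coin_prob]_w g (coin_shift w.1 - coin_shift w.2)%R =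
  2^-1%:E * \int[mu \x mu]_w g (w.1 - w.2 + 0)%R +
  4^-1%:E * (\int[mu \x mu]_w g (w.1 - w.2 + (h + h))%R +
             \int[mu \x mu]_w g (w.1 - w.2 - (h + h))%R).
Proof.
move=> mg g0.
have mg2 e : measurable_fun setT (fun w : R * R => g (w.1 - w.2 + e)%R).
  apply: (measurableT_comp mg); apply: measurable_funD => //.
  by apply: measurable_funB; [exact: measurable_fst|exact: measurable_snd].
pose G (a : R) := \int[mu]_y g (a - y)%R.
have G0 a : 0 <= G a by apply: integral_ge0.
have mG : measurable_fun setT G.
  apply: (@measurable_fun_fubini_tonelli_F _ _ R R R mu
    (fun w => g (w.1 - w.2)%R)) => //.
  by have := mg2 0%R; under eq_fun do rewrite addr0.
have GE e : \int[mu]_x G (x + e)%R = \int[mu \x mu]_w g (w.1 - w.2 + e)%R.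
  have := @fubini_tonelli1 _ _ _ _ _ mu mu _ (mg2 e) (fun w => g0 _).
  rewrite /= => ->; apply: eq_integral => x _; apply: eq_integral => y _ /=.
  by congr g; ring.
have mcs : measurable_fun setT
    (fun w : (bool * R) * (bool * R) => g (coin_shift w.1 - coin_shift w.2)%R).
  apply: (measurableT_comp mg); apply: measurable_funB.
    exact: (measurableT_comp measurable_coin_shift measurable_fst).
  exact: (measurableT_comp measurable_coin_shift measurable_snd).
have := @fubini_tonelli1 _ _ _ _ _ coin_prob coin_prob _ mcs (fun w => g0 _).
rewrite /= => ->; rewrite /fubini_F/=.
pose k (a : R) := 2^-1%:E * G (a - h)%R + 2^-1%:E * G (a + h)%R.
have k0 a : 0 <= k a by rewrite adde_ge0// mule_ge0// lee_fin.
have mk : measurable_fun setT k.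
  apply: emeasurable_funD; apply: measurable_funeM.
    exact: (measurable_shift (- h) mG).
  exact: (measurable_shift h mG).
transitivity (\int[coin_prob]_w k (coin_shift w)).
  apply: eq_integral => w _; set a := coin_shift w.
  have mga : measurable_fun setT (fun y : R => g (a - y)%R).
    by apply: (measurableT_comp mg); exact: measurable_funB.
  rewrite (ge0_integral_coin mga (fun y => g0 _)) /k /G.
  congr (_ * _ + _ * _); apply: eq_integral => y _; congr g; ring.
rewrite ge0_integral_coin//.
have kE e : \int[mu]_x k (x + e)%R =
    2^-1%:E * \int[mu]_x G (x + (e - h))%R + 2^-1%:E * \int[mu]_x G (x + (e + h))%R.
  rewrite -!ge0_integralZl_EFin//; try exact: measurable_shift.
  rewrite -ge0_integralD; first last.
  - by apply: measurable_funeM; exact: measurable_shift.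
  - by move=> x _; rewrite mule_ge0// lee_fin.
  - by apply: measurable_funeM; exact: measurable_shift.
  - by move=> x _; rewrite mule_ge0// lee_fin.
  - exact: measurableT.
  by apply: eq_integral => x _; rewrite /k -!addrA.
rewrite !kE !GE subrr addNr.
have -> : (- h - h = - (h + h))%R by rewrite opprD.
have I0 e : 0 <= \int[mu \x mu]_w g (w.1 - w.2 + e)%R by apply: integral_ge0.
exact: mixE.
Qed.

End mixture.

(** * Energy of a mixture of translates of the equilibrium measure *)

Lemma log_energy_id (R : realType) (V : R -> R) (mu : probability R R) :
  log_energy V mu = log_energy V (law mu (@measurable_id _ R setT)).
Proof. exact: eq_log_energy. Qed.

Section coin_deficit.
Local Open Scope ereal_scope.
Context (R : realType) (V : R -> R) (muV : probability R R) (c r h eta : R).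
Hypothesis mV : measurable_fun setT V.
Hypothesis V_ge : forall x, (c <= V x)%R.
Hypothesis muV_min : equilibrium_measure V muV.
Hypothesis muV_fin : log_energy V muV != +oo.
Hypothesis r0 : (0 <= r)%R.
Hypothesis h01 : (0 < h <= 1)%R.
Hypothesis supp : {ae muV, forall x, (`|x| <= r)%R}.
Hypothesis V_diff : {ae muV, forall x,
  (V (x + h) + V (x - h) - 2 * V x <= eta * h ^+ 2)%R}.

Let X : R -> R := id.
Let mX : measurable_fun setT X. Proof. exact: measurable_id. Qed.
(* the factor [8] makes [L] exceed the diameter after the shift, which is at
   most [2 * (r + 1)], with room for a lower bound on the kernel *)
Let L : R := (8 * (r + 1))%R.
Let L0 : (0 < L)%R. Proof. by rewrite mulr_gt0// ltr_wpDl. Qed.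
Let Q := coin_prob muV.
Let Y := coin_shift h : bool * R -> R.
Let mY : measurable_fun setT Y. Proof. exact: measurable_coin_shift. Qed.

Let eX : finite_energy muV V X.
Proof.
apply: (finite_energy_law mV (mX := mX)).
by have := muV_fin; rewrite log_energy_id.
Qed.

Let XL : {ae muV \x muV, forall w, (`|X w.1 - X w.2| <= L)%R}.
Proof.
apply: filterS (ae_pair supp) => w [w1 w2].
have := ler_normB w.1 w.2; have := r0; move: w1 w2; rewrite /X /L/=.
lra.
Qed.

Let no_atom x : muV (X @^-1` [set x]) = 0.
Proof. by have [_ dX _] := eX; apply: ((ae_neq_no_atom muV mX).2 dX). Qed.

Let YL : {ae Q \x Q, forall w, (`|Y w.1 - Y w.2| <= L)%R}.
Proof.
have /andP[h0 h1] := h01.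
have : {ae Q, forall w, (`|Y w| <= r + 1)%R}.
  apply: (@ae_coin _ _ _ (fun y => `|y| <= r + 1)%R).
  - rewrite (_ : [set x | _] = `[(- (r + 1))%R, (r + 1)%R]%classic)//.
    by apply/seteqP; split => y /=; rewrite in_itv/= ler_norml.
  - apply: filterS supp => x xr; rewrite (le_trans (ler_normD _ _))//.
    by rewrite (gtr0_norm h0); lra.
  - apply: filterS supp => x xr; rewrite (le_trans (ler_normB _ _))//.
    by rewrite (gtr0_norm h0); lra.
move=> /(@ae_pair _ _ _ Q _).
apply: filterS => w [w1 w2].
have := ler_normB (Y w.1) (Y w.2); have := r0; move: w1 w2; rewrite /L/=.
lra.
Qed.

Let dY : {ae Q \x Q, forall w, Y w.1 != Y w.2}.
Proof.
apply: ((ae_neq_no_atom Q mY).1) => x.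
have mx : measurable (Y @^-1` [set x]).
  by rewrite -[X in measurable X]setTI; exact: mY.
have shift_neq e : {ae muV, forall y, ~ (y + e = x)%R}.
  exists [set (x - e)%R]; split => //.
    exact: no_atom.
  by move=> y /= /contrapT <-; rewrite addrK.
have : {ae Q, forall w, ~ (Y w = x)}.
  apply: (@ae_coin _ _ _ (fun y => ~ (y = x))).
  - exact: (measurableC (measurable_set1 x)).
  - exact: shift_neq.
  - exact: shift_neq.
have -> : {ae Q, forall w, ~ (Y w = x)} = Q.-negligible (Y @^-1` [set x]).
  by rewrite /almost_everywhere/=; congr (_.-negligible _); rewrite setCK.
by move/(negligibleP _ mx).
Qed.

Let W x := (V x - c)%R.
Let W0 x : (0 <= W x)%R. Proof. by rewrite subr_ge0. Qed.
Let mW : measurable_fun setT (EFin \o W).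
Proof. by apply/measurable_EFinP; exact: measurable_funB. Qed.

Let iVX : muV.-integrable setT (EFin \o V).
Proof. by case: eX. Qed.

Let WY_le : \int[Q]_w (W (Y w))%:E <=
  (\int[muV]_x V x - c + eta * h ^+ 2 / 2)%R%:E.
Proof.
have WE0 y : 0 <= (EFin \o W) y by rewrite lee_fin.
have := ge0_integral_coin muV h mW WE0; rewrite /= => ->.
have mWe e : measurable_fun setT (fun x : R => (W (x + e))%:E).
  by apply: (measurableT_comp mW); exact: measurable_funD.
rewrite -!ge0_integralZl_EFin//;
  do ?[exact: mWe]; do ?[by move=> x _; rewrite lee_fin].
rewrite -ge0_integralD//; do ?[by move=> x _; rewrite mule_ge0// lee_fin];
  do ?[by apply: measurable_funeM; exact: mWe].
under eq_integral do rewrite -!EFinM -EFinD.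
have ic k := @finite_measure_integrable_cst _ _ _ muV setT k measurableT.
have iW : muV.-integrable setT (EFin \o (fun x => V x + (eta * h ^+ 2 / 2 - c))%R).
  have := integrableD measurableT iVX (ic (eta * h ^+ 2 / 2 - c)%R).
  by apply: eq_integrable.
have -> : (\int[muV]_x V x - c + eta * h ^+ 2 / 2 =
    \int[muV]_x (V x + (eta * h ^+ 2 / 2 - c)))%R.
  rewrite (RintegralD measurableT iVX (ic _)).
  rewrite Rintegral_cst//; have /= -> := @probability_setT _ _ _ muV.
  by rewrite mulr1 -addrA [(- c + _)%R]addrC.
apply: ge0_ae_le_integral_Rintegral => //.
- apply: measurable_funD; apply: measurable_funM => //; apply/measurable_EFinP;
    exact: mWe.
- by move=> x; rewrite addr_ge0// mulr_ge0.
- by apply: filterS V_diff => x; rewrite /W; lra.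
Qed.

Let iWY : Q.-integrable setT (EFin \o (W \o Y)).
Proof.
apply/integrableP; split; first exact: (measurableT_comp mW mY).
apply: le_lt_trans (ltry _); apply: le_trans WY_le.
by apply: ge0_le_integral => //; [exact: measurableT_comp (measurableT_comp mW mY)|exact: (measurableT_comp mW mY)|move=> w _ /=; rewrite ger0_norm].
Qed.

Let iVY : Q.-integrable setT (EFin \o (V \o Y)).
Proof.
have := integrableD measurableT iWY (@finite_measure_integrable_cst _ _ _ Q setT c measurableT).
by apply: eq_integrable => // w _; rewrite /= -EFinD /W subrK.
Qed.

Let K := kernel_corr muV X L.

Let Kfin e : K e \is a fin_num.
Proof.
have [_ dX il] := eX.
have K0 := (kernel_corr_fin_num mX dX XL).2 il.
rewrite ge0_fin_numE ?kernel_corr_ge0// (le_lt_trans (kernel_corr_le _ L mX e))//.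
by rewrite -ge0_fin_numE// kernel_corr_ge0.
Qed.

Let fin_mix (a b c0 : \bar R) : a \is a fin_num -> b \is a fin_num ->
  c0 \is a fin_num -> 2^-1%:E * a + 4^-1%:E * (b + c0) =
    (2^-1 * fine a + 4^-1 * (fine b + fine c0))%R%:E.
Proof. by case: a => // x; case: b => // y; case: c0. Qed.

Let KY : kernel_corr Q Y L 0 =
  (2^-1 * fine (K 0) + 4^-1 * (fine (K (h + h)) + fine (K (- (h + h)))))%R%:E.
Proof.
rewrite /kernel_corr; under eq_integral do rewrite addr0.
rewrite (ge0_integral_coin2 muV h (@measurable_tent_kernel R L) (tent_kernel_ge0 L)).
exact: fin_mix (Kfin 0) (Kfin (h + h)) (Kfin (- (h + h))).
Qed.

Let measurable_dist e :
  measurable_fun setT (fun w : R * R => (`|w.1 - w.2 + e|)%:E).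
Proof.
apply/measurable_EFinP; apply: measurableT_comp => //.
apply: measurable_funD => //; apply: measurable_funB.
  exact: measurable_fst.
exact: measurable_snd.
Qed.

Let measurable_normE : measurable_fun setT (fun z : R => `|z|%:E).
Proof. by apply/measurable_EFinP; exact: normr_measurable. Qed.

Let dist_le :
  (\int[muV \x muV]_w `|X w.1 - X w.2| <= \int[Q \x Q]_w `|Y w.1 - Y w.2|)%R.
Proof.
have iX : (muV \x muV).-integrable setT
    (EFin \o (fun w => `|X w.1 - X w.2|)%R).
  apply: (ae_le_integrable (g := cst L)).
  - exact: measurable_normrB.
  - exact: (@finite_measure_integrable_cst _ _ _ (muV \x muV : probability _ _)).
  - by apply: filterS XL => w; rewrite normr_id.
have iY : (Q \x Q).-integrable setT (EFin \o (fun w => `|Y w.1 - Y w.2|)%R).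
  apply: (ae_le_integrable (g := cst L)).
  - exact: measurable_normrB.
  - exact: (@finite_measure_integrable_cst _ _ _ (Q \x Q : probability _ _)).
  - by apply: filterS YL => w; rewrite normr_id.
rewrite -lee_fin !EFin_Rintegral//.
have n0 (z : R) : 0 <= `|z|%:E by rewrite lee_fin.
have := ge0_integral_coin2 muV h measurable_normE n0; rewrite /= => ->.
rewrite -ge0_integralD//; do ?[exact: measurable_dist].
have m2 : measurable_fun setT
    (fun w : R * R => `|w.1 - w.2 + (h + h)|%:E + `|w.1 - w.2 - (h + h)|%:E).
  by apply: emeasurable_funD; exact: measurable_dist.
have n2 (w : R * R) : 0 <= `|w.1 - w.2 + (h + h)|%:E + `|w.1 - w.2 - (h + h)|%:E.
  by rewrite adde_ge0.
rewrite -!ge0_integralZl_EFin//; do ?[exact: measurable_dist];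
  do ?[by move=> w _; exact: n2]; do ?[by move=> w _; exact: n0].
rewrite -ge0_integralD//;
  do ?[by move=> w _; rewrite mule_ge0// lee_fin];
  do ?[by apply: measurable_funeM; exact: measurable_dist];
  do ?[exact: measurable_funeM].
apply: ge0_le_integral => //.
- apply/measurable_EFinP; exact: measurable_normrB.
- apply: emeasurable_funD; apply: measurable_funeM => //; exact: measurable_dist.
move=> w _ /=; rewrite /X; set z := (w.1 - w.2)%R.
rewrite -[leRHS]/((2^-1 * `|z + 0| + 4^-1 * (`|z + (h + h)| + `|z - (h + h)|))%R%:E).
rewrite lee_fin addr0.
have := ler_normD (z + (h + h))%R (z - (h + h))%R.
rewrite (_ : z + (h + h) + (z - (h + h)) = 2 * z)%R; last by ring.
rewrite normrM gtr0_norm//; lra.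
Qed.

Let arith (A A' D D' k0 k1 k2 l l' e : R) :
  (A - (l - 1 + D * l' - k0) <=
   A' - (l - 1 + D' * l' - (2^-1 * k0 + 4^-1 * (k1 + k2))) ->
  A' - c <= A - c + e -> D * l' <= D' * l' -> 2^-1 * k0 - 4^-1 * (k1 + k2) <= e)%R.
Proof. lra. Qed.

(** The energy cannot decrease when the equilibrium measure is replaced by the
    mixture of its translates by [h] and [- h]. The potential term increases by
    at most [eta * h ^ 2 / 2], and the mean distance does not decrease, so the
    correlation of the kernel drops by at most that amount. *)
Lemma coin_deficit :
  (2^-1 * fine (K 0) - 4^-1 * (fine (K (h + h)) + fine (K (- (h + h)))) <=
   eta * h ^+ 2 / 2)%R.
Proof.
have [_ dX _] := eX.
have KYfin : kernel_corr Q Y L 0 \is a fin_num by rewrite KY.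
have eY : finite_energy Q V Y.
  by split=> //; exact: (kernel_corr_fin_num mY dY YL).1.
have := muV_min (law Q mY); rewrite log_energy_id.
rewrite (log_energy_law mV _ eX) (log_energy_law mV _ eY).
have [_ _ ilX] := eX; have [_ _ ilY] := eY.
rewrite -!EFin_Rintegral// -!EFinB lee_fin.
have WYr : (\int[Q]_w V (Y w) - c <= \int[muV]_x V x - c + eta * h ^+ 2 / 2)%R.
  rewrite -lee_fin; apply: le_trans WY_le.
  rewrite -EFin_Rintegral// RintegralB//.
    rewrite Rintegral_cst//; have /= -> := @probability_setT _ _ _ Q.
    by rewrite mulr1.
  exact: (@finite_measure_integrable_cst _ _ _ Q).
rewrite (integral_ln_dist mX dX XL (Kfin 0)) (integral_ln_dist mY dY YL KYfin).
rewrite KY /= -/K.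
have dl := dist_le; rewrite -(@ler_pM2r _ L^-1) ?invr_gt0// in dl.
move=> E; exact: (arith E WYr dl).
Qed.

End coin_deficit.

(** * Positive curvature on the support of the equilibrium measure *)

Section curvature.
Context (R : realType) (V : R -> R) (muV : probability R R) (c r rho : R).
Hypothesis V_C2 : C2 V.
Hypothesis V_ge : forall x, (c <= V x)%R.
Hypothesis rho0 : 0 < rho.
Hypothesis V_far : forall x, r <= `|x| -> rho <= (V^`(2))%classic x.
Hypothesis muV_min : equilibrium_measure V muV.
Hypothesis muV_fin : log_energy V muV != +oo%E.

Lemma C2_continuous : continuous V.
Proof.
by case: V_C2 => dV _ _ x; apply: differentiable_continuous; exact/derivable1_diffP.
Qed.

(** The kernel vanishes at distances larger than [L]. *)
Lemma kernel_corr_far (L M t : R) : {ae muV, forall x, `|x| <= M} ->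
  2 * M + L <= `|t| -> kernel_corr muV (id : R -> R) L t = 0%E.
Proof.
move=> supp Lt.
rewrite -[RHS](integral0 (muV \x muV)%E setT).
apply: ge0_ae_eq_integral => //.
- apply: (measurableT_comp (@measurable_tent_kernel R L)).
  apply: measurable_funD => //; apply: measurable_funB.
    exact: measurable_fst.
  exact: measurable_snd.
- by move=> w _; exact: tent_kernel_ge0.
- apply: filterS (ae_pair supp) => w [w1 w2] _ /=; apply: tent_kernel0.
  rewrite [_ + t]addrC.
  have := ler_normB w.1 w.2; have := lerB_normD t (w.1 - w.2).
  move: w1 w2 Lt; lra.
Qed.

(** On the support [|z| <= 2 * M <= L / 4], so that the kernel is at least
    [ln 4 - 1 >= 1 / 4]. *)
Lemma kernel_corr_ge (L M : R) : 0 <= M -> {ae muV, forall x, `|x| <= M} ->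
  {ae (muV \x muV)%E, forall w, w.1 != w.2} ->
  L = 8 * (M + 1) -> ((4^-1)%:E <= kernel_corr muV (id : R -> R) L 0)%E.
Proof.
move=> M0 supp neq LM.
have L0 : 0 < L by rewrite LM; lra.
have -> : (4^-1)%:E = (\int[muV \x muV]_w (cst (4^-1)%:E w))%E.
  rewrite integral_cst//.
  have /= -> := @probability_setT _ _ _ ((muV \x muV)%E : probability _ R).
  by rewrite mule1.
apply: ae_ge0_le_integral => //.
- by move=> w _; rewrite lee_fin invr_ge0.
- by move=> w _; exact: tent_kernel_ge0.
- apply: (measurableT_comp (@measurable_tent_kernel R L)).
  apply: measurable_funD => //; apply: measurable_funB.
    exact: measurable_fst.
  exact: measurable_snd.
- apply: filterS2 (ae_pair supp) neq => w [w1 w2] w12 _ /=.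
  rewrite addr0; set z := w.1 - w.2.
  have z0 : 0 < `|z| by rewrite normr_gt0 subr_eq0.
  have zM : `|z| <= 2 * M by have := ler_normB w.1 w.2; rewrite -/z; lra.
  rewrite tent_kernelE//; last by rewrite LM; lra.
  rewrite lee_fin.
  have s4 : `|z| / L <= 4^-1 by rewrite ler_pdivrMr// LM; lra.
  have h0 : 0 < 2^-1 :> R by rewrite invr_gt0.
  have sL : 0 < `|z| / L by rewrite divr_gt0.
  have := ln_le_tangent sL h0.
  rewrite ln_div ?posrE// invrK lnV ?posrE//.
  have : ln (1 + (- 2^-1)) <= - 2^-1 :> R by apply: le_ln1Dx; lra.
  have -> : 1 + (- 2^-1) = 2^-1 :> R by lra.
  rewrite lnV ?posrE//.
  lra.
Qed.

Lemma exists_pow2_small (t e : R) : 0 < t -> 0 < e ->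
  exists n : nat, t / 2 ^+ n.+1 <= e.
Proof.
move=> t0 e0; exists (Num.truncn (t / e)).
set n := Num.truncn _.
have h : t / e < n.+1%:R by exact: truncnS_gt.
rewrite ler_pdivrMr ?exprn_gt0//.
rewrite ltr_pdivrMr// in h; rewrite (le_trans (ltW h))// mulrC ler_wpM2l ?(ltW e0)//.
by rewrite -natrX ler_nat ltnW// ltn_expl.
Qed.

Let V' := (V^`())%classic.
Let V'' := (V^`(2))%classic.

Let dV x : derivable V x 1. Proof. by case: V_C2. Qed.
Let dV' x : derivable V' x 1. Proof. by case: V_C2. Qed.
Let cV'' : continuous V''. Proof. by case: V_C2. Qed.

Lemma second_difference_upper x h eta : 0 <= h ->
  (forall y, `|y - x| <= h -> V'' y <= eta) ->
  V (x + h) + V (x - h) - 2 * V x <= eta * h ^+ 2.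
Proof.
move=> h0 H; apply: (@symmetric_difference_le R V x dV eta h h0) => u u0 uh.
have ab : x - u <= x + u by lra.
have := @derive1_le_increment R V' eta (x - u) (x + u) dV' ab.
have -> : x + u - (x - u) = 2 * u by ring.
rewrite mulrCA -mulrA; apply => y y1 y2.
by apply: H; rewrite ler_norml; apply/andP; split; lra.
Qed.

Let four_pow n : (4 ^+ n : R) = (2 ^+ n) ^+ 2.
Proof. by rewrite -exprM mulnC exprM expr2 -natrM. Qed.

Let arith (q k a b : R) : q <= k - a -> q <= k - b -> 0 < q ->
  2^-1 * k - 4^-1 * (a + b) <= q / 8 -> False.
Proof. lra. Qed.

(** The equilibrium measure charges every neighbourhood of some point of positive
    curvature. Otherwise [V'' <= 0] almost everywhere for [muV], so [muV] has
    bounded support and the second differences of [V] are at most [o (h ^ 2)] on it,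
    whereas splitting [muV] into two translates lowers the logarithmic part of
    the energy by a multiple of [h ^ 2]. *)
Lemma curvature_on_support : exists2 x0, 0 < V'' x0 &
  forall e, 0 < e -> muV `]x0 - e, x0 + e[%classic != 0%E.
Proof.
apply: contrapT => H.
have ae0 : {ae muV, forall x, ~ (0 < V'' x)}.
  apply: ae_of_locally_null => x V''x; apply: contrapT => K; apply: H.
  exists x => // e e0; apply/negP => /eqP me; apply: K.
  by exists e.
pose M := Num.max r 0.
have M0 : 0 <= M by rewrite le_max lexx orbT.
have supp : {ae muV, forall x, `|x| <= M}.
  apply: filterS ae0 => x; apply: contra_notT; rewrite -ltNge gt_max => /andP[rx _].
  by rewrite (lt_le_trans rho0)// V_far// ltW.
pose L := 8 * (M + 1).
have LM : L = 8 * (M + 1) by [].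
have L0 : 0 < L by rewrite LM; lra.
have mV : measurable_fun setT V := continuous_measurable_fun C2_continuous.
have mid := @measurable_id _ R setT.
pose K := kernel_corr muV (id : R -> R) L.
have eX : finite_energy muV V (id : R -> R).
  by apply: (finite_energy_law mV (mX := mid)); have := muV_fin; rewrite log_energy_id.
have [_ neq il] := eX.
have XL : {ae (muV \x muV)%E, forall w, `|id w.1 - id w.2| <= L}.
  apply: filterS (ae_pair supp) => w [w1 w2].
  by have := ler_normB w.1 w.2; rewrite /=; move: w1 w2 M0; rewrite LM; lra.
have Kfin : K 0 \is a fin_num by exact: (kernel_corr_fin_num mid neq XL).2 il.
have K4 : 4^-1 <= fine (K 0).
  by rewrite -lee_fin fineK//; exact: (kernel_corr_ge M0 supp neq LM).
set k0 := fine (K 0) in K4.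
have k00 : 0 < k0 by lra.
pose t := 2 * M + L.
have t0 : 0 < t by rewrite /t; lra.
have Kt : K t = 0%E by apply: (kernel_corr_far supp); rewrite gtr0_norm.
have KNt : K (- t) = 0%E by apply: (kernel_corr_far supp); rewrite normrN gtr0_norm.
(* this [eta] makes [eta * h ^ 2 / 2] a quarter of the lower bound
   [k0 / 4 ^ n / 2] for the drop of the correlation *)
pose eta := k0 / t ^+ 2.
have eta0 : 0 < eta by rewrite divr_gt0// exprn_gt0.
have [e e0 He] := uniform_upper_modulus M cV'' eta0.
have e1 : 0 < Num.min e 1 by rewrite lt_min e0 ltr01.
have [n] := exists_pow2_small t0 e1; rewrite le_min => /andP[ne n1].
pose h := t / 2 ^+ n.+1.
have h0 : 0 < h by rewrite divr_gt0// exprn_gt0.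
have hh : h + h = t / 2 ^+ n.
  by rewrite /h exprS; field; rewrite expf_eq0 pnatr_eq0 andbF.
have h01 : 0 < h <= 1 by rewrite h0.
have Vdiff : {ae muV, forall x, V (x + h) + V (x - h) - 2 * V x <= eta * h ^+ 2}.
  apply: filterS2 supp ae0 => x xM /negP; rewrite -leNgt => V''x.
  apply: second_difference_upper; first exact: ltW.
  move=> y yx; apply: (le_trans (He x y xM (le_trans yx ne))).
  by move: V''x; lra.
have D : 2^-1 * k0 - 4^-1 * (fine (K (h + h)) + fine (K (- (h + h)))) <=
    eta * h ^+ 2 / 2.
  exact: (coin_deficit mV V_ge muV_min muV_fin M0 h01 supp Vdiff).
have G1 : k0 / 4 ^+ n <= k0 - fine (K (t / 2 ^+ n)).
  exact: (kernel_corr_geom mid n Kfin Kt).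
have G2 : k0 / 4 ^+ n <= k0 - fine (K (- t / 2 ^+ n)).
  exact: (kernel_corr_geom mid n Kfin KNt).
rewrite mulNr -hh in G2; rewrite -hh in G1.
have E : eta * h ^+ 2 / 2 = k0 / 4 ^+ n / 8.
  rewrite /eta /h [(2 ^+ n.+1)%R]exprS.
  rewrite four_pow.
  have : (2 ^+ n : R) != 0 by rewrite expf_eq0 pnatr_eq0 andbF.
  by move: (2 ^+ n : R) => a a0; field; rewrite a0 (gt_eqF t0).
rewrite E in D.
have q0 : 0 < k0 / 4 ^+ n by rewrite divr_gt0// exprn_gt0.
exact: (arith G1 G2 q0 D).
Qed.

End curvature.

(** * Convexity gaps at midpoints *)

Section midpoint_gap.
Context (R : realType) (V : R -> R) (r rho : R).
Hypothesis V_C2 : C2 V.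
Hypothesis V_convex : convex_on_line V.
Hypothesis rho0 : 0 < rho.
Hypothesis r0 : 0 < r.
Hypothesis V_far : forall x, r <= `|x| -> rho <= (V^`(2))%classic x.

Let V' := (V^`())%classic.
Let V'' := (V^`(2))%classic.

Let dV x : derivable V x 1. Proof. by case: V_C2. Qed.
Let dV' x : derivable V' x 1. Proof. by case: V_C2. Qed.
Let V'nd : {homo V' : x y / x <= y}.
Proof. exact: (convex_derive1_nd V_convex dV). Qed.

(** The convexity gap of [V] at the midpoint, written in the form [1 - t], [t]
    with [t = 2^-1]. *)
Definition midpoint_gap (z : R * R) : R :=
  (1 - 2^-1) * V z.1 + 2^-1 * V z.2 - V ((1 - 2^-1) * z.1 + 2^-1 * z.2).

Lemma midpoint_gap_ge0 z : 0 <= midpoint_gap z.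
Proof. by rewrite subr_ge0; exact: (convex_on_lineE z.1 z.2 V_convex (half01 R)). Qed.

Lemma measurable_midpoint_gap : measurable_fun setT midpoint_gap.
Proof.
have mV : measurable_fun setT V := continuous_measurable_fun (C2_continuous V_C2).
apply: measurable_funB.
  by apply: measurable_funD; apply: measurable_funM => //; exact: measurableT_comp.
apply: (measurableT_comp mV).
by apply: measurable_funD; exact: measurable_funM.
Qed.

Lemma midpoint_gapE (x y : R) : midpoint_gap (x, y) =
  2^-1 * (V ((x + y) / 2 + (y - x) / 2) + V ((x + y) / 2 - (y - x) / 2)
    - 2 * V ((x + y) / 2)).
Proof.
rewrite /midpoint_gap/=.
have -> : (1 - 2^-1) * x + 2^-1 * y = (x + y) / 2 by field.
have -> : (x + y) / 2 + (y - x) / 2 = y by field.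
have -> : (x + y) / 2 - (y - x) / 2 = x by field.
by field.
Qed.

Lemma midpoint_gapC (x y : R) : midpoint_gap (x, y) = midpoint_gap (y, x).
Proof.
rewrite /midpoint_gap/= (_ : (1 - 2^-1) * y + 2^-1 * x = (1 - 2^-1) * x + 2^-1 * y).
  by field.
by field.
Qed.

Let V'_far_pos (a b : R) : r <= a -> a <= b -> rho * (b - a) <= V' b - V' a.
Proof.
have r_gt0 := r0; have rho_gt0 := rho0.
move=> ra ab; apply: derive1_ge_increment => // x; move=> ax _.
have x0 : 0 <= x by lra.
have xx : r <= `|x| by rewrite ger0_norm//; lra.
exact: V_far xx.
Qed.

Let V'_far_neg (a b : R) : b <= - r -> a <= b -> rho * (b - a) <= V' b - V' a.
Proof.
have r_gt0 := r0; have rho_gt0 := rho0.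
move=> ra ab; apply: derive1_ge_increment => // x; move=> _ xb.
have x0 : x <= 0 by lra.
have xx : r <= `|x| by rewrite ler0_norm//; lra.
exact: V_far xx.
Qed.

Let sym_diff_ge0 (z u : R) : 0 <= V (z + u) + V (z - u) - 2 * V z.
Proof.
have := convex_on_lineE (z + u) (z - u) V_convex (half01 R).
have -> : (1 - 2^-1) * (z + u) + 2^-1 * (z - u) = z by field.
lra.
Qed.

Let sym_diff_far_pos (z s : R) : 0 <= z -> 0 <= s -> 3 * r <= z + s ->
  rho / 8 * s ^+ 2 <= V (z + s) + V (z - s) - 2 * V z.
Proof.
have r_gt0 := r0; have rho_gt0 := rho0.
(* if [s] is large, the growth is used from [u = r] on, where [r <= z + u];
   if not, then [r <= z] and it is used from [u = 0] on *)
move=> z0 s0 zs; have [rs|sr] := leP (2 * r) s.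
  have als : r <= s by lra.
  have := @symmetric_difference_ge R V z dV (rho / 2) r s als.
  have H u : r <= u -> u <= s -> 2 * (rho / 2) * (u - r) <= V' (z + u) - V' (z - u).
    move=> ru us.
    have h1 : V' (z - u) <= V' (z + r) by apply: V'nd; lra.
    have ra : r <= z + r by lra.
    have ab : z + r <= z + u by lra.
    have := V'_far_pos ra ab.
    rewrite (_ : z + u - (z + r) = u - r); last by ring.
    lra.
  move=> /(_ H); have := sym_diff_ge0 z r.
  have : s ^+ 2 / 4 <= (s - r) ^+ 2 by nra.
  move: (V (z + s)) (V (z - s)) (V (z + r)) (V (z - r)) => a b c d.
    move: rho_gt0; move: rho => k; nra.
have als : 0 <= s by lra.
have := @symmetric_difference_ge R V z dV (rho / 2) 0 s als.
have H u : 0 <= u -> u <= s -> 2 * (rho / 2) * (u - 0) <= V' (z + u) - V' (z - u).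
  move=> ru us.
  have h1 : V' (z - u) <= V' z by apply: V'nd; lra.
  have ra : r <= z by lra.
  have ab : z <= z + u by lra.
  have := V'_far_pos ra ab.
  rewrite (_ : z + u - z = u); last by ring.
  lra.
move=> /(_ H); rewrite !subr0 addr0.
have : 0 <= s ^+ 2 by exact: sqr_ge0.
move: (s ^+ 2) (V (z + s)) (V (z - s)) (V z) => a b c d.
move: rho_gt0; move: rho => k; nra.
Qed.

Let sym_diff_far_neg (z s : R) : z <= 0 -> 0 <= s -> z - s <= - (3 * r) ->
  rho / 8 * s ^+ 2 <= V (z + s) + V (z - s) - 2 * V z.
Proof.
have r_gt0 := r0; have rho_gt0 := rho0.
move=> z0 s0 zs; have [rs|sr] := leP (2 * r) s.
  have als : r <= s by lra.
  have := @symmetric_difference_ge R V z dV (rho / 2) r s als.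
  have H u : r <= u -> u <= s -> 2 * (rho / 2) * (u - r) <= V' (z + u) - V' (z - u).
    move=> ru us.
    have h1 : V' (z - r) <= V' (z + u) by apply: V'nd; lra.
    have ra : z - r <= - r by lra.
    have ab : z - u <= z - r by lra.
    have := V'_far_neg ra ab.
    rewrite (_ : z - r - (z - u) = u - r); last by ring.
    lra.
  move=> /(_ H); have := sym_diff_ge0 z r.
  have : s ^+ 2 / 4 <= (s - r) ^+ 2 by nra.
  move: (V (z + s)) (V (z - s)) (V (z + r)) (V (z - r)) => a b c d.
    move: rho_gt0; move: rho => k; nra.
have als : 0 <= s by lra.
have := @symmetric_difference_ge R V z dV (rho / 2) 0 s als.
have H u : 0 <= u -> u <= s -> 2 * (rho / 2) * (u - 0) <= V' (z + u) - V' (z - u).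
  move=> ru us.
  have h1 : V' z <= V' (z + u) by apply: V'nd; lra.
  have ra : z <= - r by lra.
  have ab : z - u <= z by lra.
  have := V'_far_neg ra ab.
  rewrite (_ : z - (z - u) = u); last by ring.
  lra.
move=> /(_ H); rewrite !subr0 addr0.
have : 0 <= s ^+ 2 by exact: sqr_ge0.
move: (s ^+ 2) (V (z + s)) (V (z - s)) (V z) => a b c d.
move: rho_gt0; move: rho => k; nra.
Qed.

(** If one of the points is far, then the symmetric difference of [V'] grows at
    rate [rho] on a definite proportion of the segment. *)
Lemma midpoint_gap_far (x y : R) : 3 * r <= `|x| \/ 3 * r <= `|y| ->
  rho / 64 * (x - y) ^+ 2 <= midpoint_gap (x, y).
Proof.
have r_gt0 := r0; have rho_gt0 := rho0.
wlog xy : x y / x <= y.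
  move=> H xry; have [/H|/ltW/H] := leP x y; first by apply.
  by rewrite midpoint_gapC -opprB sqrrN; apply; case: xry; [right|left].
move=> xry; rewrite midpoint_gapE.
set z := (x + y) / 2; set s := (y - x) / 2.
have s0 : 0 <= s by rewrite /s; lra.
have -> : (x - y) ^+ 2 = 4 * s ^+ 2 by rewrite /s; field.
suff : rho / 8 * s ^+ 2 <= V (z + s) + V (z - s) - 2 * V z.
  by move: (V (z + s)) (V (z - s)) (V z) (s ^+ 2) => a b c d; lra.
have [z0|z0] := leP 0 z.
  apply: sym_diff_far_pos => //; rewrite /z /s in z0 *.
  by case: xry => h; apply: (le_trans h); rewrite ler_norml; apply/andP; split; lra.
apply: sym_diff_far_neg => //; first exact: ltW.
rewrite lerNr; rewrite /z /s in z0 *.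
by case: xry => h; apply: (le_trans h); rewrite ler_norml; apply/andP; split; lra.
Qed.

Lemma midpoint_gap_near (x0 delta kappa x y : R) : 0 < kappa -> 0 < delta ->
  (forall u, `|u - x0| <= 2 * delta -> kappa <= V'' u) ->
  `|x - x0| <= delta -> `|y - x| <= delta ->
  kappa / 8 * (x - y) ^+ 2 <= midpoint_gap (x, y).
Proof.
move=> k0 d0 Hk xx0 yx.
have key (a b : R) : a <= b -> (forall u, a <= u -> u <= b -> kappa <= V'' u) ->
    kappa / 8 * (a - b) ^+ 2 <= midpoint_gap (a, b).
  move=> ab Hu; rewrite midpoint_gapE.
  set z := (a + b) / 2; set s := (b - a) / 2.
  have s0 : 0 <= s by rewrite /s; lra.
  have := @symmetric_difference_ge R V z dV kappa 0 s s0.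
  have H u : 0 <= u -> u <= s -> 2 * kappa * (u - 0) <= V' (z + u) - V' (z - u).
    move=> u0 us.
    have zu : z - u <= z + u by lra.
    have := @derive1_ge_increment R V' kappa (z - u) (z + u) dV' zu.
    have -> : z + u - (z - u) = 2 * u by ring.
    rewrite subr0 mulrCA -mulrA; apply => w w1 w2.
    by apply: Hu; rewrite /z /s in us w1 w2 *; lra.
  move=> /(_ H); rewrite !subr0 addr0.
  have -> : (a - b) ^+ 2 = 4 * s ^+ 2 by rewrite /s; field.
  by move: (V (z + s)) (V (z - s)) (V z) (s ^+ 2) => A B C D; lra.
move: xx0 yx; rewrite !ler_norml => /andP[h1 h2] /andP[h3 h4].
have [xy|/ltW yx] := leP x y.
  by apply: key => // u xu uy; apply: Hk; rewrite ler_norml; apply/andP; split; lra.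
rewrite midpoint_gapC -opprB sqrrN.
by apply: key => // u xu uy; apply: Hk; rewrite ler_norml; apply/andP; split; lra.
Qed.

Let same_sign_neq0 (u v : R) : 0 < u * v -> u + 2 * v != 0.
Proof.
move=> uv; have : 0 < (u + 2 * v) ^+ 2 by nra.
by apply: contraTneq => ->; rewrite expr0n/= ltxx.
Qed.

Let same_sign_ratio (u v : R) : 0 < u * v -> 0 <= u / (u + 2 * v) <= 1.
Proof.
move=> uv.
have sq : 0 < (u + 2 * v) ^+ 2 by rewrite exprn_even_gt0//= same_sign_neq0.
have -> : u / (u + 2 * v) = u * (u + 2 * v) / (u + 2 * v) ^+ 2.
  by field; exact: same_sign_neq0.
by rewrite divr_ge0 ?ler_pdivrMr ?mul1r ?(ltW sq)//; nra.
Qed.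

Let mono_arith (b p x y w q : R) : w <= (1 - b) * p + b * y ->
  q <= (1 - (1 - b) / 2) * p + (1 - b) / 2 * y ->
  (1 - 2^-1) * x + 2^-1 * w - p <= (1 - 2^-1) * x + 2^-1 * y - q.
Proof. by move=> ? ?; lra. Qed.

(** The gap increases when [w], on the segment from [x] to [y], is replaced by
    [y]. *)
Lemma midpoint_gap_mono (x w y : R) : 0 < (w - x) * (y - w) ->
  midpoint_gap (x, w) <= midpoint_gap (x, y).
Proof.
move=> uv; rewrite /midpoint_gap/=.
have := same_sign_ratio uv.
have den := same_sign_neq0 uv.
(* [w] and the midpoint of [x], [y] both lie between [p] and [y], with weights
   [b] and [(1 - b) / 2] on [y] *)
set p := (1 - 2^-1) * x + 2^-1 * w; set b := _ / _ => b01.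
have Hb := convex_on_lineE p y V_convex b01.
have a01 : 0 <= (1 - b) / 2 <= 1 by move/andP: b01 => [b0 b1]; apply/andP; split; lra.
have Ha := convex_on_lineE p y V_convex a01.
rewrite (_ : (1 - b) * p + b * y = w) in Hb; last by rewrite /b /p; field.
rewrite (_ : _ * p + _ * y = (1 - 2^-1) * x + 2^-1 * y) in Ha; last by rewrite /b /p; field.
exact: mono_arith Hb Ha.
Qed.

End midpoint_gap.

(** * Displacements and midpoint gaps *)

(** The remainder of [ln_midpoint_gap]. The power [-2] is used instead of an
    inverse for the sake of measurability. *)
Definition relative_gap (R : realType) (z : R * R) : R :=
  2^-1 * ((z.1 - z.2) ^+ 2 * (z.1 + z.2) `^ (-2)).

Lemma relative_gap_ge0 (R : realType) (z : R * R) : 0 <= relative_gap z.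
Proof. by rewrite mulr_ge0// mulr_ge0 ?sqr_ge0 ?powR_ge0. Qed.

Lemma relative_gapE (R : realType) (a b : R) : 0 < a -> 0 < b ->
  relative_gap (a, b) = 2^-1 * ((a - b) / (a + b)) ^+ 2.
Proof.
move=> a0 b0; rewrite /relative_gap/= expr_div_n.
by rewrite (powR_invn 2)// addr_ge0// ltW.
Qed.

Lemma measurable_relative_gap (R : realType) :
  measurable_fun setT (@relative_gap R).
Proof.
apply: measurable_funM => //; apply: measurable_funM.
  by apply: measurable_funX; exact: measurable_funB.
apply: (measurableT_comp (@measurable_powR R (-2))).
exact: measurable_funD.
Qed.

(* The constant [(2 + 4 * k2) * i + 64 * k2], with [k2 = K ^ 2] and [i = c^-1],
   is the one of [displacement_le_gaps]; the lemmas [le_gaps_far],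
   [le_gaps_jump] and [le_gaps_ball] are its three cases. *)
Section displacement_arithmetic.
Context (R : realType).
Implicit Types m g i d D a b k : R.

Lemma le_gaps_far m (m' : R) g i (k2 : R) D : D <= i * m -> 0 <= i -> 0 <= k2 -> 0 <= m ->
  0 <= m' -> 0 <= g -> D <= ((2 + 4 * k2) * i + 64 * k2) * (m + m' + g).
Proof.
move=> Dim i0 k0 m0 m'0 g0; apply: (le_trans Dim).
have h1 : 0 <= i * m by exact: mulr_ge0.
have h2 : 0 <= i * (m' + g) by rewrite mulr_ge0 ?addr_ge0.
have h3 : 0 <= (i + 4 * k2 * i + 64 * k2) * (m + m' + g).
  by rewrite mulr_ge0 ?addr_ge0 ?mulr_ge0.
by lra.
Qed.

Lemma le_gaps_jump m (m' : R) g i (k2 : R) D (D' : R) : 0 <= k2 -> 0 <= i -> 0 <= m -> 0 <= m' ->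
  0 <= g -> D <= 4 * k2 -> 1 <= D' -> D' <= i * m' ->
  D <= ((2 + 4 * k2) * i + 64 * k2) * (m + m' + g).
Proof.
move=> k0 i0 m0 m'0 g0 Dk D1 Dim.
have h1 : 4 * k2 <= 4 * k2 * (i * m').
  by rewrite ler_peMr ?mulr_ge0//; exact: le_trans Dim.
have h2 : 0 <= 4 * k2 * i * (m + g) by rewrite !mulr_ge0 ?addr_ge0.
have h3 : 0 <= (2 * i + 64 * k2) * (m + m' + g).
  by rewrite mulr_ge0 ?addr_ge0 ?mulr_ge0.
by lra.
Qed.

Lemma le_gaps_ball m (m' : R) g i (k2 : R) d D : 0 <= k2 -> 0 <= i -> 0 <= m -> 0 <= m' ->
  0 <= g -> (d - D) ^+ 2 <= 32 * k2 * g -> D ^+ 2 <= i * m' ->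
  d ^+ 2 <= ((2 + 4 * k2) * i + 64 * k2) * (m + m' + g).
Proof.
move=> k0 i0 m0 m'0 g0 dD Dim.
have h0 : d ^+ 2 <= 2 * D ^+ 2 + 2 * (d - D) ^+ 2.
  by rewrite -subr_ge0 (_ : _ - _ = (d - 2 * D) ^+ 2) ?sqr_ge0//; ring.
have h1 : 0 <= (2 * i) * (m + g) by rewrite !mulr_ge0 ?addr_ge0.
have h2 : 0 <= 64 * k2 * (m + m') by rewrite !mulr_ge0 ?addr_ge0.
have h3 : 0 <= 4 * k2 * i * (m + m' + g) by rewrite !mulr_ge0 ?addr_ge0.
by lra.
Qed.

Lemma sqrB_le_relative_gap a b k : 0 < a -> 0 < b -> a + b <= 4 * k ->
  (a - b) ^+ 2 <= 32 * k ^+ 2 * relative_gap (a, b).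
Proof.
move=> a0 b0 abk; have s0 : 0 < a + b by rewrite addr_gt0.
rewrite relative_gapE// expr_div_n.
have -> : 32 * k ^+ 2 * (2^-1 * ((a - b) ^+ 2 / (a + b) ^+ 2)) =
    ((4 * k) ^+ 2 / (a + b) ^+ 2) * (a - b) ^+ 2 by field; rewrite gt_eqF.
rewrite ler_peMl ?sqr_ge0// ler_pdivlMr ?exprn_gt0// mul1r.
by rewrite ler_pXn2r// nnegrE; lra.
Qed.

End displacement_arithmetic.

Section displacement_bound.
Context (R : realType) (V : R -> R) (r rho x0 kappa delta : R).
Hypothesis V_C2 : C2 V.
Hypothesis V_convex : convex_on_line V.
Hypothesis rho0 : 0 < rho.
Hypothesis r0 : 0 < r.
Hypothesis V_far : forall x, r <= `|x| -> rho <= (V^`(2))%classic x.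
Hypothesis kappa0 : 0 < kappa.
Hypothesis delta0 : 0 < delta.
Hypothesis V_near : forall u, `|u - x0| <= 2 * delta -> kappa <= (V^`(2))%classic u.

Let M := midpoint_gap V.
Let K : R := 3 * r + `|x0| + delta + 1.
(* the constant in [c * (x - y) ^ 2 <= M (x, y)], for [x] or [y] outside the
   ball of radius [K], or [x] near [x0] *)
Let c : R := Num.min (rho / 64) (Num.min (kappa / 8) (kappa * delta ^+ 2 / (32 * K ^+ 2))).

Let K_gt0 : 0 < K.
Proof.
have := r0; have := delta0; have : 0 <= `|x0| by [].
by rewrite /K; move: `|x0| => a; lra.
Qed.

Let K_r : 3 * r <= K.
Proof.
have := r0; have := delta0; have : 0 <= `|x0| by [].
by rewrite /K; move: `|x0| => a; lra.
Qed.

Let c_gt0 : 0 < c.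
Proof.
rewrite /c !lt_min !divr_gt0//= ?mulr_gt0//; exact: exprn_gt0.
Qed.

Let c_far (x y : R) : K <= `|x| \/ K <= `|y| -> c * (x - y) ^+ 2 <= M (x, y).
Proof.
move=> xy; apply: (@le_trans _ _ (rho / 64 * (x - y) ^+ 2)).
  by rewrite ler_wpM2r ?sqr_ge0// ge_min lexx.
apply: (midpoint_gap_far V_C2 V_convex rho0 r0 V_far).
by case: xy => h; [left|right]; exact: le_trans K_r h.
Qed.

Let near_bound (x : R) : `|x - x0| <= delta -> `|x| <= K - 1.
Proof.
have := r0; have := delta0 => d0 r1 xd; have := ler_normD (x - x0) x0.
rewrite subrK /K; move: xd; move: `|x - x0| `|x0| `|x| => a b d; lra.
Qed.

Let square_le (k d b e : R) : 0 <= k -> 0 <= e -> e <= 2 * b -> 0 < b ->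
  k * d ^+ 2 / (32 * b ^+ 2) * e ^+ 2 <= k / 8 * d ^+ 2.
Proof.
move=> k0 e0 eb b0.
have -> : k / 8 * d ^+ 2 = k * d ^+ 2 / (32 * b ^+ 2) * (2 * b) ^+ 2.
  by field; rewrite gt_eqF.
apply: ler_wpM2l; last by rewrite ler_pXn2r// nnegrE mulr_ge0// ltW.
by apply: divr_ge0; apply: mulr_ge0 => //; exact: sqr_ge0.
Qed.

Let c_near (x y : R) : `|x - x0| <= delta -> c * (x - y) ^+ 2 <= M (x, y).
Proof.
move=> xd; have [Ky|yK] := leP K `|y|; first by apply: c_far; right.
have near z := @midpoint_gap_near R V V_C2 x0 delta kappa x z kappa0 delta0 V_near xd.
have [yxd|dyx] := leP `|y - x| delta.
  apply: le_trans (near _ yxd).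
  by rewrite ler_wpM2r ?sqr_ge0// !ge_min lexx/= orbT.
have xyK : `|x - y| <= 2 * K.
  apply: (le_trans (ler_normB _ _)); have := near_bound xd; move: yK.
  by move: `|y| `|x| => a b; lra.
have k0 : 0 <= kappa by exact: ltW.
apply: (@le_trans _ _ (kappa / 8 * delta ^+ 2)).
  rewrite -(real_normK (num_real (x - y))).
  apply: le_trans (square_le delta k0 (normr_ge0 _) xyK K_gt0).
  by rewrite ler_wpM2r ?sqr_ge0// !ge_min lexx !orbT.
(* the point at distance [delta] from [x] in the direction of [y] *)
have [w [wx wy]] : exists w, `|w - x| = delta /\ 0 < (w - x) * (y - w).
  have d0 := delta0; have [xy|yx] := leP x y.
    exists (x + delta); move: dyx; rewrite ger0_norm ?subr_ge0// => dyx.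
    have -> : x + delta - x = delta by ring.
    by rewrite gtr0_norm//; split => //; rewrite mulr_gt0//; lra.
  exists (x - delta); move: dyx; rewrite ltr0_norm ?subr_lt0// => dyx.
  have -> : x - delta - x = - delta by ring.
  by rewrite normrN gtr0_norm//; split => //; rewrite mulNr -mulrN mulr_gt0//; lra.
apply: le_trans (midpoint_gap_mono V_convex wy).
have wd : `|w - x| <= delta by rewrite wx.
apply: le_trans (near _ wd).
by rewrite -normrN opprB in wx; rewrite -wx real_normK ?num_real.
Qed.

Let C : R := (2 + 4 * K ^+ 2) / c + 64 * K ^+ 2.

(** Let [x'] be near [x0], where [V] is curved, and let the pairs be comonotone.
    The displacement [x - y] is controlled by its own convexity gap if it is far
    out; otherwise it is compared with [x' - y'], which is controlled by its gap,
    and the difference of the two is the difference of the distances [|x - x'|]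
    and [|y - y'|], controlled by the gap of the logarithm. *)
Lemma displacement_le_gaps : exists2 C1 : R, 0 < C1 &
  forall x y x' y' : R, `|x' - x0| <= delta -> 0 <= (x - x') * (y - y') ->
  x != x' -> y != y' ->
  (x - y) ^+ 2 <= C1 * (M (x, y) + M (x', y') + relative_gap (`|x - x'|, `|y - y'|)).
Proof.
have K2 : 0 < K ^+ 2 by rewrite exprn_gt0.
exists C => [|x y x' y' x'd mono xx' yy'].
  rewrite /C; apply: addr_gt0; last exact: mulr_gt0.
  by apply: divr_gt0 => //; apply: addr_gt0 => //; exact: mulr_gt0.
have M0 : 0 <= M (x, y) by exact: midpoint_gap_ge0.
have M0' : 0 <= M (x', y') by exact: midpoint_gap_ge0.
have G0 := relative_gap_ge0 (`|x - x'|, `|y - y'|).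
have near := c_near y' x'd.
have xK := near_bound x'd.
have ic : 0 < c^-1 by rewrite invr_gt0.
(* [c D^2 <= M] in the form [D^2 <= c^-1 M] *)
have inv D m : c * D <= m -> D <= c^-1 * m by rewrite ler_pdivlMl.
have a0 : 0 < `|x - x'| by rewrite normr_gt0 subr_eq0.
have b0 : 0 < `|y - y'| by rewrite normr_gt0 subr_eq0.
have [Kx|xlt] := leP K `|x|.
  exact: (le_gaps_far (inv _ _ (c_far (or_introl Kx))) (ltW ic) (ltW K2) M0 M0' G0).
have [Ky|ylt] := leP K `|y|.
  exact: (le_gaps_far (inv _ _ (c_far (or_intror Ky))) (ltW ic) (ltW K2) M0 M0' G0).
have K0 := K_gt0.
have [Ky'|y'lt] := leP K `|y'|.
  (* [y'] is far from [x'], so the second gap is bounded below *)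
  have D1 : 1 <= (x' - y') ^+ 2.
    rewrite -(real_normK (num_real (x' - y'))) expr_ge1// distrC.
    by apply: le_trans (lerB_dist _ _); move: Ky' xK; move: `|y'| `|x'| => u v; lra.
  have D4 : (x - y) ^+ 2 <= 4 * K ^+ 2.
    rewrite -(real_normK (num_real (x - y))) (_ : 4 * K ^+ 2 = (2 * K) ^+ 2); last by ring.
    rewrite ler_pXn2r ?nnegrE ?mulr_ge0 ?(ltW K0)//; apply: (le_trans (ler_normB _ _)).
    by move: xlt ylt; move: `|y| `|x| => u v; lra.
  exact: (le_gaps_jump (ltW K2) (ltW ic) M0 M0' G0 D4 D1 (inv _ _ near)).
(* all four points lie in the ball of radius [K] *)
have ab : `|x - x'| + `|y - y'| <= 4 * K.
  have := ler_normB x x'; have := ler_normB y y'.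
  by move: xlt ylt y'lt xK; move: `|x| `|y| `|y'| `|x'| `|x - x'| `|y - y'|
    => ? ? ? ? ? ?; lra.
have gap : (x - y - (x' - y')) ^+ 2 <= 32 * K ^+ 2 * relative_gap (`|x - x'|, `|y - y'|).
  rewrite (_ : (x - y - (x' - y')) ^+ 2 = (`|x - x'| - `|y - y'|) ^+ 2).
    exact: sqrB_le_relative_gap.
  rewrite [RHS]sqrrB !real_normK ?num_real// -normrM ger0_norm//; ring.
exact: (le_gaps_ball (ltW K2) (ltW ic) M0 M0' G0 gap (inv _ _ near)).
Qed.

End displacement_bound.

(** * Transport from midpoint gaps *)

Section tensor.
Local Open Scope ereal_scope.

Lemma ge0_integral_tensor d (T : measurableType d) (R : realType)
    (P : probability T R) (f g : T -> \bar R) :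
  measurable_fun setT f -> measurable_fun setT g ->
  (forall x, 0 <= f x) -> (forall x, 0 <= g x) ->
  \int[P \x P]_w (f w.1 * g w.2) = \int[P]_x f x * \int[P]_x g x.
Proof.
move=> mf mg f0 g0.
have mfg : measurable_fun setT (fun w : T * T => f w.1 * g w.2).
  by apply: emeasurable_funM; exact: measurableT_comp.
have fg0 (w : T * T) : 0 <= f w.1 * g w.2 by rewrite mule_ge0.
have := @fubini_tonelli1 _ _ _ _ _ P P _ mfg fg0; rewrite /= => ->.
rewrite /fubini_F/=.
under eq_integral => x _.
  rewrite ge0_integralZl//.
  over.
by rewrite ge0_integralZr//; exact: integral_ge0.
Qed.

Lemma ge0_integral_fst d (T : measurableType d) (R : realType)
    (P : probability T R) (f : T -> \bar R) :
  measurable_fun setT f -> (forall x, 0 <= f x) ->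
  \int[P \x P]_w f w.1 = \int[P]_x f x.
Proof.
move=> mf f0; have := ge0_integral_tensor P mf (measurable_cst 1) f0 (fun=> lee01).
rewrite integral_cst//; have /= -> := @probability_setT _ _ _ P.
by rewrite !mule1; under eq_integral do rewrite mule1.
Qed.

Lemma ge0_integral_snd d (T : measurableType d) (R : realType)
    (P : probability T R) (f : T -> \bar R) :
  measurable_fun setT f -> (forall x, 0 <= f x) ->
  \int[P \x P]_w f w.2 = \int[P]_x f x.
Proof.
move=> mf f0; have := ge0_integral_tensor P (measurable_cst 1) mf (fun=> lee01) f0.
rewrite integral_cst//; have /= -> := @probability_setT _ _ _ P.
by rewrite !mul1e; under eq_integral do rewrite mul1e.
Qed.

Lemma half_sum_le (R : realType) (a b : \bar R) : 0 <= a -> 0 <= b ->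
  2^-1%:E * (a + a + b) <= a + b.
Proof.
case: a => [a| |]//; case: b => [b| |]// a0 b0; last 3 first; do ?exact: leey.
by rewrite -!EFinD -EFinM lee_fin; rewrite !lee_fin in a0 b0; lra.
Qed.

End tensor.

Section midpoint_transport.
Local Open Scope ereal_scope.
Context (R : realType) (V : R -> R) (muV : probability R R) (c r rho : R).
Hypothesis V_C2 : C2 V.
Hypothesis V_convex : convex_on_line V.
Hypothesis rho0 : (0 < rho)%R.
Hypothesis r0 : (0 < r)%R.
Hypothesis V_far : forall x, (r <= `|x| -> rho <= (V^`(2))%classic x)%R.
Hypothesis V_ge : forall x, (c <= V x)%R.
Hypothesis muV_min : equilibrium_measure V muV.
Hypothesis muV_fin : log_energy V muV != +oo.

Let mV : measurable_fun setT V := continuous_measurable_fun (C2_continuous V_C2).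

Lemma quantile_ae_neq (mu : probability R R) : log_energy V mu != +oo ->
  {ae unif R \x unif R, forall w, quantile mu w.1 != quantile mu w.2}.
Proof.
rewrite (log_energy_quantile V) => fin.
by have [] := finite_energy_law mV fin.
Qed.

(** The interpolation at time [1/2], integrated against an independent point that
    falls in [A]. *)
Lemma midpoint_transport (x0 kappa delta : R) (A : set R) :
  measurable A -> (forall x, A x -> `|x - x0| <= delta)%R -> muV A != 0 ->
  (0 < kappa)%R -> (0 < delta)%R ->
  (forall u, `|u - x0| <= 2 * delta -> kappa <= (V^`(2))%classic u)%R ->
  exists2 C : R, (0 < C)%R & forall mu : probability R R,
    C%:E * wasserstein 2 mu muV ^+ 2 <= log_energy V mu - log_energy V muV.
Proof.
move=> mA A_near A0 kappa0 delta0 V_near.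
have Afin : muV A \is a fin_num by exact: fin_num_measure.
have [C1 C10 HC1] := displacement_le_gaps V_C2 V_convex rho0 r0 V_far kappa0 delta0 V_near.
have a0 : (0 < fine (muV A))%R.
  by rewrite fine_gt0// lt0e A0 measure_ge0/= -ge0_fin_numE.
exists (fine (muV A) / C1)%R; first by rewrite divr_gt0.
move=> mu.
have [mu_infty|mu_fin] := eqVneq (log_energy V mu) +oo.
  rewrite mu_infty; have := log_energyB_fin mV muV_fin muV_fin.
  by rewrite fin_numB => /andP[/fineK <- _]; rewrite leey.
set X := quantile muV; set Y := quantile mu.
have mX : measurable_fun setT X := measurable_quantile muV.
have mY : measurable_fun setT Y := measurable_quantile mu.
have half : (0 < (2^-1 : R) < 1)%R by apply/andP; split; lra.
have mh := measurable_midpoint_gap V_C2.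
have mk := @measurable_relative_gap R.
have h0 z : (0 <= midpoint_gap V z)%R by exact: midpoint_gap_ge0.
have k0 := @relative_gap_ge0 R.
have hV x y : (V ((1 - 2^-1) * x + 2^-1 * y) + midpoint_gap V (x, y) <=
    (1 - 2^-1) * V x + 2^-1 * V y)%R.
  by rewrite addrC subrK.
have kV (a b : R) : (0 < a)%R -> (0 < b)%R -> ((1 - 2^-1) * ln a + 2^-1 * ln b +
    relative_gap (a, b) <= ln ((1 - 2^-1) * a + 2^-1 * b))%R.
  move=> apos bpos; have := ln_midpoint_gap apos bpos.
  by rewrite relative_gapE// (_ : 1 - 2^-1 = 2^-1 :> R)%R//; field.
pose U2 := (measurableTypeR R * measurableTypeR R)%type.
pose H := fun w : measurableTypeR R => (midpoint_gap V (X w, Y w))%:E.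
pose G := fun w : U2 =>
  (relative_gap (`|X w.1 - X w.2|, `|Y w.1 - Y w.2|)%R)%:E.
have gap : \int[unif R]_w H w + \int[unif R \x unif R]_w G w <=
    2^-1%:E * (log_energy V mu - log_energy V muV).
  exact: (quantile_displacement_gap mV V_ge muV_min muV_fin mu_fin half mh mk h0 k0 hV kV).
pose D := fun w : measurableTypeR R => ((X w - Y w) ^+ 2)%:E.
have mD : measurable_fun setT D.
  by apply/measurable_EFinP; apply: measurable_funX; exact: measurable_funB.
have D0 w : 0 <= D w by rewrite lee_fin sqr_ge0.
pose I := fun w : measurableTypeR R => (\1_A (X w) : R)%:E.
have mI : measurable_fun setT I.
  by apply/measurable_EFinP; exact: (measurableT_comp (measurable_indic _)).
have I0 w : 0 <= I w by rewrite lee_fin.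
have II : \int[unif R]_w I w = muV A.
  have -> : I = (fun w => (\1_(X @^-1` A) w)%:E) by [].
  have mXA : measurable (X @^-1` A) by rewrite -[_ @^-1` _]setTI; exact: mX.
  by rewrite integral_indic// setIT law_quantile.
have WD : wasserstein 2 mu muV ^+ 2 <= \int[unif R]_w D w.
  rewrite sqre_poweR ?wasserstein_ge0//.
  have two0 : (0 < (2 : R))%R by [].
  apply: (le_trans (wasserstein_quantile_le muV mu two0)).
  under eq_integral do rewrite powR_mulrn// real_normK ?num_real//.
  exact: lexx.
have mH : measurable_fun setT H.
  apply/measurable_EFinP; apply: (measurableT_comp mh).
  exact: measurable_fun_pair.
have mG : measurable_fun setT G.
  apply/measurable_EFinP; apply: (measurableT_comp mk).
  by apply: measurable_fun_pair; exact: measurable_normrB.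
have H0 w : 0 <= H w by rewrite lee_fin.
have G0 w : 0 <= G w by rewrite lee_fin.
have key : (\int[unif R]_w D w) * muV A <=
    C1%:E * (\int[unif R]_w H w + \int[unif R]_w H w + \int[unif R \x unif R]_w G w).
  have mH1 : measurable_fun setT (fun w : U2 => H w.1) by exact: measurableT_comp mH _.
  have mH2 : measurable_fun setT (fun w : U2 => H w.2) by exact: measurableT_comp mH _.
  rewrite -II -ge0_integral_tensor//.
  rewrite -{1}(ge0_integral_fst (unif R) mH H0) -(ge0_integral_snd (unif R) mH H0).
  rewrite -ge0_integralD//.
  rewrite -ge0_integralD//; last 2 first.
  - by move=> w _; rewrite adde_ge0.
  - exact: emeasurable_funD.
  rewrite -ge0_integralZl//; last 3 first.
  - by do ?apply: emeasurable_funD.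
  - by move=> w _; rewrite !adde_ge0.
  - by rewrite lee_fin ltW.
  have F := ae_filter_ringOfSetsType (unif R \x unif R).
  apply: ae_ge0_le_integral => //.
  - by move=> w _; rewrite mule_ge0.
  - by apply: emeasurable_funM; exact: measurableT_comp.
  - by move=> w _; rewrite mule_ge0 ?adde_ge0// lee_fin ltW.
  - by apply: measurable_funeM; do ?apply: emeasurable_funD.
  apply: (@filterS3 _ _ F) (quantile_ae_neq muV_fin) (quantile_ae_neq mu_fin)
    (quantile_comonotone muV mu) => w Xw Yw mono _.
  rewrite /I indicE; case: (boolP (X w.2 \in A)) => [|_]; last first.
    by rewrite mule0 mule_ge0 ?adde_ge0// lee_fin ltW.
  rewrite inE => /A_near wA; rewrite mule1.
  exact: HC1 wA mono Xw Yw.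
have c1 : 0 <= (fine (muV A) / C1)%:E by rewrite lee_fin ltW// divr_gt0.
apply: (@le_trans _ _ ((fine (muV A) / C1)%:E * \int[unif R]_w D w)).
  exact: lee_wpmul2l.
set ID := \int[unif R]_w D w in key *.
set IH := \int[unif R]_w H w in gap key.
set IG := \int[unif R \x unif R]_w G w in gap key.
have IH0 : 0 <= IH by exact: integral_ge0.
have IG0 : 0 <= IG by exact: integral_ge0.
have fE := log_energyB_fin mV muV_fin mu_fin.
rewrite -(@lee_pmul2l _ C1%:E) ?lte_fin//.
rewrite muleA -EFinM mulrCA mulfV ?gt_eqF// mulr1 fineK// muleC.
apply: (le_trans key); apply: lee_wpmul2l; first by rewrite lee_fin ltW.
rewrite -(@lee_pmul2l _ 2^-1%:E) ?lte_fin ?invr_gt0//.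
by apply: le_trans gap; exact: half_sum_le.
Qed.
End midpoint_transport.

(** * Quadratic potentials *)

Section coupling.
Local Open Scope ereal_scope.
Context (R : realType).

(** For a coupling of measures whose means differ by [m], integrate
    [(x - y) ^ 2 >= 2 * m * (x - y) - m ^ 2]. *)
Lemma coupling_means_le (mu nu : probability R R) (pi : probability (R * R)%type R) (m : R) :
  coupling mu nu pi ->
  mu.-integrable setT (EFin \o id) -> nu.-integrable setT (EFin \o id) ->
  (\int[mu]_x x - \int[nu]_x x = m)%R ->
  (m ^+ 2)%:E <= \int[pi]_z (`|z.1 - z.2| `^ 2)%:E.
Proof.
move=> cpl imu inu mE.
have mid : measurable_fun setT (EFin \o id : R -> \bar R) by exact/measurable_EFinP.
have mf : measurable_fun setT (fst : R * R -> R) by exact: measurable_fst.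
have ms : measurable_fun setT (snd : R * R -> R) by exact: measurable_snd.
have E1 (f : R -> \bar R) : \int[mu]_x f x = \int[law pi mf]_x f x.
  by apply: eq_measure_integral => A mA _; have [] := cpl A mA.
have E2 (f : R -> \bar R) : \int[nu]_x f x = \int[law pi ms]_x f x.
  by apply: eq_measure_integral => A mA _; have [] := cpl A mA.
have if1 : pi.-integrable setT (EFin \o fst).
  apply/(integrable_law pi mf mid); apply/integrableP; split => //.
  by rewrite -E1; case/integrableP : imu.
have is2 : pi.-integrable setT (EFin \o snd).
  apply/(integrable_law pi ms mid); apply/integrableP; split => //.
  by rewrite -E2; case/integrableP : inu.
have M1 : (\int[pi]_z z.1 = \int[mu]_x x)%R.
  by rewrite /Rintegral E1 (integral_law _ mid).
have M2 : (\int[pi]_z z.2 = \int[nu]_x x)%R.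
  by rewrite /Rintegral E2 (integral_law _ mid).
have mc : measurable_fun setT (fun z : R * R => (`|z.1 - z.2| `^ 2)%:E).
  by apply/measurable_EFinP; exact: (measurable_cost 2 mf ms).
have [->|lt_infty] := eqVneq (\int[pi]_z (`|z.1 - z.2| `^ 2)%:E) +oo; first exact: leey.
have ic : pi.-integrable setT (fun z : R * R => (`|z.1 - z.2| `^ 2)%:E).
  apply/integrableP; split => //; rewrite ltey.
  by under eq_integral do rewrite gee0_abs ?lee_fin ?powR_ge0//.
pose g (z : R * R) : R := (2 * m * (z.1 - z.2) + - m ^+ 2)%R.
have id_ : pi.-integrable setT (EFin \o (fun z : R * R => z.1 - z.2)%R).
  apply: eq_integrable (integrableB measurableT if1 is2) => //.
have ig1 : pi.-integrable setT (EFin \o (fun z : R * R => 2 * m * (z.1 - z.2))%R).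
  apply: eq_integrable (integrableZl measurableT (2 * m) id_) => //.
have ik : pi.-integrable setT (EFin \o cst (- m ^+ 2)%R).
  exact: (@finite_measure_integrable_cst _ _ _ pi setT (- m ^+ 2)%R measurableT).
have ig : pi.-integrable setT (EFin \o g).
  apply: eq_integrable (integrableD measurableT ig1 ik) => //.
have -> : (m ^+ 2)%:E = \int[pi]_z (g z)%:E.
  rewrite -EFin_Rintegral//; congr EFin; rewrite /g.
  rewrite (RintegralD measurableT ig1 ik) (RintegralZl _ measurableT id_).
  rewrite (RintegralB measurableT if1 is2) M1 M2 mE.
  rewrite Rintegral_cst//; have /= -> := @probability_setT _ _ _ pi.
  by rewrite mulr1; ring.
apply: le_integral => // z _; rewrite lee_fin /g powR_mulrn// real_normK ?num_real//.
rewrite -subr_ge0 (_ : _ - _ = (z.1 - z.2 - m) ^+ 2)%R ?sqr_ge0//; ring.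
Qed.

Lemma wasserstein2_mean_ge (mu nu : probability R R) (m : R) :
  mu.-integrable setT (EFin \o id) -> nu.-integrable setT (EFin \o id) ->
  (\int[mu]_x x - \int[nu]_x x = m)%R ->
  (m ^+ 2)%:E <= wasserstein 2 mu nu ^+ 2.
Proof.
move=> imu inu mE; rewrite sqre_poweR ?wasserstein_ge0//.
have h : `|m|%:E <= wasserstein 2 mu nu.
  apply: le_ereal_inf_tmp => _ [pi cpl <-].
  have -> : `|m|%:E = poweR (m ^+ 2)%:E 2^-1.
    rewrite poweR_EFin -(real_normK (num_real m)) -powR_mulrn// -powRrM mulfV//.
    by rewrite powRr1.
  apply: gt0_ler_poweR; rewrite ?in_itv/= ?andbT ?leey ?lee_fin ?sqr_ge0//.
    by rewrite integral_ge0// => z _; rewrite lee_fin powR_ge0.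
  exact: coupling_means_le cpl imu inu mE.
have -> : (m ^+ 2)%:E = poweR `|m|%:E 2.
  by rewrite poweR_EFin powR_mulrn// real_normK ?num_real.
apply: gt0_ler_poweR; rewrite ?in_itv/= ?andbT ?leey ?lee_fin ?wasserstein_ge0//.
by rewrite normr_ge0.
Qed.

End coupling.

Section quadratic.
Context (R : realType) (V : R -> R) (muV : probability R R) (rho : R).
Hypothesis rho0 : 0 < rho.
Hypothesis VE : forall x, V x = rho * x ^+ 2.
Hypothesis muV_min : equilibrium_measure V muV.

Let cV : continuous V.
Proof.
have -> : V = (fun x => rho * x ^+ 2) by apply/funext.
by move=> x; apply: cvgM; [exact: cvg_cst|exact: exprn_continuous].
Qed.

Let mV : measurable_fun setT V := continuous_measurable_fun cV.
Let mid : measurable_fun setT (id : R -> R) := @measurable_id _ R setT.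
Let muV_fin : log_energy V muV != +oo%E.
Proof. exact: equilibrium_log_energy_fin. Qed.

Let eX : finite_energy muV V id.
Proof. by apply: (finite_energy_law mV (mX := mid)); rewrite -log_energy_id. Qed.

Let iV : muV.-integrable setT (EFin \o V). Proof. by case: eX. Qed.

Let icst (k : R) : muV.-integrable setT (EFin \o cst k).
Proof. exact: (@finite_measure_integrable_cst _ _ _ muV setT k measurableT). Qed.

Lemma quadratic_equilibrium_integrable : muV.-integrable setT (EFin \o (id : R -> R)).
Proof.
have iW := integrableZl measurableT rho^-1 iV.
apply: (@ae_le_integrable _ _ _ muV id (fun x => 1 + rho^-1 * V x) mid).
  by apply: eq_integrable (integrableD measurableT (icst 1) iW) => //.
apply: aeW => x; rewrite VE mulKf ?gt_eqF// ler_norml.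
by apply/andP; split; have := sqr_ge0 (x - 1); have := sqr_ge0 (x + 1); nra.
Qed.

Let iX := quadratic_equilibrium_integrable.
Let mean := (\int[muV]_x x)%R.

Let cancel_arith (a b k : R) : a + k - b - (a - b) = k.
Proof. by ring. Qed.

Let translate_law m : log_energy V (translate m muV) =
  log_energy V (law muV (measurable_translation m)).
Proof. exact: eq_log_energy. Qed.

Let i2m m : muV.-integrable setT (EFin \o (fun x => 2 * rho * m * x)).
Proof. by apply: eq_integrable (integrableZl measurableT (2 * rho * m) iX). Qed.

Let i2mk m : muV.-integrable setT (EFin \o (fun x => 2 * rho * m * x + rho * m ^+ 2)).
Proof.
by apply: eq_integrable (integrableD measurableT (i2m m) (icst (rho * m ^+ 2))).
Qed.

Let VtE m x : V (translation m x) = V x + (2 * rho * m * x + rho * m ^+ 2).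
Proof. by rewrite /translation !VE; ring. Qed.

Let iVt m : muV.-integrable setT (fun x => (V (translation m x))%:E).
Proof.
apply: eq_integrable (integrableD measurableT iV (i2mk m)) => // x _.
by rewrite VtE.
Qed.

Let eXt m : finite_energy muV V (translation m).
Proof.
have [_ neq il] := eX; split; first exact: iVt.
- by apply: filterS neq => w; rewrite /translation (inj_eq (addIr m)).
- by apply: eq_integrable il => // w _; rewrite /translation opprD addrACA subrr addr0.
Qed.

Lemma quadratic_energy_translate (m : R) : (log_energy V (translate m muV) -
  log_energy V muV)%E = (2 * rho * m * mean + rho * m ^+ 2)%:E.
Proof.
rewrite translate_law [log_energy V muV]log_energy_id (log_energy_law mV _ eX) (log_energy_law mV _ (eXt m)).
have [_ _ il] := eX.
have -> : (\int[muV \x muV]_w (ln `|translation m w.1 - translation m w.2|)%:E =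
    \int[muV \x muV]_w (ln `|id w.1 - id w.2|)%:E)%E.
  by apply: eq_integral => w _; rewrite /translation opprD addrACA subrr addr0.
rewrite -(EFin_Rintegral il) -(EFin_Rintegral (iVt m)) -(EFin_Rintegral iV).
rewrite -!EFinB; congr EFin.
have -> : (\int[muV]_x V (translation m x) =
    \int[muV]_x (V x + (2 * rho * m * x + rho * m ^+ 2)))%R.
  by congr fine; apply: eq_integral => x _; rewrite VtE.
rewrite (RintegralD measurableT iV (i2mk m)) (RintegralD measurableT (i2m m) (icst _)).
rewrite (RintegralZl _ measurableT iX) Rintegral_cst//.
have /= -> := @probability_setT _ _ _ muV.
by rewrite mulr1; exact: cancel_arith.
Qed.

(** The energy of the translate by [m] is quadratic in [m] and minimal at [m = 0];
    the choice [m = - mean] contradicts minimality unless the mean vanishes. *)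
Lemma quadratic_equilibrium_mean : mean = 0.
Proof.
have h : 0 <= 2 * rho * - mean * mean + rho * (- mean) ^+ 2.
  have := log_energyB_fin mV muV_fin muV_fin; rewrite fin_numB => /andP[fin _].
  rewrite -lee_fin -quadratic_energy_translate sube_ge0 ?fin//; exact: muV_min.
apply/eqP; rewrite -sqrf_eq0 eq_le sqr_ge0 andbT -(pmulr_rle0 _ rho0).
rewrite (_ : _ + _ = - (rho * mean ^+ 2)) in h; last by ring.
by rewrite -oppr_ge0.
Qed.

Lemma quadratic_wasserstein_translate (m : R) :
  (wasserstein 2 (translate m muV) muV ^+ 2)%E = (m ^+ 2)%:E.
Proof.
apply/eqP; rewrite eq_le; apply/andP; split.
  rewrite sqre_poweR ?wasserstein_ge0//.
  have two0 : 0 < (2 : R) by [].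
  apply: (le_trans (wasserstein_law_le (P := muV) (mX := measurable_translation m)
    (mY := mid) two0 _ _)) => //.
  rewrite (eq_integral (cst (m ^+ 2)%:E)); last first.
    by move=> x _; rewrite /translation addrAC subrr add0r powR_mulrn// real_normK ?num_real.
  rewrite integral_cst//; have /= -> := @probability_setT _ _ _ muV.
  by rewrite mule1.
have it : (law muV (measurable_translation m)).-integrable setT (EFin \o (id : R -> R)).
  apply/integrable_law; first exact/measurable_EFinP.
  by apply: eq_integrable (integrableD measurableT iX (icst m)).
apply: wasserstein2_mean_ge => //.
have -> : (\int[translate m muV]_x x = \int[muV]_x (x + m))%R.
  congr fine; apply: (@integral_law _ _ _ muV _ _ _ (measurable_translation m) (EFin \o id)).
    exact/measurable_EFinP.
  by apply: eq_integrable (integrableD measurableT iX (icst m)).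
rewrite (RintegralD measurableT iX (icst m)) Rintegral_cst//.
have /= -> := @probability_setT _ _ _ muV.
by rewrite mulr1 addrAC subrr add0r.
Qed.

Lemma quadratic_transport_equality (m : R) :
  (rho%:E * wasserstein 2 (translate m muV) muV ^+ 2 =
    log_energy V (translate m muV) - log_energy V muV)%E.
Proof.
rewrite quadratic_wasserstein_translate quadratic_energy_translate.
by rewrite quadratic_equilibrium_mean mulr0 add0r -EFinM.
Qed.

Lemma quadratic_constant_sharp (k : R) :
  (forall mu : probability R R, (k%:E * wasserstein 2 mu muV ^+ 2 <=
    log_energy V mu - log_energy V muV)%E) -> k <= rho.
Proof.
move=> /(_ (translate 1 muV)).
rewrite -quadratic_transport_equality quadratic_wasserstein_translate.
by rewrite expr1n !mule1 lee_fin.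
Qed.

End quadratic.

(** * Transport inequalities for convex potentials *)

Section inequalities.
Context (R : realType) (V : R -> R) (muV : probability R R) (c : R).
Hypothesis V_C2 : C2 V.
Hypothesis V_ge : forall x, (c <= V x)%R.
Hypothesis muV_min : equilibrium_measure V muV.
Hypothesis muV_fin : log_energy V muV != +oo%E.

Let mV : measurable_fun setT V := continuous_measurable_fun (C2_continuous V_C2).
Let cV'' : continuous (V^`(2))%classic. Proof. by case: V_C2. Qed.

Lemma transport_strongly_convex (rho : R) (mu : probability R R) : 0 < rho ->
  convex_on_line (fun x => V x - rho * x ^+ 2) ->
  (rho%:E * wasserstein 2 mu muV ^+ 2 <= log_energy V mu - log_energy V muV)%E.
Proof.
move=> rho0 cV; rewrite sqre_poweR ?wasserstein_ge0//.
apply: (transport_inequality mV V_ge muV_min muV_fin) => //; first exact: ltW.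
move=> t x y /andP[t0 t1].
have t01 : 0 <= t <= 1 by rewrite !ltW.
have := convex_on_lineE x y cV t01.
rewrite !powR_mulrn ?subr_ge0 ?(ltW t1)// real_normK ?num_real// => convexity.
(* [t * (1 - t) - t * (1 - t) ^ 2 = t * t * (1 - t)] *)
have gap : 0 <= rho * (t * t * (1 - t) * (x - y) ^+ 2).
  have s0 : 0 <= 1 - t by rewrite subr_ge0 ltW.
  have t0' := ltW t0.
  exact: mulr_ge0 (ltW rho0) (mulr_ge0 (mulr_ge0 (mulr_ge0 t0' t0') s0) (sqr_ge0 _)).
rewrite -subr_ge0; rewrite -subr_ge0 in convexity.
apply: le_trans (addr_ge0 convexity gap) _.
by rewrite le_eqVlt; apply/orP; left; apply/eqP; ring.
Qed.

Let half_le (a b : R) : a - b < a / 2 -> a / 2 <= b.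
Proof. by lra. Qed.

Lemma transport_convex (r rho : R) : 0 < rho -> convex_on_line V ->
  (forall x, r <= `|x| -> rho <= (V^`(2))%classic x) ->
  exists2 C : R, 0 < C & forall mu : probability R R,
    (C%:E * wasserstein 2 mu muV ^+ 2 <= log_energy V mu - log_energy V muV)%E.
Proof.
move=> rho0 cV far.
have r1 : 0 < Num.max r 1 by rewrite lt_max ltr01 orbT.
have far1 x : Num.max r 1 <= `|x| -> rho <= (V^`(2))%classic x.
  by rewrite ge_max => /andP[rx _]; exact: far.
have [x0 V''x0 x0_supp] := curvature_on_support V_C2 V_ge rho0 far muV_min muV_fin.
have kappa0 : 0 < (V^`(2))%classic x0 / 2 by rewrite divr_gt0.
have /cvgrPdist_lt/(_ _ kappa0) := @cV'' x0.
move=> /nbhs_ballP[e /= e0 He].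
have delta0 : 0 < e / 4 by rewrite divr_gt0.
have near u : `|u - x0| <= 2 * (e / 4) -> (V^`(2))%classic x0 / 2 <= (V^`(2))%classic u.
  move=> ue; have : `|(V^`(2))%classic x0 - (V^`(2))%classic u| < (V^`(2))%classic x0 / 2.
    by apply: He; rewrite /ball/= distrC (le_lt_trans ue)//; lra.
  by rewrite ltr_norml => /andP[_ /half_le].
apply: (midpoint_transport V_C2 cV rho0 r1 far1 V_ge muV_min muV_fin
  (A := `]x0 - e / 4, x0 + e / 4[%classic) _ _ (x0_supp _ delta0) kappa0 delta0 near).
- exact: measurable_itv.
- by move=> x /=; rewrite in_itv/= ler_norml => /andP[? ?]; apply/andP; split; lra.
Qed.

(** The second difference of [V] at [0] is at least [2 * rho * h `^ p] and at most
    of order [h ^ 2]. *)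
Lemma C2_power_exponent_ge2 (rho p : R) : 0 < rho -> 1 < p ->
  convex_on_line (fun x => V x - rho * `|x| `^ p) -> 2 <= p.
Proof.
move=> rho0 p1 cV; rewrite leNgt; apply/negP => p2.
have [e e0 He] := @uniform_upper_modulus R _ 0 1 cV'' ltr01.
set K : R := (V^`(2))%classic 0 + 1.
have key h : 0 < h -> h <= e -> 2 * rho <= K * h `^ (2 - p).
  move=> h0 he.
  have half : 0 <= (2^-1 : R) <= 1 by apply/andP; split; lra.
  have := convex_on_lineE h (- h) cV half.
  have -> : (1 - 2^-1) * h + 2^-1 * - h = 0 by field.
  rewrite normrN normr0 powR0; last by rewrite gt_eqF//; lra.
  rewrite gtr0_norm// mulr0 subr0 => C.
  have := @second_difference_upper R V V_C2 0 h K (ltW h0).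
  rewrite add0r sub0r => U.
  have {}U : V h + V (- h) - 2 * V 0 <= K * h ^+ 2.
    apply: U => y; rewrite subr0 => yh; apply: He; first by rewrite normr0.
    by rewrite subr0; exact: le_trans yh he.
  have hp : 0 < h `^ p by rewrite powR_gt0.
  rewrite -(ler_pM2r hp) -[leRHS]mulrA -powRD; last by rewrite (gt_eqF h0) implybT.
  rewrite subrK powR_mulrn ?(ltW h0)//.
  move: C U; move: (V 0) (V h) (V (- h)) (h `^ p) (K * h ^+ 2) => a b d f g; lra.
have q0 : 0 < 2 - p by lra.
have K0 : 0 < K.
  rewrite ltNge; apply/negP => K0; have := key e e0 (lexx e).
  have : K * e `^ (2 - p) <= 0 by rewrite mulr_le0_ge0 ?powR_ge0.
  by move: (K * _) => a; lra.
(* this [h] gives [K * h `^ (2 - p) <= rho] *)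
pose h := Num.min e ((rho / K) `^ (2 - p)^-1).
have h0 : 0 < h by rewrite lt_min e0 powR_gt0// divr_gt0.
have he : h <= e by rewrite ge_min lexx.
have := key h h0 he.
have : K * h `^ (2 - p) <= rho.
  rewrite -ler_pdivlMl// mulrC.
  have -> : rho / K = ((rho / K) `^ (2 - p)^-1) `^ (2 - p).
    by rewrite -powRrM mulVf ?gt_eqF// powRr1// divr_ge0 ?ltW.
  by apply: ge0_ler_powR; rewrite ?nnegrE ?powR_ge0 ?(ltW h0) ?(ltW q0)// ge_min lexx orbT.
by move: (K * _) => a; lra.
Qed.

Lemma transport_power_convex (rho p : R) (mu : probability R R) : 0 < rho -> 1 < p ->
  convex_on_line (fun x => V x - rho * `|x| `^ p) ->
  ((cp p * rho)%:E * poweR (wasserstein p mu muV) p <=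
    log_energy V mu - log_energy V muV)%E.
Proof.
move=> rho0 p1 cV; have p0 : 0 < p by lra.
apply: (transport_inequality mV V_ge muV_min muV_fin) => //.
  by rewrite mulr_ge0 ?cp_ge0// ltW.
move=> t x y t01; have t01' : 0 <= t <= 1 by case/andP: t01 => *; rewrite !ltW.
have C := convex_on_lineE x y cV t01'.
have := ler_wpM2l (ltW rho0) (powR_uniformly_convex x y p1 t01).
rewrite !(mulrDr rho) => P.
rewrite -subr_ge0; rewrite -subr_ge0 in C; rewrite -subr_ge0 in P.
apply: le_trans (addr_ge0 C P) _.
by rewrite le_eqVlt; apply/orP; left; apply/eqP; ring.
Qed.

End inequalities.

Theorem theorem2 (R : realType) (V : R -> R) (muV : probability R R)
    (hV : potential V) (hmuV : equilibrium_measure V muV) :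
  [/\ (forall rho : R, 0 < rho ->
        (C2 V -> convex_on_line (fun x => V x - rho * x ^+ 2) ->
          forall mu : probability R R,
            (rho%:E * wasserstein 2 mu muV ^+ 2
               <= log_energy V mu - log_energy V muV)%E) /\
        ((forall x, V x = rho * x ^+ 2) ->
          (forall m : R,
            (rho%:E * wasserstein 2 (translate m muV) muV ^+ 2
               = log_energy V (translate m muV) - log_energy V muV)%E) /\
          (forall c : R,
            (forall mu : probability R R,
              (c%:E * wasserstein 2 mu muV ^+ 2
                 <= log_energy V mu - log_energy V muV)%E) ->
            c <= rho))),
      (forall r rho : R, 0 < rho -> C2 V -> convex_on_line V ->
        (forall x, r <= `|x| -> rho <= (V^`(2))%classic x) ->
        exists2 C : R, 0 < C &
          forall mu : probability R R,
            (C%:E * wasserstein 2 mu muV ^+ 2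
               <= log_energy V mu - log_energy V muV)%E) &
      (forall rho p : R, 0 < rho -> 1 < p -> C2 V ->
        convex_on_line (fun x => V x - rho * `|x| `^ p) ->
        0 < cp p /\
        forall mu : probability R R,
          ((cp p * rho)%:E * poweR (wasserstein p mu muV) p
             <= log_energy V mu - log_energy V muV)%E)].
Proof.
split=> [rho rho0|r rho rho0 V_C2 cV far|rho p rho0 p1 V_C2 cV].
- split=> [V_C2 cV mu|VE]; last first.
    split=> [m|k]; first exact: quadratic_transport_equality.
    exact: quadratic_constant_sharp.
  have V_cont := C2_continuous V_C2.
  have [c V_ge] := potential_lower_bound hV V_cont.
  exact: (transport_strongly_convex V_C2 V_ge hmuV
    (equilibrium_log_energy_fin V_cont hmuV)).
- have V_cont := C2_continuous V_C2.
  have [c V_ge] := potential_lower_bound hV V_cont.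
  exact: (transport_convex V_C2 V_ge hmuV
    (equilibrium_log_energy_fin V_cont hmuV) rho0 cV far).
- have V_cont := C2_continuous V_C2.
  have [c V_ge] := potential_lower_bound hV V_cont.
  have p2 := C2_power_exponent_ge2 V_C2 rho0 p1 cV.
  split=> [|mu]; first exact: cp_gt0.
  exact: (transport_power_convex V_C2 V_ge hmuV
    (equilibrium_log_energy_fin V_cont hmuV) mu rho0 p1 cV).
Qed.
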